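(* Let $p$ be a prime and fix a branch $\varpi\in\mathbb{C}_p$. Let $n_1,\ldots,n_r\in\mathbb{N}$ and $\xi_1,\ldots,\xi_r\in\mathbb{C}_p$ with $|\xi_j|_p=1$ $(1\leqslant j\leqslant r)$. The equality $$\ell^{(p)}_{n_1,\ldots,n_r}(\xi_1,\ldots,\xi_r;z)=\frac{1}{p^r}\sum_{0<\alpha_1,\ldots,\alpha_r<p}\ \sum_{\rho_1^p=\cdots=\rho_r^p=1}\rho_1^{-\alpha_1}\cdots\rho_r^{-\alpha_r}\,Li^{(p),\varpi}_{n_1,\ldots,n_r}(\rho_1\xi_1,\ldots,\rho_r\xi_r;z)$$ holds for $z\in\mathbf{P}^1(\mathbb{C}_p)-]S_r\setminus\{\bar0\}[$, where $S_r=\{\bar0,\overline\infty,\overline{\xi_r^{-1}},\overline{(\xi_{r-1}\xi_r)^{-1}},\ldots,\overline{(\xi_1\cdots\xi_r)^{-1}}\}\subset\mathbf{P}^1(\overline{\mathbb{F}}_p)$.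
   Context: Let ${\rm red}:\mathbf{P}^1(\mathbb{C}_p)\to\mathbf{P}^1(\overline{\mathbb{F}}_p)$ be the reduction map, $\bar a={\rm red}(a)$, $]S[={\rm red}^{-1}(S)$. $A^{\rm rig}(X)$ is the algebra of rigid analytic functions on $X$. **Rigid TMPL.** For $|\xi_j|_p=1$, $$\ell^{(p)}_{n_1,\ldots,n_r}(\xi_1,\ldots,\xi_r;z)=\sum_{\substack{0<k_1<\cdots<k_r\\(k_1,p)=\cdots=(k_r,p)=1}}\frac{\xi_1^{k_1}\cdots\xi_r^{k_r}}{k_1^{n_1}\cdots k_r^{n_r}}z^{k_r}\qquad(|z|_p<1),$$ which extends uniquely to a rigid analytic function on $\mathbf{P}^1(\mathbb{C}_p)-]S[$, $S=\{\overline{\xi_r^{-1}},\overline{(\xi_{r-1}\xi_r)^{-1}},\ldots,\overline{(\xi_1\cdots\xi_r)^{-1}}\}$; the same symbol denotes the extension. **Coleman functions.** $\log^\varpi:\mathbb{C}_p^\times\to\mathbb{C}_p$ is the locally analytic homomorphism given by the usual series on $1+\mathfrak{M}_{\mathbb{C}_p}$ with $\log^\varpi(p)=\varpi$. For a finite set $S=\{s_0,\ldots,s_d\}\subset\mathbf{P}^1(\overline{\mathbb{F}}_p)$ choose local parameters $z_i:\,]s_i[\,\simeq\,]\bar0[$ and let $U_\lambda$ $(0<\lambda<1)$ be $\mathbf{P}^1(\mathbb{C}_p)$ minus the discs $\{|z_i|_p\leqslant\lambda\}$. $A^\dag(\mathbf{P}^1\setminus S)=\varinjlim_{\lambda\to1^-}A^{\rm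 rig}(U_\lambda)$, $\Omega^{\dag,1}(\mathbf{P}^1\setminus S)=A^\dag(\mathbf{P}^1\setminus S)dz$. $A^\varpi_{\rm loc}(\mathbf{P}^1\setminus S)=\prod_xA^\varpi_{\log}(U(x))$ over $x\in\mathbf{P}^1(\overline{\mathbb{F}}_p)$, where $A^\varpi_{\log}(U(x))=A^{\rm rig}(]x[)$ if $x\notin S$ and $A^\varpi_{\log}(U(s_i))=\varinjlim_{\lambda\to1^-}A^{\rm rig}(]s_i[\,\cap U_\lambda)[\log^\varpi(z_i)]$; $d$ is the componentwise derivative. Coleman's theory gives the $A^\dag(\mathbf{P}^1\setminus S)$-subalgebra $A^\varpi_{\rm Col}(\mathbf{P}^1\setminus S)\subset A^\varpi_{\rm loc}(\mathbf{P}^1\setminus S)$ of Coleman functions and a $\mathbb{C}_p$-linear integration $\int:A^\varpi_{\rm Col}\otimes_{A^\dag}\Omega^{\dag,1}\to A^\varpi_{\rm Col}/\mathbb{C}_p$ with $d\circ\int={\rm id}$; a Coleman function vanishing on a nonempty admissible open subset is $0$. $\int_x^z\eta$ denotes the primitive $F_\eta$ of $\eta$ normalized by $F_\eta(x)=0$. **TMPL.** For $|\xi_j|_p\leqslant1$, $Li^{(p),\varpi}_{n_1,\ldots,n_r}(\xi_1,\ldots,\xi_r;z)\in A^\varpi_{\rm Col}(\mathbf{P}^1\setminus S_r)$ is defined recursively by $Li^{(p),\varpi}_1(\xi_1;z)=\int_0^z\frac{\xi_1dt}{1-\xi_1t}=-\log^\varpi(1-\xi_1z)$, by $\int_0^zLi^{(p),\varpi}_{n_1,\ldots,n_{r-1},n_r-1}(\xi_1,\ldots,\xi_r;t)\frac{dt}{t}$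 if $n_r\neq1$, and by $\int_0^zLi^{(p),\varpi}_{n_1,\ldots,n_{r-1}}(\xi_1,\ldots,\xi_{r-2},\xi_{r-1}\xi_r;t)\frac{\xi_rdt}{1-\xi_rt}$ if $n_r=1$, $r\geqslant2$. For $|z|_p<1$ it equals $\sum_{0<k_1<\cdots<k_r}\frac{\xi_1^{k_1}\cdots\xi_r^{k_r}z^{k_r}}{k_1^{n_1}\cdots k_r^{n_r}}$, and as a function it is defined on an affinoid bigger than $\mathbf{P}^1(\mathbb{C}_p)-]S_r\setminus\{\bar0\}[$. *)

(* Defs.v *)
From HB Require Import structures.
From mathcomp Require Import all_boot all_order all_algebra.
From mathcomp Require Import boolp classical_sets fsbigop reals topology.
From mathcomp Require Import normedtype sequences.

Set Implicit Arguments.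
Unset Strict Implicit.
Unset Printing Implicit Defensive.

Import Order.TTheory GRing.Theory Num.Theory.
Import numFieldNormedType.Exports.

Local Open Scope classical_set_scope.
Local Open Scope ring_scope.

(* P^1(K); None is the point at infinity. *)
Notation P1 K := (option K).

Section Padic.
Context (R : realType) (K : closedFieldType) (v : K -> R).

(* The closure of Q in K, i.e. Q_p when v extends the p-adic absolute value. *)
Definition in_Qp (x : K) : Prop :=
  forall e : R, 0 < e -> exists q : rat, v (x - ratr q) < e.

(* (K, v) is C_p with |p| = 1/p: an algebraically closed field (by the type of
   K), complete, in which the algebraic closure of Q_p is dense.  This
   determines (K, v) up to isometric isomorphism. *)
Record is_Cp (p : nat) : Prop := IsCp {
  Cp_ge0 : forall x, 0 <= v x;
  Cp_eq0 : forall x, v x = 0 <-> x = 0;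
  Cp_mul : forall x y, v (x * y) = v x * v y;
  Cp_ultra : forall x y, v (x + y) <= Num.max (v x) (v y);
  Cp_p : v p%:R = p%:R^-1;
  Cp_complete : forall u : nat -> K,
    (forall e : R, 0 < e -> exists N : nat,
       forall i j, (N <= i)%N -> (N <= j)%N -> v (u i - u j) < e) ->
    exists l : K, (fun i => v (u i - l)) @ \oo --> (0 : R);
  Cp_dense : forall (x : K) (e : R), 0 < e ->
    exists (y : K) (P : {poly K}),
      [/\ P != 0, forall i, in_Qp P`_i, root P y & v (x - y) < e]
}.

Definition is_sum (u : nat -> K) (l : K) : Prop :=
  (fun N : nat => v (\sum_(k < N) u k - l)) @ \oo --> (0 : R).

(* log^varpi.  Local analyticity follows from the functional equation and the
   expansion on 1 + M; there is exactly one such homomorphism on K^*. *)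
Record is_log_branch (p : nat) (varpi : K) (log : K -> K) : Prop :=
IsLogBranch {
  log_mul : forall x y, x != 0 -> y != 0 -> log (x * y) = log x + log y;
  log_series : forall x, v x < 1 ->
    is_sum (fun k => (-1) ^+ k * x ^+ k.+1 / k.+1%:R) (log (1 + x));
  log_p : log p%:R = varpi
}.

(** Points of the projective line and reduction *)

Definition coord (z : P1 K) : K := if z is Some a then a else 0.

Definition P1inv (x : K) : P1 K := if x == 0 then None else Some x^-1.

Definition integral (z : P1 K) : bool := if z is Some a then v a <= 1 else false.

(* red(x) = red(y).  The points that are not integral are those reducing to
   infinity.  A point of P^1 over the residue field is represented by any of
   its lifts s, and the residue disc ]s[ is the set of z with red_eq s z. *)
Definition red_eq (x y : P1 K) : bool :=
  if integral x && integral y then v (coord x - coord y) < 1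
  else integral x == integral y.

(* The local parameter of the residue disc of s: z - s, or 1 / z at infinity.
   It is only meant for z in that disc. *)
Definition lpar (s z : P1 K) : K :=
  if integral s then coord z - coord s else (coord z)^-1.

(** Rigid analytic functions; only the values on the domain are relevant *)

(* The value of the rational function P / Q; at infinity it presupposes
   that P / Q has no pole there. *)
Definition ratev (P Q : {poly K}) (z : P1 K) : K :=
  if z is Some a then P.[a] / Q.[a] else P`_(size Q).-1 / lead_coef Q.

Definition no_pole (P Q : {poly K}) (z : P1 K) : bool :=
  if z is Some a then Q.[a] != 0 else (size P <= size Q)%N.

(* A^rig(X) for X an affinoid subset of P^1: the completion, for the sup norm,
   of the algebra of rational functions without poles on X. *)
Definition rigid (X : set (P1 K)) (f : P1 K -> K) : Prop :=
  forall e : R, 0 < e -> exists P Q : {poly K},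
    [/\ Q != 0, forall z, X z -> no_pole P Q z
      & forall z, X z -> v (f z - ratev P Q z) < e].

(* In what follows S is a finite list of lifts of the points of a finite
   subset of P^1 over the residue field (several lifts of a point allowed). *)

(* P^1(K) - ]S[ *)
Definition off_tube (S : seq (P1 K)) : set (P1 K) :=
  [set z | forall s, s \in S -> ~~ red_eq s z].

(* U_lam, and the affinoids which exhaust it when mu decreases to lam. *)
Definition Uset (S : seq (P1 K)) (lam : R) : set (P1 K) :=
  [set z | forall s, s \in S -> red_eq s z -> lam < v (lpar s z)].

Definition Uaff (S : seq (P1 K)) (mu : R) : set (P1 K) :=
  [set z | forall s, s \in S -> red_eq s z -> mu <= v (lpar s z)].

(* A^dagger(P^1 \ S) *)
Definition dagger (S : seq (P1 K)) (f : P1 K -> K) : Prop :=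
  exists lam : R, [/\ 0 < lam, lam < 1
    & forall mu, lam < mu -> mu < 1 -> rigid (Uaff S mu) f].

(* A^rig(]x[), through the parameter lpar x : ]x[ -> ]0[. *)
Definition disc_analytic (x : P1 K) (f : P1 K -> K) : Prop :=
  exists a : nat -> K, forall z, red_eq x z ->
    is_sum (fun k => a k * lpar x z ^+ k) (f z).

(* A^rig of the annulus of ]s[ where lam < |lpar s| < 1: Laurent series. *)
Definition annulus_analytic (s : P1 K) (lam : R) (f : P1 K -> K) : Prop :=
  exists a b : nat -> K, forall z, red_eq s z -> lam < v (lpar s z) ->
    exists f1 f2 : K,
      [/\ is_sum (fun k => a k * lpar s z ^+ k) f1,
          is_sum (fun k => b k * lpar s z ^- k.+1) f2 & f z = f1 + f2].

(* A_log(U(s)) for s in S. *)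
Definition annulus_log_analytic (log : K -> K) (s : P1 K) (f : P1 K -> K) :
    Prop :=
  exists (lam : R) (d : nat) (c : nat -> P1 K -> K),
    [/\ 0 < lam, lam < 1, forall i, annulus_analytic s lam (c i)
      & forall z, red_eq s z -> lam < v (lpar s z) ->
          f z = \sum_(i < d) c i z * log (lpar s z) ^+ i].

(** Coleman functions *)

(* An element of A_loc(P^1 \ S) is given by a function on P^1(K), of which only
   the restriction to U_lam, for lam close enough to 1, matters. *)
Definition A_loc (log : K -> K) (S : seq (P1 K)) (f : P1 K -> K) : Prop :=
  (forall x, off_tube S x -> disc_analytic x f) /\
  (forall s, s \in S -> annulus_log_analytic log s f).

Definition germ_eq (S : seq (P1 K)) (f g : P1 K -> K) : Prop :=
  exists lam : R, [/\ 0 < lam, lam < 1 & forall z, Uset S lam z -> f z = g z].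

(* dF = g dz *)
Definition primitive_of (S : seq (P1 K)) (g F : P1 K -> K) : Prop :=
  exists lam : R, [/\ 0 < lam, lam < 1
    & forall t : K, Uset S lam (Some t) -> forall e : R, 0 < e ->
        exists delta : R, 0 < delta /\
          forall h : K, h != 0 -> v h < delta ->
            v ((F (Some (t + h)) - F (Some t)) / h - g (Some t)) < e].

Definition P1pow (q : nat) (z : P1 K) : P1 K :=
  if z is Some a then Some (a ^+ q) else None.

(* P(phi^* ) F, where phi is the Frobenius lift z |-> z ^ q. *)
Definition frob_poly (q : nat) (P : {poly K}) (F : P1 K -> K) : P1 K -> K :=
  fun z => \sum_(i < size P) P`_i * F (P1pow (q ^ i) z).

(* The ring A_Col(P^1 \ S) of Coleman functions: the smallest
   A^dagger(P^1 \ S)-submodule of A_loc(P^1 \ S) which contains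
   A^dagger(P^1 \ S) and is closed under Coleman integration.  According to
   Coleman, for g in A_Col the primitives of g dz in A_Col are those
   F in A_loc such that dF = g dz and P(phi^* ) F is in A_Col for some
   polynomial P no root of which is a root of unity; here phi is a lift of a
   power of Frobenius fixing S pointwise.  That A_Col is closed under products
   follows from integration by parts. *)
Inductive coleman (p : nat) (log : K -> K) (S : seq (P1 K)) :
    (P1 K -> K) -> Prop :=
| coleman_germ f g : germ_eq S f g -> coleman p log S f -> coleman p log S g
| coleman_dagger f : dagger S f -> coleman p log S f
| coleman_add f g : coleman p log S f -> coleman p log S g ->
    coleman p log S (fun z => f z + g z)
| coleman_scale a f : dagger S a -> coleman p log S f ->
    coleman p log S (fun z => a z * f z)
| coleman_int m P g F :
    (0 < m)%N ->
    (forall s, s \in S -> red_eq (P1pow (p ^ m) s) s) ->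
    (forall (k : nat) (zeta : K),
       (0 < k)%N -> zeta ^+ k = 1 -> ~~ root P zeta) ->
    A_loc log S F -> coleman p log S g -> primitive_of S g F ->
    coleman p log S (frob_poly (p ^ m) P F) ->
    coleman p log S F.

(* F(z) = int_0^z g(t) dt.  When 0 reduces into S, F(0) makes sense if the
   component of F at 0 lies in A^rig(]0[); F then denotes, on the whole of
   ]0[, the analytic continuation of that component. *)
Definition coleman_int_from0 (p : nat) (log : K -> K) (S : seq (P1 K))
    (g : K -> K) (F : P1 K -> K) : Prop :=
  [/\ coleman p log S F, primitive_of S (fun z => g (coord z)) F,
      disc_analytic (Some 0) F & F (Some 0) = 0].

(** Multiple polylogarithms *)

(* xi_r^-1, (xi_(r-1) xi_r)^-1, ..., (xi_1 ... xi_r)^-1 *)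
Definition poles (xi : seq K) : seq (P1 K) :=
  [seq P1inv (\prod_(x <- drop j xi) x) | j <- iota 0 (size xi)].

(* S_r *)
Definition tmpl_sing (xi : seq K) : seq (P1 K) := Some 0 :: None :: poles xi.

(* is_tmpl p log [:: n_1; ...; n_r] [:: xi_1; ...; xi_r] F: the Coleman
   function F is Li_(n_1, ..., n_r)(xi_1, ..., xi_r; z). *)
Inductive is_tmpl (p : nat) (log : K -> K) :
    seq nat -> seq K -> (P1 K -> K) -> Prop :=
| tmpl_base x F :
    coleman_int_from0 p log (tmpl_sing [:: x])
      (fun t => x / (1 - x * t)) F ->
    is_tmpl p log [:: 1%N] [:: x] F
| tmpl_gt1 n m xi G F : (0 < m)%N ->
    is_tmpl p log (rcons n m) xi G ->
    coleman_int_from0 p log (tmpl_sing xi)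
      (fun t => G (Some t) / t) F ->
    is_tmpl p log (rcons n m.+1) xi F
| tmpl_eq1 n xi x y G F :
    is_tmpl p log n (rcons xi (x * y)) G ->
    coleman_int_from0 p log (tmpl_sing (rcons (rcons xi x) y))
      (fun t => G (Some t) * (y / (1 - y * t))) F ->
    is_tmpl p log (rcons n 1%N) (rcons (rcons xi x) y) F.

(* The part k_r < N of the series defining the rigid TMPL. *)
Definition rigid_tmpl_partial (p r : nat) (n : r.-tuple nat) (xi : r.-tuple K)
    (z : K) (N : nat) : K :=
  \sum_(k : r.-tuple 'I_N |
      sorted ltn [seq val i | i <- k] &&
      all (fun i : 'I_N => (0 < i)%N && coprime i p) k)
    (\prod_(j < r) (tnth xi j ^+ tnth k j / (tnth k j)%:R ^+ tnth n j)) *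
    z ^+ last 0%N [seq val i | i <- k].

(* L is the rigid analytic extension of the series to P^1(K) - ]S[. *)
Definition is_rigid_tmpl (p r : nat) (n : r.-tuple nat) (xi : r.-tuple K)
    (L : P1 K -> K) : Prop :=
  rigid (off_tube (poles xi)) L /\
  forall z : K, v z < 1 ->
    (fun N => v (rigid_tmpl_partial p n xi z N - L (Some z))) @ \oo --> (0 : R).

End Padic.

(* Main.v *)
(* Near 0 both sides are power series: the Taylor coefficients of the Coleman
   functions follow from the differential equations, and the identity is the
   orthogonality of the characters of Z/p, applied to each summation index.

   On the other residue discs one needs the uniqueness of Coleman functions.
   Let A be the ring of functions that are analytic off the residue discs of
   the poles and on an annulus [lam < |t| <= 1].  A module W of functions over
   A, stable under d/dt and under the Frobenius lift phi, is good if a member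
   that vanishes on an annulus [lam < |t| < 1] vanishes everywhere.  A is good
   by the maximum principle.  If W is good, F' lies in W and phi F - r F lies in
   W for some r that is not a root of unity, then W + A F is good: let
   S = w + a F vanish on the annulus.  As a' S - a S' lies in W, it vanishes,
   and S = c_x a on each residue disc ]x[; as a (phi S) - r (phi a) S lies in W,
   it vanishes too, and c_(phi x) = r c_x; since x is periodic under phi, c_x = 0.
   Splitting the polynomials P(phi) of Coleman integration into linear factors,
   one sees that all Coleman functions lie in good modules. *)

Require Import Defs.
From mathcomp Require Import all_boot all_order all_algebra.
From mathcomp Require Import boolp classical_sets fsbigop reals topology.
From mathcomp Require Import normedtype sequences.
From mathcomp Require Import ring lra zify.
From mathcomp Require cyclic.
Set Implicit Arguments.
Unset Strict Implicit.
Unset Printing Implicit Defensive.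
Import Order.TTheory GRing.Theory Num.Theory.
Import numFieldNormedType.Exports.
Local Open Scope classical_set_scope.
Local Open Scope ring_scope.

(** * The absolute value *)

(** The polylogarithms in the sum have different singular sets, yet they must be compared at once. A
    p-th root of unity reduces to 1, so the singular points of all the twists lie in the same
    residue discs, and one finite set [T] of units serves for every term. The Frobenius lift has to
    be common too, whereas each Coleman integration may use its own power of Frobenius; the least
    exponent m that fixes the residue discs of [T] divides all the others, and passing from P(X) to
    P(X^j) brings every operator back to t -> t^(p^m).

    Two obstacles prevent a plain division of S = w + a F by a. If a vanishes on a whole residue
    disc, no constant can be read off there; a three circles argument then shows that a vanishes on
    all of them, which leaves S = w. Otherwise a may still have zeros inside a disc, so S = c a is
    obtained from Taylor coefficients and not by differentiating S / a. The periodicity of residue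
    discs under phi means that the residue field is algebraic over F_p, and this is extracted from
    the density in K of the elements algebraic over Q_p. *)

Section AbsoluteValue.
Context (R : realType) (K : closedFieldType) (v : K -> R).
Context (p : nat) (p_prime : prime p) (KCp : is_Cp v p).

Lemma av_ge0 x : 0 <= v x. Proof. exact: (Cp_ge0 KCp). Qed.
Hint Resolve av_ge0 : core.

Lemma av0 : v 0 = 0. Proof. exact/(Cp_eq0 KCp). Qed.

Lemma avM x y : v (x * y) = v x * v y. Proof. exact: (Cp_mul KCp). Qed.

Lemma av_eq0 x : (v x == 0) = (x == 0).
Proof. by apply/eqP/eqP => /(Cp_eq0 KCp). Qed.

Lemma av_gt0 x : (0 < v x) = (x != 0).
Proof. by rewrite lt0r av_ge0 andbT av_eq0. Qed.

Lemma av1 : v 1 = 1.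
Proof.
have v1_neq0 : v 1 != 0 by rewrite av_eq0 oner_eq0.
by apply: (mulfI v1_neq0); rewrite -avM !mulr1.
Qed.

Lemma avX x k : v (x ^+ k) = v x ^+ k.
Proof. by elim: k => [|k IH]; rewrite ?expr0 ?av1 // !exprS avM IH. Qed.

Lemma avN x : v (- x) = v x.
Proof.
have vN1 : v (-1) = 1.
  apply/eqP; rewrite -(@eqrXn2 _ 2) ?ler01 //.
  by rewrite -avX sqrrN !expr1n av1.
by rewrite -mulN1r avM vN1 mul1r.
Qed.

Lemma avV x : v x^-1 = (v x)^-1.
Proof.
have [->|x0] := eqVneq x 0; first by rewrite invr0 av0 invr0.
have vx0 : v x != 0 by rewrite av_eq0.
by apply: (mulfI vx0); rewrite -avM !mulfV ?av1.
Qed.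

Lemma avF x y : v (x / y) = v x / v y. Proof. by rewrite avM avV. Qed.

Lemma avBC x y : v (x - y) = v (y - x). Proof. by rewrite -avN opprB. Qed.

Lemma avD_le B x y : v x <= B -> v y <= B -> v (x + y) <= B.
Proof.
by move=> xB yB; apply: le_trans (Cp_ultra KCp x y) _; rewrite ge_max xB.
Qed.

Lemma avD_lt B x y : v x < B -> v y < B -> v (x + y) < B.
Proof.
by move=> xB yB; apply: le_lt_trans (Cp_ultra KCp x y) _; rewrite gt_max xB.
Qed.

Lemma avB_le B x y : v x <= B -> v y <= B -> v (x - y) <= B.
Proof. by move=> xB yB; apply: avD_le; rewrite ?avN. Qed.

Lemma avB_lt B x y : v x < B -> v y < B -> v (x - y) < B.
Proof. by move=> xB yB; apply: avD_lt; rewrite ?avN. Qed.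

Lemma av_le_trans B x y z : v (x - y) <= B -> v (y - z) <= B -> v (x - z) <= B.
Proof. by move=> xy yz; rewrite -(subrKA y) ; apply: avD_le. Qed.

Lemma av_lt_trans B x y z : v (x - y) < B -> v (y - z) < B -> v (x - z) < B.
Proof. by move=> xy yz; rewrite -(subrKA y) ; apply: avD_lt. Qed.

Lemma avD_iso x y : v y < v x -> v (x + y) = v x.
Proof.
move=> yx; apply/le_anti; rewrite avD_le ?(ltW yx) //=.
rewrite leNgt; apply/negP => xyx.
by have := avB_lt xyx yx; rewrite addrK ltxx.
Qed.

Lemma avB_iso x y : v y < v x -> v (x - y) = v x.
Proof. by move=> yx; rewrite avD_iso ?avN. Qed.

Lemma av_sum_le (I : Type) (s : seq I) (P : pred I) (F : I -> K) B :
  0 <= B -> (forall i, P i -> v (F i) <= B) -> v (\sum_(i <- s | P i) F i) <= B.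
Proof.
by move=> B0 FB; elim/big_ind: _ => [|x y|//]; [rewrite av0 | apply: avD_le].
Qed.

Lemma av_sum_lt (I : Type) (s : seq I) (P : pred I) (F : I -> K) B :
  0 < B -> (forall i, P i -> v (F i) < B) -> v (\sum_(i <- s | P i) F i) < B.
Proof.
by move=> B0 FB; elim/big_ind: _ => [|x y|//]; [rewrite av0 | apply: avD_lt].
Qed.

Lemma av_prod (I : Type) (s : seq I) (P : pred I) (F : I -> K) :
  v (\prod_(i <- s | P i) F i) = \prod_(i <- s | P i) v (F i).
Proof. by apply: (big_morph v avM av1). Qed.

Lemma av_nat_le1 k : v k%:R <= 1.
Proof.
elim: k => [|k IH]; first by rewrite av0 ler01.
by rewrite -addn1 natrD avD_le ?av1.
Qed.

Lemma p_gt1R : 1 < p%:R :> R.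
Proof. by rewrite ltr1n prime_gt1. Qed.

Lemma av_p_lt1 : v p%:R < 1.
Proof. by rewrite (Cp_p KCp) invf_lt1 ?p_gt1R // (lt_trans ltr01) ?p_gt1R. Qed.

(** If |k| < 1, a Bézout relation between k and p would give |1| < 1. *)
Lemma av_nat_coprime k : coprime p k -> v k%:R = 1.
Proof.
move=> cpk; apply/eqP; rewrite eq_le av_nat_le1 leNgt /=; apply/negP => vk1.
have [k0|k_gt0] := posnP k.
  move: cpk; rewrite k0 /coprime gcdn0 => /eqP p1.
  by move: p_prime; rewrite p1.
have [u w E _] := egcdnP k (prime_gt0 p_prime).
move: E; rewrite (eqP cpk) => E.
have : v ((u * p)%:R - (w * k)%:R) < 1.
  apply: avB_lt; rewrite natrM avM; apply: le_lt_trans (ler_piMl _ (av_nat_le1 _)) _ => //.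
  exact: av_p_lt1.
by rewrite E natrD addrAC subrr add0r av1 ltxx.
Qed.

(** Characteristic 0 is a consequence of |p| = 1/p: the p-part of k has a nonzero absolute value and
    the cofactor is a unit. *)
Lemma natK_neq0 k : (0 < k)%N -> k%:R != 0 :> K.
Proof.
move=> k0; have [m Hm ->] := pfactor_coprime p_prime k0.
rewrite -av_gt0 natrM avM av_nat_coprime // mul1r natrX avX exprn_gt0 //.
by rewrite (Cp_p KCp) invr_gt0 (lt_trans ltr01) ?p_gt1R.
Qed.

Lemma root_exists k (a : K) : (0 < k)%N -> exists x, x ^+ k = a.
Proof.
move=> k0; have [x Hx] := solve_monicpoly (fun i => if i == 0%N then a else 0) k0.
exists x; rewrite Hx -(prednK k0) big_ord_recl /= expr0 mulr1 big1 ?addr0 // => i _.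
by rewrite mul0r.
Qed.

Lemma bernoulli_ge (d : R) k : 0 <= d <= 1 -> 1 - d *+ k <= (1 - d) ^+ k.
Proof.
move=> /andP[d0 d1]; elim: k => [|k IH]; first by rewrite mulr0n subr0.
rewrite exprS mulrS.
have : (1 - d) * (1 - d *+ k) <= (1 - d) * (1 - d) ^+ k by rewrite ler_wpM2l ?subr_ge0.
apply: le_trans; have : 0 <= d *+ k by rewrite mulrn_wge0.
by set y := d *+ k => y0; nra.
Qed.

Lemma exp_near1 (l : R) k : l < 1 -> exists2 l', 0 < l' < 1 & l < l' ^+ k.
Proof.
move=> l1; wlog l0 : l l1 / 0 < l.
  move=> H; have [l0|l0] := ltP 0 l; first exact: H.
  have [||l' h1 h2] := H 2^-1; [lra | lra |].
  by exists l' => //; apply: le_lt_trans h2; lra.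
have k0 : (0 : R) < k.+2%:R by rewrite ltr0n.
(* With k + 2 in the denominator, both d < 1 and k d < 1 - l are strict for every k, 0 included. *)
pose d := (1 - l) / k.+2%:R.
have d1 : d < 1.
  by rewrite ltr_pdivrMr // mul1r; have := @ler1n R k.+2; rewrite ltn0Sn => /esym h; lra.
have d0 : 0 < d by rewrite divr_gt0 ?subr_gt0.
exists (1 - d); first by rewrite subr_gt0 d1 ltrBlDr ltrDl d0.
apply: lt_le_trans (bernoulli_ge k _); last by rewrite !ltW.
have : d *+ k < d *+ k.+2 by rewrite !mulrS addrA ltrDr addr_gt0.
rewrite -[d *+ k.+2]mulr_natr divfK ?gt_eqF //; lra.
Qed.

Lemma exp_small (l e : R) : 0 <= l < 1 -> 0 < e -> exists k, l ^+ k < e.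
Proof.
move=> /andP[l0 l1] e0.
have : (fun k => l ^+ k) @ \oo --> (0 : R).
  by apply: cvg_expr; rewrite ger0_norm.
move/cvgr0Pnorm_lt => /(_ _ e0) [N _ HN]; exists N.
by have := HN N (leqnn N); rewrite /= ger0_norm // exprn_ge0.
Qed.

(* The value group is dense: take a root of p of high order. *)
Lemma av_near1 (l : R) : l < 1 -> exists c, l < v c < 1.
Proof.
move=> l1.
wlog l0 : l l1 / 0 < l.
  move=> H; have [l0|l0] := ltP 0 l; first exact: H.
  have [||c /andP[h1 h2]] := H 2^-1; [lra | lra |].
  by exists c; rewrite h2 andbT; apply: le_lt_trans h1; lra.
have vp0 : 0 < v p%:R by rewrite av_gt0 natK_neq0 ?prime_gt0.
have [k Hk] : exists k, l ^+ k < v p%:R by apply: exp_small => //; rewrite l1 ltW.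
have k0 : (0 < k)%N.
  by case: k Hk => // ; rewrite expr0 => H; have := lt_trans H av_p_lt1; rewrite ltxx.
have [c Hc] := root_exists p%:R k0; exists c; apply/andP; split.
  by rewrite -(@ltr_pXn2r _ k k0) ?nnegrE ?(ltW l0) ?av_ge0 // -avX Hc.
by rewrite -(@ltr_pXn2r _ k k0) ?nnegrE ?ler01 ?av_ge0 // -avX Hc expr1n av_p_lt1.
Qed.

Lemma av_small (e : R) : 0 < e -> exists2 c, 0 < v c & v c < e.
Proof.
move=> e0; have [k Hk] : exists k, v p%:R ^+ k < e.
  by apply: exp_small => //; rewrite av_ge0 av_p_lt1.
by exists (p%:R ^+ k); rewrite ?avX // exprn_gt0 // av_gt0 natK_neq0 ?prime_gt0.
Qed.

(** A Cauchy estimate on a circle of radius |c| < 1 loses the factor |c|^k; letting |c| tend to 1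
    removes it. *)
Lemma near1_le (A B l : R) k : 0 <= A -> 0 <= B -> l < 1 ->
  (forall c, l < v c < 1 -> A * v c ^+ k <= B) -> A <= B.
Proof.
move=> A0 B0 l1 H; rewrite leNgt; apply/negP => BA.
have Ap : 0 < A := le_lt_trans B0 BA.
have [l' /andP[l'0 l'1] Hl'] : exists2 l', 0 < l' < 1 & B / A < l' ^+ k.
  by apply: exp_near1; rewrite ltr_pdivrMr ?mul1r.
have [c /andP[]] : exists c, Num.max l l' < v c < 1.
  by apply: av_near1; rewrite gt_max l1.
rewrite gt_max => /andP[lc l'c] c1.
have := H c; rewrite lc c1 => /(_ isT); apply/negP; rewrite -ltNge.
rewrite mulrC -ltr_pdivrMr //; apply: lt_le_trans Hl' _.
by rewrite lerXn2r ?nnegrE ?ltW // (lt_trans l'0).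
Qed.

End AbsoluteValue.

(** * Power series and Cauchy estimates *)

Section Series.
Context (R : realType) (K : closedFieldType) (v : K -> R).
Context (p : nat) (p_prime : prime p) (KCp : is_Cp v p).
#[local] Hint Extern 0 (is_true (0 <= v _)) => exact: (av_ge0 KCp) : core.

Lemma le_of_forall_gt (x B : R) : (forall e, 0 < e -> x <= B + e) -> x <= B.
Proof. by move=> H; apply/ler_addgt0Pr. Qed.

Lemma av_cvgP (u : nat -> K) :
  (fun N => v (u N)) @ \oo --> (0 : R) <->
  forall e : R, 0 < e -> exists N0, forall N, (N0 <= N)%N -> v (u N) < e.
Proof.
split=> [/cvgr0Pnorm_lt H e e0|H].
  have [N0 _ HN] := H e e0; exists N0 => N le_N.
  by have := HN N le_N; rewrite /= ger0_norm.
apply/cvgr0Pnorm_lt => e e0; have [N0 HN] := H e e0.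
by exists N0 => // N le_N /=; rewrite ger0_norm //; apply: HN.
Qed.

Lemma av_lim_unique (u : nat -> K) (l m : K) :
  (fun N => v (u N - l)) @ \oo --> (0 : R) ->
  (fun N => v (u N - m)) @ \oo --> (0 : R) -> l = m.
Proof.
move=> /av_cvgP ul /av_cvgP um; apply/eqP; rewrite -subr_eq0 -(av_eq0 KCp).
rewrite eq_le (av_ge0 KCp) andbT; apply: le_of_forall_gt => e e0; rewrite add0r.
have [N1 H1] := ul e e0; have [N2 H2] := um e e0.
apply: (av_le_trans KCp (y := u (maxn N1 N2))); apply: ltW.
  by rewrite (avBC KCp) H1 ?leq_maxl.
by rewrite H2 ?leq_maxr.
Qed.

(** The Gauss norm of the monic polynomial with roots [qs], in multiplicative form. *)
Definition gauss_prod (qs : seq K) : R := \prod_(q <- qs) Num.max 1 (v q).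

Lemma gauss_prod_gt0 qs : 0 < gauss_prod qs.
Proof. by apply: prodr_gt0 => q _; rewrite lt_max ltr01. Qed.

Lemma coef_prod_XsubC_le qs i :
  v (\prod_(q <- qs) ('X - q%:P))`_i <= gauss_prod qs.
Proof.
rewrite /gauss_prod; elim: qs i => [|q qs IH] i.
  rewrite !big_nil coef1; case: eqP => _; first by rewrite (av1 KCp).
  by rewrite (av0 KCp) ler01.
rewrite !big_cons mulrBl coefB coefXM coefCM.
have g0 := ltW (gauss_prod_gt0 qs).
apply: (avB_le KCp).
  case: eqP => _; first by rewrite (av0 KCp) mulr_ge0 // le_max ler01.
  apply: le_trans (IH _) _; rewrite ler_peMl // le_max lexx //.
by rewrite (avM KCp) ler_pM // le_max lexx orbT.
Qed.

Lemma av_sub_le_max t q : v t <= 1 -> v (t - q) <= Num.max 1 (v q).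
Proof. by move=> t1; apply: (avB_le KCp); rewrite le_max ?t1 ?lexx ?orbT. Qed.

Lemma prod_le1_eq1 (qs : seq K) (f : K -> R) :
  (forall q, q \in qs -> 0 <= f q <= 1) -> \prod_(q <- qs) f q = 1 ->
  forall q, q \in qs -> f q = 1.
Proof.
move=> f01 f1 q qin; move: f1; rewrite (big_rem q qin) /= => E.
have /andP[fq0 fq1] := f01 q qin.
have rest1 : \prod_(y <- rem q qs) f y <= 1.
  by rewrite big_seq; apply: prodr_ile1 => y /mem_rem /f01.
apply/le_anti; rewrite fq1 -{1}E; exact: ler_piMr.
Qed.

(* A root [t] of [\prod_q ('X - q) - 1], the product being over [0] and the
   integral [q], is integral, hence all the factors [t - q] are units. *)
Lemma exists_generic_unit (qs : seq K) :
  exists t, v t = 1 /\ forall q, q \in qs -> v (t - q) = Num.max 1 (v q).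
Proof.
pose s := 0 :: [seq q <- qs | v q <= 1].
pose A : {poly K} := \prod_(q <- s) ('X - q%:P).
have szA : (1 < size A)%N by rewrite size_prod_XsubC.
have [t rt] : exists t, root (A - 1) t.
  by apply/closed_rootP; rewrite size_polyDl ?size_polyN ?size_poly1 ?gtn_eqF.
have At : A.[t] = 1 by move: rt; rewrite rootE !hornerE subr_eq0 => /eqP.
have prod1 : \prod_(q <- s) v (t - q) = 1.
  rewrite -(av_prod KCp) -(av1 KCp); congr v; rewrite -[RHS]At horner_prod.
  by apply: eq_bigr => q _; rewrite hornerXsubC.
have s_le1 q : q \in s -> v q <= 1.
  rewrite inE => /orP[/eqP->|]; first by rewrite (av0 KCp) ler01.
  by rewrite mem_filter => /andP[].
have t1 : v t <= 1.
  rewrite leNgt; apply/negP => t1.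
  have vtq q : q \in s -> v (t - q) = v t.
    by move=> /s_le1 q1; apply: (avB_iso KCp); apply: le_lt_trans t1.
  have : 1 < \prod_(q <- s) v (t - q).
    rewrite (eq_big_seq (fun=> v t)) // big_const_seq count_predT iter_mulr_1.
    by rewrite exprn_egt1.
  by rewrite prod1 ltxx.
have tq1 : forall q, q \in s -> v (t - q) = 1.
  apply: prod_le1_eq1 prod1 => q qin; rewrite (av_ge0 KCp) /=.
  by apply: (avB_le KCp) => //; apply: s_le1.
exists t; split=> [|q qin].
  by have := tq1 0; rewrite subr0; apply; rewrite inE eqxx.
have [q1|q1] := leP (v q) 1.
  by apply: tq1; rewrite inE mem_filter q1 qin orbT.
by rewrite (avBC KCp) (avB_iso KCp) //; apply: le_lt_trans q1.
Qed.

Lemma poly_factor (P : {poly K}) :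
  {qs | P = lead_coef P *: \prod_(q <- qs) ('X - q%:P)}.
Proof. exact: closed_field_poly_normal. Qed.

Lemma horner_factor (a t : K) qs :
  v (a *: \prod_(q <- qs) ('X - q%:P)).[t] = v a * \prod_(q <- qs) v (t - q).
Proof.
rewrite hornerZ (avM KCp) horner_prod (av_prod KCp); congr (_ * _).
by apply: eq_bigr => q _; rewrite hornerXsubC.
Qed.

(** Maximum principle: at a unit congruent to no root, |P| equals the Gauss norm, which bounds every
    coefficient. *)
Lemma gauss_unit (P : {poly K}) :
  exists2 t, v t = 1 & forall k, v P`_k <= v P.[t].
Proof.
have [qs defP] := poly_factor P; have [t [t1 Ht]] := exists_generic_unit qs.
exists t => // k.
have -> : v P.[t] = v (lead_coef P) * gauss_prod qs.
  by rewrite {1}defP horner_factor (eq_big_seq _ Ht).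
have -> : P`_k = lead_coef P * (\prod_(q <- qs) ('X - q%:P))`_k.
  by rewrite {1}defP coefZ.
by rewrite (avM KCp) ler_wpM2l // coef_prod_XsubC_le.
Qed.

(** Rescaling the variable by c reduces the circle |t| = |c| to the unit circle, where [gauss_unit]
    applies. *)
Lemma cauchy_poly (P : {poly K}) (c : K) (e : R) : c != 0 ->
  (forall t, v t = v c -> v P.[t] <= e) -> forall k, v P`_k * v c ^+ k <= e.
Proof.
move=> c0 HP k; pose P' := \poly_(i < size P) (P`_i * c ^+ i).
have hP' t : P'.[t] = P.[c * t].
  rewrite horner_poly horner_coef; apply: eq_bigr => i _.
  by rewrite exprMn mulrA.
have [t t1 Ht] := gauss_unit P'.
have <- : v P'`_k = v P`_k * v c ^+ k.
  rewrite coef_poly -(avX KCp) -(avM KCp).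
  by case: ltnP => // H; rewrite nth_default // mul0r.
apply: le_trans (Ht k) _; rewrite hP'; apply: HP.
by rewrite (avM KCp) t1 mulr1.
Qed.

Lemma horner_le (P : {poly K}) (t : K) (r B : R) : 0 <= B -> v t <= r ->
  (forall k, v P`_k * r ^+ k <= B) -> v P.[t] <= B.
Proof.
move=> B0 tr HP; rewrite horner_coef; apply: (av_sum_le KCp) => // k _.
apply: le_trans (HP k); rewrite (avM KCp) (avX KCp) ler_wpM2l //.
by rewrite lerXn2r ?nnegrE // (le_trans _ tr).
Qed.

Definition trunc (a : nat -> K) N : {poly K} := \poly_(k < N) a k.

Lemma horner_trunc a N t : (trunc a N).[t] = \sum_(k < N) a k * t ^+ k.
Proof. by rewrite horner_poly. Qed.

Definition has_series (a : nat -> K) (f : K -> K) : Prop :=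
  forall t, v t < 1 -> is_sum v (fun k => a k * t ^+ k) (f t).

Lemma has_series_cvg a f t : has_series a f -> v t < 1 ->
  forall e : R, 0 < e ->
    exists N0, forall N, (N0 <= N)%N -> v ((trunc a N).[t] - f t) < e.
Proof.
move=> af t1 e e0; have /av_cvgP /(_ _ e0)[N0 H] := af t t1.
by exists N0 => N /H; rewrite horner_trunc.
Qed.

Lemma series_terms_small a f c : has_series a f -> v c < 1 ->
  forall e : R, 0 < e ->
    exists N0, forall k, (N0 <= k)%N -> v (a k) * v c ^+ k < e.
Proof.
move=> af c1 e e0; have [N0 H] := has_series_cvg af c1 e0.
exists N0 => k Hk; have := avB_lt KCp (H k.+1 (leqW Hk)) (H k Hk).
by rewrite !horner_trunc big_ord_recr /= opprB addrA subrK addrAC subrr add0r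
  (avM KCp) (avX KCp).
Qed.

Lemma series_terms_bounded a f c : has_series a f -> v c < 1 ->
  exists2 B, 0 < B & forall k, v (a k) * v c ^+ k <= B.
Proof.
move=> af c1; have [N0 H] := series_terms_small af c1 ltr01.
exists (1 + \sum_(k < N0) v (a k) * v c ^+ k).
  by rewrite ltr_pwDl // sumr_ge0 // => i _; rewrite mulr_ge0 // exprn_ge0.
have S0 : 0 <= \sum_(k < N0) v (a k) * v c ^+ k.
  by apply: sumr_ge0 => i _; rewrite mulr_ge0 // exprn_ge0.
move=> k; have [/H Hk|kN] := leqP N0 k; first by lra.
rewrite (bigD1 (Ordinal kN)) //= addrCA lerDl addr_ge0 // sumr_ge0 // => i _.
by rewrite mulr_ge0 // exprn_ge0.
Qed.

Lemma series_tail a f c (e : R) N t : has_series a f -> v c < 1 -> 0 <= e ->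
  (forall k, (N <= k)%N -> v (a k) * v c ^+ k <= e) -> v t <= v c ->
  v (f t - (trunc a N).[t]) <= e.
Proof.
move=> af c1 e0 He tc; apply: le_of_forall_gt => d d0.
have [N0 H] := has_series_cvg af (le_lt_trans tc c1) d0.
apply: (av_le_trans KCp (y := (trunc a (maxn N0 N)).[t])).
  by rewrite (avBC KCp) ltW // (lt_le_trans (H _ (leq_maxl _ _))) // lerDr.
apply: (@le_trans _ _ e); last by rewrite lerDl ltW.
rewrite !horner_trunc -(subnK (leq_maxr N0 N)) addnC big_split_ord /=.
rewrite addrAC subrr add0r; apply: (av_sum_le KCp) => // k _.
apply: le_trans (He _ (leq_addr k N)); rewrite (avM KCp) (avX KCp).
by rewrite ler_wpM2l // lerXn2r ?nnegrE.
Qed.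

Lemma series_bound a f c B t : has_series a f -> v c < 1 -> 0 <= B ->
  (forall k, v (a k) * v c ^+ k <= B) -> v t <= v c -> v (f t) <= B.
Proof.
move=> af c1 B0 HB tc; have := series_tail (N := 0) af c1 B0 _ tc.
by rewrite horner_trunc big_ord0 subr0; apply => k _.
Qed.

Lemma series_trunc_approx a f c (e : R) : has_series a f -> v c < 1 -> 0 < e ->
  exists N0, forall N, (N0 <= N)%N -> forall t, v t <= v c ->
    v (f t - (trunc a N).[t]) <= e.
Proof.
move=> af c1 e0; have [N0 H] := series_terms_small af c1 e0.
exists N0 => N leN t tc; apply: series_tail af c1 (ltW e0) _ tc => k lek.
by rewrite ltW // H // (leq_trans leN).
Qed.

(** A long truncation of [a] approximates f on the circle and already has the right coefficient of
    index k, so the polynomial estimate can be applied to this truncation minus P. *)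
Lemma cauchy_series a f (P : {poly K}) c (e : R) :
  has_series a f -> c != 0 -> v c < 1 -> 0 <= e ->
  (forall t, v t = v c -> v (f t - P.[t]) <= e) ->
  forall k, v (a k - P`_k) * v c ^+ k <= e.
Proof.
move=> af c0 c1 e0 HP k; apply: le_of_forall_gt => d d0.
have [N0 H] := series_trunc_approx af c1 d0.
have -> : a k - P`_k = (trunc a (maxn N0 k.+1) - P)`_k.
  by rewrite coefB coef_poly leq_maxr.
apply: cauchy_poly => // t tc; rewrite hornerD hornerN.
apply: (av_le_trans KCp (y := f t)).
  by rewrite (avBC KCp) (le_trans (H _ _ _ _)) ?leq_maxl ?tc // lerDr.
by rewrite (le_trans (HP _ tc)) // lerDl ltW.
Qed.

Lemma cauchy_series0 a f c (e : R) :
  has_series a f -> c != 0 -> v c < 1 -> 0 <= e ->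
  (forall t, v t = v c -> v (f t) <= e) ->
  forall k, v (a k) * v c ^+ k <= e.
Proof.
move=> af c0 c1 e0 HP k; rewrite -[a k]subr0 -[X in _ - X](coef0 K k).
by apply: cauchy_series (af) _ _ _ _ _ => // t /HP; rewrite horner0 subr0.
Qed.

(** One circle is enough for the identity principle of power series: the Cauchy estimate holds there
    with bound 0. *)
Lemma series_circle_eq0 a f c : has_series a f -> c != 0 -> v c < 1 ->
  (forall t, v t = v c -> f t = 0) -> forall k, a k = 0.
Proof.
move=> af c0 c1 f0 k.
have /(_ k) : forall k, v (a k) * v c ^+ k <= 0.
  by apply: (cauchy_series0 af c0 c1) => // t tc; rewrite f0 // (av0 KCp).
have ck : 0 < v c ^+ k by rewrite exprn_gt0 // (av_gt0 KCp).
rewrite pmulr_lle0 // => a0; apply/eqP; rewrite -(av_eq0 KCp).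
by rewrite eq_le a0 (av_ge0 KCp).
Qed.

End Series.

(** * Analytic functions as limits of polynomials on closed discs *)

Section Apx.
Context (R : realType) (K : closedFieldType) (v : K -> R).
Context (p : nat) (p_prime : prime p) (KCp : is_Cp v p).
#[local] Hint Extern 0 (is_true (0 <= v _)) => exact: (av_ge0 KCp) : core.

(* These are exactly the functions with a power series expansion
   ([apx_series], [apx_has_series]), but here the stability under products,
   substitutions and uniform limits needs no computation on coefficients. *)
Definition apx (f : K -> K) : Prop :=
  forall c, v c < 1 -> forall e : R, 0 < e ->
    exists P : {poly K}, forall t, v t <= v c -> v (f t - P.[t]) <= e.

Lemma apx_eq f g : (forall t, v t < 1 -> f t = g t) -> apx f -> apx g.
Proof.
move=> fg af c c1 e e0; have [P HP] := af c c1 e e0.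
by exists P => t tc; rewrite -fg ?HP // (le_lt_trans tc).
Qed.

Lemma apx_series a f : has_series v a f -> apx f.
Proof.
move=> af c c1 e e0; have [N HN] := series_trunc_approx KCp af c1 e0.
by exists (trunc a N) => t; apply: HN.
Qed.

Lemma apx_poly (P : {poly K}) : apx (horner P).
Proof. by move=> c _ e e0; exists P => t _; rewrite subrr (av0 KCp) ltW. Qed.

Lemma poly_bounded (P : {poly K}) :
  exists2 B, 0 < B & forall t, v t <= 1 -> v P.[t] <= B.
Proof.
have S0 : 0 <= \sum_(k < size P) v P`_k by apply: sumr_ge0.
exists (1 + \sum_(k < size P) v P`_k); first by rewrite ltr_pwDl.
move=> t t1; apply: (horner_le KCp) (t1) _ => [|k]; first by rewrite addr_ge0.
rewrite expr1n mulr1; have [Pk|kP] := leqP (size P) k.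
  by rewrite nth_default // (av0 KCp) addr_ge0.
by rewrite (bigD1 (Ordinal kP)) //= addrCA lerDl addr_ge0 // sumr_ge0.
Qed.

Lemma apx_bounded f c : apx f -> v c < 1 ->
  exists2 B, 0 < B & forall t, v t <= v c -> v (f t) <= B.
Proof.
move=> af c1; have [P HP] := af c c1 1 ltr01; have [B B0 HB] := poly_bounded P.
exists (Num.max 1 B); first by rewrite lt_max ltr01.
move=> t tc; rewrite -[f t](subrK P.[t]); apply: (avD_le KCp).
  by rewrite le_max HP.
by rewrite le_max HB ?orbT // ltW // (le_lt_trans tc).
Qed.

Lemma apx_add f g : apx f -> apx g -> apx (fun t => f t + g t).
Proof.
move=> af ag c c1 e e0.
have [P HP] := af c c1 e e0; have [Q HQ] := ag c c1 e e0.
exists (P + Q) => t tc; rewrite hornerD opprD addrACA.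
by apply: (avD_le KCp); [apply: HP | apply: HQ].
Qed.

Lemma apx_mul f g : apx f -> apx g -> apx (fun t => f t * g t).
Proof.
move=> af ag c c1 e e0; have [B B0 HB] := apx_bounded ag c1.
have [P HP] := af c c1 (e / B) (divr_gt0 e0 B0).
have [A A0 HA] := poly_bounded P.
have [Q HQ] := ag c c1 (e / A) (divr_gt0 e0 A0).
exists (P * Q) => t tc; rewrite hornerM.
have -> : f t * g t - P.[t] * Q.[t] =
  (f t - P.[t]) * g t + P.[t] * (g t - Q.[t]) by ring.
have t1 : v t <= 1 by rewrite ltW // (le_lt_trans tc).
apply: (avD_le KCp); rewrite (avM KCp).
  apply: le_trans (ler_pM _ _ (HP t tc) (HB t tc)) _ => //.
  by rewrite divfK // gt_eqF.
apply: le_trans (ler_pM _ _ (HA t t1) (HQ t tc)) _ => //.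
by rewrite mulrC divfK // gt_eqF.
Qed.

Lemma apx_const a : apx (fun=> a).
Proof. by apply: apx_eq (apx_poly a%:P) => t _; rewrite hornerC. Qed.

Lemma apx_opp f : apx f -> apx (fun t => - f t).
Proof.
by move=> /(apx_mul (apx_const (-1))); apply: apx_eq => t _; rewrite mulN1r.
Qed.

Lemma apx_comp_gen f (P : {poly K}) :
  (forall c, v c < 1 -> exists2 c', v c' < 1 &
     forall t, v t <= v c -> v P.[t] <= v c') ->
  apx f -> apx (fun t => f P.[t]).
Proof.
move=> HP af c c1 e e0; have [c' c'1 Hc'] := HP c c1.
have [Q HQ] := af c' c'1 e e0.
by exists (Q \Po P) => t tc; rewrite horner_comp; apply/HQ/Hc'.
Qed.

Lemma apx_comp f (P : {poly K}) :
  (forall t, v t < 1 -> v P.[t] <= v t) -> apx f -> apx (fun t => f P.[t]).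
Proof.
move=> HP; apply: apx_comp_gen => c c1; exists c => // t tc.
by apply: le_trans (HP t _) (tc); apply: le_lt_trans tc c1.
Qed.

Lemma apx_ulim f :
  (forall e : R, 0 < e -> exists2 g, apx g &
    forall t, v t < 1 -> v (f t - g t) <= e) -> apx f.
Proof.
move=> H c c1 e e0; have [g ag Hg] := H e e0; have [P HP] := ag c c1 e e0.
exists P => t tc; apply: (av_le_trans KCp (y := g t)); last exact: HP.
exact/Hg/(le_lt_trans tc).
Qed.

(** The geometric expansion in powers of t / q, cut after N terms, leaves the remainder (t / q)^N /
    (t - q), which is uniformly small on |t| <= |c| < 1 <= |q|. *)
Lemma apx_inv_XsubC q : 1 <= v q -> apx (fun t => (t - q)^-1).
Proof.
move=> q1 c c1 e e0.
have [N HN] : exists N, v c ^+ N < e by apply: (exp_small) => //; rewrite c1 andbT.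
have q0 : q != 0 by rewrite -(av_gt0 KCp) (lt_le_trans ltr01).
exists (\poly_(k < N) - q ^- k.+1) => t tc; rewrite horner_poly.
have t1 := le_lt_trans tc c1; have tq := lt_le_trans t1 q1.
have vtq : v (t - q) = v q by rewrite (avBC KCp) (avB_iso KCp).
have tq0 : t - q != 0 by rewrite -(av_gt0 KCp) vtq (av_gt0 KCp).
have -> : (t - q)^-1 - \sum_(i < N) - q ^- i.+1 * t ^+ i =
  (t / q) ^+ N / (t - q).
  apply: (mulIf tq0); rewrite mulrBl mulVf // divfK //.
  elim: N {HN} => [|N IH]; first by rewrite big_ord0 mul0r subr0 expr0.
  rewrite big_ord_recr /= mulrDl opprD addrA IH !exprMn !exprVn !exprSr invfM.
  by field; rewrite q0 ?expf_neq0.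
rewrite (avF KCp) vtq ler_pdivrMr ?(av_gt0 KCp) //.
rewrite (avX KCp) (avF KCp).
apply: (@le_trans _ _ (v c ^+ N)).
  rewrite lerXn2r ?nnegrE ?divr_ge0 //.
  rewrite ler_pdivrMr ?(av_gt0 KCp) //; apply: le_trans tc _.
  exact: ler_peMr.
by apply: le_trans (ltW HN) _; apply: ler_peMr; rewrite // ltW.
Qed.

Lemma apx_ratio (P Q : {poly K}) :
  (forall t, v t < 1 -> Q.[t] != 0) -> apx (fun t => P.[t] / Q.[t]).
Proof.
move=> HQ; apply: apx_mul; first exact: apx_poly.
have [qs defQ] := poly_factor Q.
have Q0 : lead_coef Q != 0.
  have := HQ 0; rewrite (av0 KCp) ltr01 => /(_ isT).
  by apply: contra_neq => E; rewrite defQ E scale0r horner0.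
have qs1 q : q \in qs -> 1 <= v q.
  move=> qin; rewrite leNgt; apply/negP => /HQ; rewrite defQ hornerZ.
  rewrite mulf_eq0 negb_or => /andP[_]; rewrite -[X in X != 0]/(_.[q]) -rootE.
  by rewrite root_prod_XsubC qin.
have : apx (fun t => (\prod_(q <- qs) ('X - q%:P)).[t]^-1).
  elim: qs qs1 {defQ} => [|q qs IH] qs1.
    by apply: apx_eq (apx_const 1) => t _; rewrite big_nil hornerE invr1.
  have H1 : apx (fun t => (t - q)^-1) by apply/apx_inv_XsubC/qs1/mem_head.
  have H2 := IH (fun q' H => qs1 q' (mem_behead (s := q :: qs) H)).
  apply: apx_eq (apx_mul H1 H2) => t _.
  by rewrite big_cons hornerM hornerXsubC invfM.
move/(apx_mul (apx_const (lead_coef Q)^-1)); apply: apx_eq => t _.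
by rewrite {2}defQ hornerZ invfM.
Qed.

(** Cauchy estimates turn the coefficients of the approximating polynomials into Cauchy sequences,
    and the completeness of K provides the limits. The same estimates on larger discs bound the
    error of the limit series. *)
Lemma apx_has_series f : apx f -> exists a, has_series v a f.
Proof.
move=> af.
have [c Hc] : {c : nat -> K & forall n, 1 - n.+2%:R^-1 < v (c n) < 1}.
  apply: (@boolp.choice _ _ (fun n x => 1 - n.+2%:R^-1 < v x < 1)) => n.
  apply: (av_near1 p_prime KCp).
  by rewrite ltrBlDr ltrDl invr_gt0 ltr0n.
have c1 n : v (c n) < 1 by have /andP[] := Hc n.
have chalf n : 2^-1 <= v (c n).
  have /andP[H _] := Hc n; apply: le_trans (ltW H).
  rewrite lerBrDr -lerBrDl (_ : 1 - 2^-1 = 2^-1); last by field.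
  by rewrite lef_pV2 ?posrE ?ltr0n // ler_nat.
have [P HP] : {P : nat -> {poly K} & forall n t,
    v t <= v (c n) -> v (f t - (P n).[t]) <= n.+1%:R^-1}.
  apply: (@boolp.choice _ _ (fun n (P : {poly K}) => forall t,
    v t <= v (c n) -> v (f t - P.[t]) <= n.+1%:R^-1)) => n.
  by apply: af => //; rewrite invr_gt0 ltr0n.
(* An auxiliary radius inside all the discs |t| <= |c n|: any two approximations can be compared on
   its circle, which is enough for the convergence of each coefficient. *)
have [c0 c0_gt0 c0_lt] : exists2 x, 0 < v x & v x < 2^-1.
  by apply: (av_small p_prime KCp); rewrite invr_gt0 ltr0n.
have c0_neq0 : c0 != 0 by rewrite -(av_gt0 KCp).
have invS_gt0 n : 0 < n.+1%:R^-1 :> R by rewrite invr_gt0 ltr0n.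
have invS_small (e : R) : 0 < e -> exists N, forall n, (N <= n)%N -> n.+1%:R^-1 < e.
  move=> e0; exists (Num.truncn e^-1) => n le_n; rewrite -[e]invrK.
  rewrite ltf_pV2 ?posrE ?invr_gt0 ?ltr0n //.
  by apply: lt_le_trans (truncnS_gt _) _; rewrite ler_nat.
have HPP n m t : (n <= m)%N -> v t <= v (c n) -> v t <= v (c m) ->
    v ((P n - P m).[t]) <= n.+1%:R^-1.
  move=> nm tn tm; rewrite hornerD hornerN; apply: (av_le_trans KCp (y := f t)).
    by rewrite (avBC KCp) HP.
  by apply: le_trans (HP _ _ tm) _; rewrite lef_pV2 ?posrE ?ltr0n // ler_nat.
have coef_cauchy k n m : (n <= m)%N ->
    v ((P n)`_k - (P m)`_k) * v c0 ^+ k <= n.+1%:R^-1.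
  move=> nm; rewrite -coefB; apply: (cauchy_poly KCp) => // t tc0.
  by apply: HPP => //; rewrite tc0 (le_trans (ltW c0_lt)).
have [a Ha] : {a : nat -> K & forall k,
    (fun n => v ((P n)`_k - a k)) @ \oo --> (0 : R)}.
  apply: (@boolp.choice _ _
    (fun k x => (fun n => v ((P n)`_k - x)) @ \oo --> (0 : R))) => k.
  apply: (Cp_complete KCp) => e e0.
  have ck0 : 0 < v c0 ^+ k by rewrite exprn_gt0.
  have [N HN] := invS_small (e * v c0 ^+ k) (mulr_gt0 e0 ck0).
  suff H i j : (N <= i)%N -> (i <= j)%N -> v ((P i)`_k - (P j)`_k) < e.
    exists N => i j Ni Nj; have [ij|/ltnW ji] := leqP i j; first exact: H.
    by rewrite (avBC KCp) H.
  move=> Ni ij; rewrite -(ltr_pM2r ck0).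
  by apply: le_lt_trans (coef_cauchy _ _ _ ij) (HN _ Ni).
have coef_lim k n : v (a k - (P n)`_k) * v (c n) ^+ k <= n.+1%:R^-1.
  have cn0 : 0 < v (c n).
    by apply: lt_le_trans (chalf n); rewrite invr_gt0 ltr0n.
  have cnk0 : 0 < v (c n) ^+ k by rewrite exprn_gt0.
  apply: le_of_forall_gt => e e0.
  have /(av_cvgP KCp) /(_ e e0)[N1 HN1] := Ha k.
  have [N2 HN2] := invS_small (1 - v (c n)) ltac:(by rewrite subr_gt0).
  (* The radii |c n| are not chosen increasing; m is so large that |c m| is at least |c n|, and both
     approximations are valid on the circle |t| = |c n|. *)
  pose m := maxn n (maxn N1 N2).
  have nm : (n <= m)%N by rewrite leq_maxl.
  have N1m : (N1 <= m)%N by rewrite /m; lia.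
  have N2m : (N2 <= m.+1)%N by rewrite /m; lia.
  have cnm : v (c n) <= v (c m).
    have /andP[H _] := Hc m; apply/ltW/(lt_trans _ H).
    by rewrite ltrBrDr addrC -ltrBrDr HN2.
  have H1 : v ((P n)`_k - (P m)`_k) * v (c n) ^+ k <= n.+1%:R^-1.
    rewrite -coefB; apply: (cauchy_poly KCp) => [|t tc].
      by rewrite -(av_gt0 KCp).
    by apply: HPP => //; rewrite tc.
  have H2 : v ((P m)`_k - a k) * v (c n) ^+ k <= e.
    apply: le_trans (ltW (HN1 _ N1m)); rewrite ler_piMr //.
    by rewrite exprn_ile1 // ltW.
  rewrite -(divfK (lt0r_neq0 cnk0) (_ + e)) ler_pM2r //.
  rewrite (avBC KCp); apply: (av_le_trans KCp (y := (P m)`_k));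
    rewrite ler_pdivlMr //.
    by apply: le_trans H1 _; rewrite lerDl ltW.
  by apply: le_trans H2 _; rewrite lerDr ltW.
exists a => t t1; apply/(av_cvgP KCp) => e e0.
have [N1 HN1] := invS_small e e0.
have [N2 HN2] := invS_small (1 - v t) ltac:(by rewrite subr_gt0).
pose n := maxn N1 N2.
have tcn : v t <= v (c n).
  have /andP[H _] := Hc n; apply/ltW/(lt_trans _ H).
  by rewrite ltrBrDr addrC -ltrBrDr HN2 // leqW // leq_maxr.
exists (size (P n)) => N leN; rewrite -horner_trunc.
apply: le_lt_trans (HN1 n (leq_maxl _ _)).
apply: (av_le_trans KCp (y := (P n).[t])); last by rewrite (avBC KCp) HP.
rewrite -hornerN -hornerD; apply: (horner_le KCp) (tcn) _ => [|k].
  by rewrite ltW.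
rewrite coefB coef_poly; case: ifP => kN; first exact: coef_lim.
rewrite nth_default ?subrr ?(av0 KCp) ?mul0r ?ltW //.
by rewrite (leq_trans leN) // leqNgt kN.
Qed.

End Apx.

(** * Derivatives *)

Section Derivative.
Context (R : realType) (K : closedFieldType) (v : K -> R).
Context (p : nat) (p_prime : prime p) (KCp : is_Cp v p).
#[local] Hint Extern 0 (is_true (0 <= v _)) => exact: (av_ge0 KCp) : core.

Definition lim0 (f : K -> K) (l : K) : Prop :=
  forall e : R, 0 < e -> exists delta : R, 0 < delta /\
    forall h : K, h != 0 -> v h < delta -> v (f h - l) < e.

(** Unfolds to the condition that [primitive_of] imposes at one point, so that the two are exchanged
    by conversion. *)
Definition is_deriv (f : K -> K) (t d : K) : Prop :=
  lim0 (fun h => (f (t + h) - f t) / h) d.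

Lemma lim0_near f g l (r : R) : 0 < r ->
  (forall h, h != 0 -> v h < r -> f h = g h) -> lim0 f l -> lim0 g l.
Proof.
move=> r0 fg fl e e0; have [d [d0 Hd]] := fl e e0.
exists (Num.min d r); rewrite lt_min d0 r0; split=> // h h0.
by rewrite lt_min => /andP[hd hr]; rewrite -fg // Hd.
Qed.

Lemma lim0_eq f g l : (forall h, h != 0 -> f h = g h) -> lim0 f l -> lim0 g l.
Proof. by move=> fg; apply: (lim0_near ltr01) => h h0 _; apply: fg. Qed.

Lemma lim0_unique f l m : lim0 f l -> lim0 f m -> l = m.
Proof.
move=> fl fm; apply/eqP; rewrite -subr_eq0 -(av_eq0 KCp) eq_le (av_ge0 KCp) andbT.
apply: le_of_forall_gt => e e0; rewrite add0r.
have [d [d0 Hd]] := fl e e0; have [d' [d'0 Hd']] := fm e e0.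
have [h h0] : exists2 h, 0 < v h & v h < Num.min d d'.
  by apply: (av_small p_prime KCp); rewrite lt_min d0.
rewrite lt_min (av_gt0 KCp) in h0 * => /andP[hd hd'].
apply/ltW/(av_lt_trans KCp (y := f h)); first by rewrite (avBC KCp) Hd.
exact: Hd'.
Qed.

Lemma lim0_const a : lim0 (fun=> a) a.
Proof.
by move=> e e0; exists 1; split=> // h _ _; rewrite subrr (av0 KCp).
Qed.

Lemma lim0_id : lim0 id 0.
Proof. by move=> e e0; exists e; split=> // h _; rewrite subr0. Qed.

Lemma lim0_add f g l m : lim0 f l -> lim0 g m -> lim0 (fun h => f h + g h) (l + m).
Proof.
move=> fl gm e e0.
have [d [d0 Hd]] := fl e e0; have [d' [d'0 Hd']] := gm e e0.
exists (Num.min d d'); rewrite lt_min d0; split=> // h h0.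
rewrite lt_min => /andP[hd hd']; rewrite opprD addrACA.
by apply: (avD_lt KCp); [apply: Hd | apply: Hd'].
Qed.

Lemma lim0_mul f g l m : lim0 f l -> lim0 g m -> lim0 (fun h => f h * g h) (l * m).
Proof.
move=> fl gm e e0.
have M0 : 0 < 1 + v m by rewrite ltr_pwDl.
have L0 : 0 < 1 + v l by rewrite ltr_pwDl.
have [d [d0 Hd]] := fl (e / (1 + v m)) (divr_gt0 e0 M0).
have [d' [d'0 Hd']] := gm (e / (1 + v l)) (divr_gt0 e0 L0).
have [d2 [d20 Hd2]] := gm 1 ltr01.
exists (Num.min (Num.min d d') d2); rewrite !lt_min d0 d'0; split=> // h h0.
rewrite !lt_min => /andP[/andP[hd hd'] hd2].
have -> : f h * g h - l * m = (f h - l) * g h + l * (g h - m) by ring.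
have gB : v (g h) <= 1 + v m.
  rewrite -(subrK m (g h)); apply: (avD_le KCp); last by rewrite lerDr.
  by apply: le_trans (ltW (Hd2 h h0 hd2)) _; rewrite lerDl.
apply: (avD_lt KCp); rewrite (avM KCp).
  apply: le_lt_trans (ler_wpM2l _ gB) _ => //.
  by rewrite -ltr_pdivlMr // Hd.
apply: (@le_lt_trans _ _ ((1 + v l) * v (g h - m))).
  by rewrite ler_wpM2r // lerDr.
by rewrite mulrC -ltr_pdivlMr // Hd'.
Qed.

Lemma lim0_inv f l : l != 0 -> lim0 f l -> lim0 (fun h => (f h)^-1) l^-1.
Proof.
move=> l0 fl e e0; have vl : 0 < v l by rewrite (av_gt0 KCp).
have [d [d0 Hd]] := fl (Num.min (v l) (e * v l ^+ 2)) ltac:(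
  by rewrite lt_min vl mulr_gt0 ?exprn_gt0).
exists d; split=> // h h0 hd; have := Hd h h0 hd; rewrite lt_min => /andP[H1 H2].
have vf : v (f h) = v l by rewrite -(subrK l (f h)) addrC (avD_iso KCp).
have f0 : f h != 0 by rewrite -(av_gt0 KCp) vf.
have -> : (f h)^-1 - l^-1 = (l - f h) / (f h * l) by field; rewrite l0.
by rewrite (avF KCp) (avM KCp) vf (avBC KCp) ltr_pdivrMr ?mulr_gt0 // -expr2.
Qed.

Lemma is_deriv_unique f t d d' : is_deriv f t d -> is_deriv f t d' -> d = d'.
Proof. exact: lim0_unique. Qed.

Lemma is_deriv_near f g t d (r : R) : 0 < r ->
  (forall s, v (s - t) < r -> f s = g s) -> is_deriv f t d -> is_deriv g t d.
Proof.
move=> r0 fg; apply: (lim0_near r0) => h _ hr; rewrite !fg //.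
  by rewrite subrr (av0 KCp).
by rewrite addrAC subrr add0r.
Qed.

Lemma is_deriv_cont f t d : is_deriv f t d -> lim0 (fun h => f (t + h)) (f t).
Proof.
move=> /(lim0_mul lim0_id) /(lim0_add (lim0_const (f t))).
rewrite mul0r addr0; apply: lim0_eq => h h0 /=.
by rewrite mulrC divfK // subrKC.
Qed.

Lemma is_deriv_const a t : is_deriv (fun=> a) t 0.
Proof. by apply: lim0_eq (lim0_const 0) => h _; rewrite subrr mul0r. Qed.

Lemma is_deriv_id t : is_deriv id t 1.
Proof.
by apply: lim0_eq (lim0_const 1) => h h0 /=; rewrite addrAC subrr add0r mulfV.
Qed.

Lemma is_deriv_add f g t d d' :
  is_deriv f t d -> is_deriv g t d' -> is_deriv (fun s => f s + g s) t (d + d').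
Proof.
move=> fd gd; apply: lim0_eq (lim0_add fd gd) => h _ /=.
by rewrite -mulrDl opprD addrACA.
Qed.

Lemma is_deriv_mul f g t d d' : is_deriv f t d -> is_deriv g t d' ->
  is_deriv (fun s => f s * g s) t (d * g t + f t * d').
Proof.
move=> fd gd.
apply: lim0_eq (lim0_add (lim0_mul fd (is_deriv_cont gd))
                         (lim0_mul (lim0_const (f t)) gd)) => h h0 /=.
by field.
Qed.

Lemma is_deriv_scale a f t d :
  is_deriv f t d -> is_deriv (fun s => a * f s) t (a * d).
Proof.
by move=> /(is_deriv_mul (is_deriv_const a t)); rewrite mul0r add0r.
Qed.

Lemma is_deriv_inv f t d : f t != 0 -> is_deriv f t d ->
  is_deriv (fun s => (f s)^-1) t (- d / f t ^+ 2).
Proof.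
move=> f0 fd; have fc := is_deriv_cont fd.
have -> : - d / f t ^+ 2 = (-1) * d * (f t)^-1 * (f t)^-1 by field.
have H := lim0_mul (lim0_mul (lim0_mul (lim0_const (-1)) fd) (lim0_inv f0 fc))
  (lim0_const (f t)^-1).
have [r [r0 Hr]] := fc (v (f t)) ltac:(by rewrite (av_gt0 KCp)).
apply: (lim0_near r0) H => h h0 hr /=; have := Hr h h0 hr => H.
have fh0 : f (t + h) != 0.
  apply: contraTneq H => ->; rewrite sub0r (avN KCp) ltxx //.
by field; rewrite h0 f0 fh0.
Qed.

Lemma is_deriv_comp f g t d d' : is_deriv g t d' -> is_deriv f (g t) d ->
  is_deriv (fun s => f (g s)) t (d * d').
Proof.
move=> gd fd.
(* The difference quotient of f is extended by d at 0, because g (t + h) - g t may vanish for h !=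
   0. *)
pose D k := if k == 0 then d else (f (g t + k) - f (g t)) / k.
have DE k : f (g t + k) - f (g t) = D k * k.
  rewrite /D; case: eqP => [->|/eqP k0]; first by rewrite addr0 subrr mulr0.
  by rewrite divfK.
suff Dlim : lim0 (fun h => D (g (t + h) - g t)) d.
  apply: lim0_eq (lim0_mul Dlim gd) => h h0 /=.
  by rewrite mulrA -DE subrKC.
move=> e e0; have [r [r0 Hr]] := fd e e0.
have [r' [r'0 Hr']] := is_deriv_cont gd r0.
exists r'; split=> // h h0 /(Hr' h h0) hr'.
rewrite /D; case: eqP => [_|/eqP k0]; first by rewrite subrr (av0 KCp).
exact: Hr.
Qed.

Lemma is_deriv_poly (P : {poly K}) t : is_deriv (horner P) t P^`().[t].
Proof.
elim/poly_ind: P => [|P c IH].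
  rewrite deriv0 horner0; apply: lim0_eq (lim0_const 0) => h _ /=.
  by rewrite !horner0 subrr mul0r.
rewrite derivD derivC addr0 derivM derivX mulr1 hornerD hornerM hornerX.
have := is_deriv_add (is_deriv_mul IH (is_deriv_id t)) (is_deriv_const c t).
rewrite mulr1 addr0; apply: lim0_eq => h _ /=.
by rewrite !hornerD !hornerM !hornerX !hornerC.
Qed.

Lemma is_deriv_ratio (P Q : {poly K}) t : Q.[t] != 0 ->
  is_deriv (fun s => P.[s] / Q.[s]) t
    ((P^`() * Q - P * Q^`()).[t] / (Q ^+ 2).[t]).
Proof.
move=> Q0.
have := is_deriv_mul (is_deriv_poly P t) (is_deriv_inv Q0 (is_deriv_poly Q t)).
congr is_deriv; rewrite hornerD hornerN !hornerM.
by field.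
Qed.

Lemma series_at0 a f : has_series v a f -> f 0 = a 0%N.
Proof.
move=> af; apply/eqP; rewrite -subr_eq0 -(av_eq0 KCp) eq_le (av_ge0 KCp) andbT.
apply: le_of_forall_gt => e e0; rewrite add0r.
have [N H] := has_series_cvg KCp (t := 0) af ltac:(by rewrite (av0 KCp)) e0.
have := H N.+1 (leqnSn N).
rewrite horner_trunc big_ord_recl expr0 mulr1 big1 ?addr0 => [|i _].
  by rewrite (avBC KCp) => /ltW.
by rewrite expr0n mulr0.
Qed.

(** Bounding the terms on the circle |t| = |p| shows that the series beyond its linear term is at
    most B (|h| / |p|)^2, hence of second order in h. *)
Lemma series_deriv0 a f : has_series v a f -> is_deriv f 0 (a 1%N).
Proof.
move=> af; have p0 : (p%:R : K) != 0 by rewrite (natK_neq0 p_prime KCp) ?prime_gt0.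
have vp0 : 0 < v p%:R by rewrite (av_gt0 KCp).
have p1 := av_p_lt1 p_prime KCp.
have [B B0 HB] := series_terms_bounded KCp af p1.
set c := v p%:R in vp0 p1 HB.
move=> e e0; exists (Num.min c (e * c ^+ 2 / B)); split.
  by rewrite lt_min vp0 divr_gt0 // mulr_gt0 // exprn_gt0.
move=> h h0; rewrite lt_min => /andP[hc he].
have vh0 : 0 < v h by rewrite (av_gt0 KCp).
have h1 := lt_trans hc p1.
have r0 : 0 <= v h / c by rewrite divr_ge0 // ltW.
have r1 : v h / c <= 1 by rewrite ler_pdivrMr // mul1r ltW.
have HT : v (f h - (trunc a 2).[h]) <= B * (v h / c) ^+ 2.
  apply: (series_tail KCp af h1) => // [|k k2].
    by rewrite mulr_ge0 ?exprn_ge0 // ltW.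
  have -> : v (a k) * v h ^+ k = v (a k) * c ^+ k * (v h / c) ^+ k.
    by rewrite -mulrA -exprMn mulrC (mulrC c) divfK ?gt_eqF // mulrC.
  apply: ler_pM; rewrite ?mulr_ge0 ?exprn_ge0 ?(ltW vp0) ?av_ge0 //.
  by rewrite ler_wiXn2l.
have -> : (f (0 + h) - f 0) / h - a 1%N = (f h - (trunc a 2).[h]) / h.
  rewrite add0r (series_at0 af) horner_trunc big_ord_recl big_ord1 expr0 /= expr1.
  by field.
rewrite (avF KCp) ltr_pdivrMr //; apply: le_lt_trans HT _.
move: he; rewrite ltr_pdivlMr // => he.
have -> : B * (v h / c) ^+ 2 = v h * B / c ^+ 2 * v h.
  by field; rewrite gt_eqF.
by rewrite ltr_pM2r // ltr_pdivrMr ?exprn_gt0.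
Qed.

Lemma deriv0_eq_coef a f d : has_series v a f -> is_deriv f 0 d -> d = a 1%N.
Proof. by move=> /series_deriv0 H1 H2; apply: is_deriv_unique H2 H1. Qed.

(** Cauchy's estimate for the coefficient of index 1, on circles whose radius tends to 1. *)
Lemma apx_deriv_bound f d (B : R) : apx v f -> is_deriv f 0 d ->
  (forall t, v t < 1 -> v (f t) <= B) -> v d <= B.
Proof.
move=> /(apx_has_series p_prime KCp)[a af] fd HB.
rewrite (deriv0_eq_coef af fd).
have B0 : 0 <= B by apply: le_trans (HB 0 _); rewrite ?(av0 KCp).
apply: (near1_le p_prime KCp (l := 0) (k := 1)) => // c /andP[c0 c1].
apply: (cauchy_series0 KCp af) => // [|t tc]; first by rewrite -(av_gt0 KCp).
by apply: HB; rewrite tc.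
Qed.

(** A second-order Taylor remainder whose constant does not depend on the degree, so that one
    estimate serves all truncations of a series. On monomials the remainder satisfies E (k + 1) = (t
    + h) E k + k h^2 t^(k - 1). *)
Lemma poly_diff_est (P : {poly K}) (c t h : K) (B : R) : 0 <= B ->
  (forall k, v P`_k * v c ^+ k <= B) -> v t <= v c -> v h <= v c ->
  v (P.[t + h] - P.[t] - h * P^`().[t]) * v c ^+ 2 <= B * v h ^+ 2.
Proof.
move=> B0 HB tc hc.
pose E k := (t + h) ^+ k - t ^+ k - h * (k%:R * t ^+ k.-1).
have HE k : v (E k) * v c ^+ 2 <= v h ^+ 2 * v c ^+ k.
  elim: k => [|k IH].
    by rewrite /E !expr0 subrr mul0r mulr0 subr0 (av0 KCp) mul0r mulr1 exprn_ge0.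
  have -> : E k.+1 = (t + h) * E k + k%:R * h ^+ 2 * t ^+ k.-1.
    rewrite /E /=; case: k {IH} => [|k]; first by rewrite !expr0 !expr1; ring.
    by rewrite /= -!natr1 !exprS; ring.
  rewrite -(avX KCp c 2) -(avM KCp) mulrDl.
  apply: (avD_le KCp).
    rewrite -mulrA (avM KCp) (avM KCp (E k)) (avX KCp) (exprS (v c) k) [X in _ <= X]mulrCA.
    by apply: ler_pM; rewrite ?mulr_ge0 ?exprn_ge0 ?(avD_le KCp).
  case: k {IH} => [|k] /=.
    by rewrite !mul0r (av0 KCp) mulr_ge0 ?exprn_ge0.
  rewrite !(avM KCp) !(avX KCp).
  have -> : v k.+1%:R * v h ^+ 2 * v t ^+ k * v c ^+ 2 =
    v h ^+ 2 * (v k.+1%:R * (v t ^+ k * v c ^+ 2)) by ring.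
  rewrite ler_wpM2l ?exprn_ge0 //.
  rewrite [X in _ <= X](_ : _ = 1 * (v c ^+ k * v c ^+ 2)); last first.
    by rewrite mul1r -exprD addn2.
  apply: ler_pM; rewrite ?mulr_ge0 ?exprn_ge0 ?(av_nat_le1 KCp) //.
  by rewrite ler_wpM2r ?exprn_ge0 // lerXn2r ?nnegrE.
have -> : P.[t + h] - P.[t] - h * P^`().[t] = \sum_(k < size P) P`_k * E k.
  have -> : P^`().[t] = \sum_(k < size P) P`_k * (k%:R * t ^+ k.-1).
    rewrite -{1}[P]coefK poly_def raddf_sum horner_sum.
    apply: eq_bigr => k _ /=.
    by rewrite derivZ derivXn hornerZ hornerMn hornerXn mulr_natl.
  rewrite !horner_coef mulr_sumr -!sumrB; apply: eq_bigr => k _.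
  by rewrite /E; ring.
rewrite -(avX KCp c 2) -(avM KCp) mulr_suml.
apply: (av_sum_le KCp) => [|k _]; first by rewrite mulr_ge0 ?exprn_ge0.
rewrite -mulrA (avM KCp) (avM KCp (E k)) (avX KCp).
apply: le_trans (ler_wpM2l (av_ge0 KCp _) (HE k)) _.
by rewrite mulrCA mulrC ler_wpM2r ?exprn_ge0.
Qed.

(* [t f'(t)] rather than [f'(t)] avoids a shift of the indices. *)
Lemma has_series_theta a f f' : has_series v a f ->
  (forall t, v t < 1 -> is_deriv f t (f' t)) ->
  has_series v (fun k => k%:R * a k) (fun t => t * f' t).
Proof.
move=> af fd t t1; apply/(av_cvgP KCp) => e e0.
have [c /andP[]] : exists c, Num.max (v t) 0 < v c < 1.
  by apply: (av_near1 p_prime KCp); rewrite gt_max t1 ltr01.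
rewrite gt_max => /andP[tc c0] c1.
have [B B0 HB] := series_terms_bounded KCp af c1.
have [d [d0 Hd]] := fd t t1 e e0.
have c20 : 0 < v c ^+ 2 by rewrite exprn_gt0.
(* The increment h is fixed before N: it is so small that the difference quotients of f and of every
   truncation are within e of the derivatives. Then N is taken so large that f and its truncation
   agree up to e |h| at t and at t + h. *)
have [h h0 h_lt] : exists2 h, 0 < v h &
    v h < Num.min (Num.min d (v c)) (e * v c ^+ 2 / B).
  apply: (av_small p_prime KCp).
  by rewrite !lt_min d0 c0 divr_gt0 // mulr_gt0.
move: h_lt; rewrite !lt_min => /andP[/andP[hd hc] he].
have h0' : h != 0 by rewrite -(av_gt0 KCp).
have th1 : v (t + h) < 1 by rewrite (avD_lt KCp) // (lt_trans hc).
have [N1 HN1] := has_series_cvg KCp af th1 (mulr_gt0 e0 h0).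
have [N2 HN2] := has_series_cvg KCp af t1 (mulr_gt0 e0 h0).
exists (maxn N1 N2) => N; rewrite geq_max => /andP[/HN1 H1 /HN2 H2].
have -> : \sum_(k < N) k%:R * a k * t ^+ k = t * (trunc a N)^`().[t].
  rewrite /trunc poly_def raddf_sum horner_sum mulr_sumr.
  apply: eq_bigr => k _ /=.
  rewrite derivZ derivXn hornerZ hornerMn hornerXn mulr_natl.
  by case: (k : nat) => [|j]; rewrite ?mulr0n ?mul0r ?mulr0 // exprS -mulr_natl /=; ring.
rewrite -mulrBr (avM KCp); apply: le_lt_trans (ler_piMl _ (ltW t1)) _ => //.
set P := trunc a N.
have H3 : v ((P.[t + h] - P.[t]) / h - P^`().[t]) < e.
  have -> : (P.[t + h] - P.[t]) / h - P^`().[t] =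
    (P.[t + h] - P.[t] - h * P^`().[t]) / h by field.
  rewrite (avF KCp) ltr_pdivrMr // -(ltr_pM2r c20).
  apply: le_lt_trans (poly_diff_est (ltW B0) _ (ltW tc) (ltW hc)) _ => [k|].
    rewrite coef_poly; case: ifP => // _.
    by rewrite (av0 KCp) mul0r ltW.
  move: he; rewrite ltr_pdivlMr // => he.
  have -> : B * v h ^+ 2 = v h * B * v h by ring.
  by rewrite [X in _ < X]mulrAC ltr_pM2r.
rewrite -/P in H1 H2.
have H4 : v ((P.[t + h] - P.[t]) / h - (f (t + h) - f t) / h) < e.
  rewrite -mulrBl (avF KCp) ltr_pdivrMr // opprB.
  have -> : P.[t + h] - P.[t] + (f t - f (t + h)) =
    (P.[t + h] - f (t + h)) - (P.[t] - f t) by ring.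
  exact: (avB_lt KCp).
apply: (av_lt_trans KCp (y := (f (t + h) - f t) / h)); last exact: Hd.
by apply: (av_lt_trans KCp (y := (P.[t + h] - P.[t]) / h)); rewrite // (avBC KCp).
Qed.

End Derivative.

(** * Proportionality of series with vanishing Wronskian *)

Section Wronskian.
Context (R : realType) (K : closedFieldType) (v : K -> R).
Context (p : nat) (p_prime : prime p) (KCp : is_Cp v p).
#[local] Hint Extern 0 (is_true (0 <= v _)) => exact: (av_ge0 KCp) : core.

Lemma series_tail_geom a f c B N t : has_series v a f -> 0 < v c -> 0 <= B ->
  (forall k, v (a k) * v c ^+ k <= B) -> v t < 1 -> v t <= v c ->
  v (f t - (trunc a N).[t]) <= B * (v t / v c) ^+ N.
Proof.
move=> af c0 B0 HB t1 tc.
have r0 : 0 <= v t / v c by rewrite divr_ge0.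
have r1 : v t / v c <= 1 by rewrite ler_pdivrMr // mul1r.
apply: (series_tail KCp af t1) => // [|k Nk]; first by rewrite mulr_ge0 ?exprn_ge0.
have -> : v (a k) * v t ^+ k = v (a k) * v c ^+ k * (v t / v c) ^+ k.
  by rewrite -mulrA -exprMn mulrC (mulrC (v c)) divfK ?gt_eqF // mulrC.
apply: ler_pM; rewrite ?mulr_ge0 ?exprn_ge0 ?av_ge0 //.
by rewrite ler_wiXn2l.
Qed.

(** The existence of the expansion of the product comes from [apx_mul]; a Cauchy estimate against
    the product of two truncations identifies its coefficients. *)
Lemma mul_coef a b d f g : has_series v a f -> has_series v b g ->
  has_series v d (fun t => f t * g t) ->
  forall k, d k = \sum_(i < k.+1) a i * b (k - i)%N.
Proof.
move=> af bg dfg k; have [c /andP[c0 c1]] := av_near1 p_prime KCp (@ltr01 R).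
have ck0 : 0 < v c ^+ k by rewrite exprn_gt0.
have c0' : c != 0 by rewrite -(av_gt0 KCp).
apply/eqP; rewrite -subr_eq0 -(av_eq0 KCp) eq_le (av_ge0 KCp) andbT.
rewrite -(pmulr_lle0 _ ck0); apply: le_of_forall_gt => e e0; rewrite add0r.
have [A A0 HA] := series_terms_bounded KCp af c1.
have [B B0 HB] := series_terms_bounded KCp bg c1.
have [N1 HN1] := series_trunc_approx KCp af c1 (divr_gt0 e0 B0).
have [N2 HN2] := series_trunc_approx KCp bg c1 (divr_gt0 e0 A0).
pose N := maxn (maxn N1 N2) k.+1.
have N1N : (N1 <= N)%N by rewrite /N; lia.
have N2N : (N2 <= N)%N by rewrite /N; lia.
have kN : (k < N)%N by rewrite /N; lia.
have := cauchy_series (P := trunc a N * trunc b N) KCp dfg c0' c1 (ltW e0).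
move=> /(_ _ k); rewrite coefM.
have -> : \sum_(j < k.+1) (trunc a N)`_j * (trunc b N)`_(k - j) =
    \sum_(i < k.+1) a i * b (k - i)%N.
  apply: eq_bigr => i _; rewrite !coef_poly.
  by rewrite (leq_ltn_trans (leq_subr i k) kN) (leq_ltn_trans (leq_ord i) kN).
apply=> t tc; rewrite hornerM.
have -> : f t * g t - (trunc a N).[t] * (trunc b N).[t] =
  (f t - (trunc a N).[t]) * g t +
  (trunc a N).[t] * (g t - (trunc b N).[t]) by ring.
have tc' : v t <= v c by rewrite tc.
apply: (avD_le KCp); rewrite (avM KCp).
  rewrite -[e](divfK (lt0r_neq0 B0)).
  apply: ler_pM => //; first exact: HN1.
  exact: (series_bound KCp bg c1 (ltW B0)).
rewrite -[e](divfK (lt0r_neq0 A0)) mulrC.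
apply: ler_pM => //; first exact: HN2.
apply: (horner_le KCp (ltW A0) tc') => j; rewrite coef_poly.
by case: ifP => // _; rewrite (av0 KCp) mul0r ltW.
Qed.

Lemma series_zero f : has_series v (fun=> 0) f -> forall t, v t < 1 -> f t = 0.
Proof.
move=> f0 t t1; apply/eqP; rewrite -(av_eq0 KCp) eq_le (av_ge0 KCp) andbT.
by apply: (series_bound KCp f0 t1) => // k; rewrite (av0 KCp) mul0r.
Qed.

Lemma has_series_eq a b f g : (forall k, a k = b k) ->
  (forall t, v t < 1 -> f t = g t) -> has_series v a f -> has_series v b g.
Proof.
move=> ab fg af t t1; rewrite -fg //; have := af t t1.
suff -> : (fun k => b k * t ^+ k) = (fun k => a k * t ^+ k) by [].
by apply/funext => k; rewrite ab.
Qed.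

Lemma has_series_lin a b f g c : has_series v a f -> has_series v b g ->
  has_series v (fun k => a k + c * b k) (fun t => f t + c * g t).
Proof.
move=> af bg t t1; apply/(av_cvgP KCp) => e e0.
have c0 : 0 < 1 + v c by rewrite ltr_pwDl.
have [N1 H1] := has_series_cvg KCp af t1 e0.
have [N2 H2] := has_series_cvg KCp bg t1 (divr_gt0 e0 c0).
exists (maxn N1 N2) => N; rewrite geq_max => /andP[/H1 {}H1 /H2 {}H2].
have -> : \sum_(k < N) (a k + c * b k) * t ^+ k - (f t + c * g t) =
  ((trunc a N).[t] - f t) + c * ((trunc b N).[t] - g t).
  rewrite !horner_trunc mulrBr mulr_sumr opprD addrACA -big_split /=.
  by congr (_ + _); apply: eq_bigr => k _; rewrite mulrDl mulrA.
apply: (avD_lt KCp) => //; rewrite (avM KCp).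
apply: le_lt_trans (ler_wpM2r _ (_ : v c <= 1 + v c)) _; rewrite ?lerDr //.
by rewrite mulrC -ltr_pdivlMr.
Qed.

Lemma series_nonzero_coef a f t : has_series v a f -> v t < 1 -> f t != 0 ->
  exists k, a k != 0.
Proof.
move=> af t1 ft0; apply: contrapT => H.
have a0 k : a k = 0 by apply/eqP/negPn/negP => ak; apply: H; exists k.
by move: ft0; rewrite (series_zero (has_series_eq a0 (fun _ _ => erefl) af)) ?eqxx.
Qed.

(** Near 0 the first nonzero term a_m h^m dominates the tail, which is at most B (|h| / |p|)^(m +
    1). A nonzero value anywhere in the disc guarantees that such a term exists. *)
Lemma isolated_zeros f t : apx v f -> v t < 1 -> f t != 0 ->
  exists2 d : R, 0 < d & forall h, h != 0 -> v h < d -> f h != 0.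
Proof.
move=> /(apx_has_series p_prime KCp)[a af] t1 ft0.
have ex_a := series_nonzero_coef af t1 ft0.
case: (ex_minnP ex_a) => m am mmin.
have p0 : (p%:R : K) != 0 by rewrite (natK_neq0 p_prime KCp) ?prime_gt0.
have p1 := av_p_lt1 p_prime KCp.
have vp0 : 0 < v p%:R by rewrite (av_gt0 KCp).
have [B B0 HB] := series_terms_bounded KCp af p1.
have am0 : 0 < v (a m) by rewrite (av_gt0 KCp).
exists (Num.min (v p%:R) (v (a m) * v p%:R ^+ m.+1 / B)).
  by rewrite lt_min vp0 divr_gt0 // mulr_gt0 // exprn_gt0.
move=> h h0; rewrite lt_min => /andP[hp hB]; apply/negP => /eqP fh0.
have := series_tail_geom m.+1 af vp0 (ltW B0) HB (lt_trans hp p1) (ltW hp).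
rewrite fh0 sub0r (avN KCp) horner_trunc big_ord_recr /= big1 ?add0r; last first.
  move=> i _; rewrite (_ : a i = 0) ?mul0r //; apply/eqP/negPn/negP => /mmin.
  by rewrite leqNgt ltn_ord.
apply/negP; rewrite -ltNge (avM KCp) (avX KCp) expr_div_n.
have vh0 : 0 < v h by rewrite (av_gt0 KCp).
rewrite mulrA ltr_pdivrMr ?exprn_gt0 //.
have -> : B * v h ^+ m.+1 = v h * B * v h ^+ m by rewrite exprS; ring.
by rewrite [X in _ < X]mulrAC ltr_pM2r ?exprn_gt0 // -ltr_pdivlMr.
Qed.

(** The coefficient of t^k in g (t f') - f (t g'), where the index i contributes the factor (k - i)
    - i. *)
Lemma wronskian_coef a b f g f' g' :
  has_series v a f -> has_series v b g ->
  (forall t, v t < 1 -> is_deriv v f t (f' t)) ->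
  (forall t, v t < 1 -> is_deriv v g t (g' t)) ->
  (forall t, v t < 1 -> g t * f' t = f t * g' t) ->
  forall k, \sum_(i < k.+1) (k%:R - (i%:R + i%:R)) * (b i * a (k - i)%N) = 0.
Proof.
move=> af bg fd gd H k.
have tf := has_series_theta p_prime KCp af fd.
have tg := has_series_theta p_prime KCp bg gd.
have [d dgf] := apx_has_series p_prime KCp
  (apx_mul KCp (apx_series KCp bg) (apx_series KCp tf)).
have d1 := mul_coef bg tf dgf.
have dfg : has_series v d (fun t => t * g' t * f t).
  by apply: has_series_eq dgf => // t t1; rewrite mulrCA H //; ring.
have d2 := mul_coef tg af dfg.
under eq_bigr => i _ do rewrite mulrBl mulrDl.
have -> : \sum_(i < k.+1) (k%:R * (b i * a (k - i)%N) -
    (i%:R * (b i * a (k - i)%N) + i%:R * (b i * a (k - i)%N))) =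
  \sum_(i < k.+1) b i * ((k - i)%:R * a (k - i)%N) -
  \sum_(i < k.+1) i%:R * b i * a (k - i)%N.
  rewrite -sumrB; apply: eq_bigr => i _.
  by rewrite natrB ?leq_ord //; ring.
by rewrite -d1 -d2 subrr.
Qed.

(** As g may have zeros in the disc, the argument is on coefficients. Let m be the order of g at 0
    and choose c so that f - c g, with coefficients a, has a_m = 0. The equation of index m + l
    contains (l - m) b_m a_l and otherwise only products that involve some b_i with i < m, which is
    0, or some a_j with j < l; hence a = 0 by induction. *)
Lemma wronskian_prop f g f' g' t0 : apx v f -> apx v g ->
  (forall t, v t < 1 -> is_deriv v f t (f' t)) ->
  (forall t, v t < 1 -> is_deriv v g t (g' t)) ->
  (forall t, v t < 1 -> g t * f' t = f t * g' t) ->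
  v t0 < 1 -> g t0 != 0 ->
  exists c, forall t, v t < 1 -> f t = c * g t.
Proof.
move=> af ag fd gd H t01 gt0.
have [b bg] := apx_has_series p_prime KCp ag.
have [a0 a0f] := apx_has_series p_prime KCp af.
have ex_b := series_nonzero_coef bg t01 gt0.
case: (ex_minnP ex_b) => m bm mmin.
pose c := a0 m / b m; exists c.
pose f1 t := f t + (- c) * g t; pose f1' t := f' t + (- c) * g' t.
have f1d t : v t < 1 -> is_deriv v f1 t (f1' t).
  move=> t1; apply: (is_deriv_add KCp (fd t t1)).
  exact: (is_deriv_scale KCp _ (gd t t1)).
have af1 := has_series_lin (- c) a0f bg.
set a := (fun k => _) in af1.
have am : a m = 0 by rewrite /a /c mulNr divfK ?subrr.
have HW : forall t, v t < 1 -> g t * f1' t = f1 t * g' t.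
  by move=> t t1; rewrite /f1 /f1' mulrDr H //; ring.
have W := wronskian_coef af1 bg f1d gd HW.
have a_eq0 : forall l, a l = 0.
  elim/ltn_ind => l IH; have [->//|lm] := eqVneq l m.
  have := W (m + l)%N; have mlt : (m < (m + l).+1)%N by rewrite ltnS leq_addr.
  rewrite (bigD1 (Ordinal mlt)) //= big1 ?addr0 => [|i].
    rewrite addnC addnK natrD opprD addrACA subrr addr0 => /eqP.
    rewrite !mulf_eq0 (negPf bm) /= => /orP[|/eqP //].
    rewrite subr_eq0 => /eqP lmK; exfalso; move/eqP: lm; apply.
    have natK_inj i j : (i < j)%N -> i%:R <> j%:R :> K.
      move=> ij /eqP; rewrite eq_sym -subr_eq0 -natrB 1?ltnW //.
      by apply/negP; rewrite (natK_neq0 p_prime KCp) ?subn_gt0.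
    by case: (ltngtP l m) => // /natK_inj; [move/(_ lmK) | move/(_ (esym lmK))].
  rewrite -val_eqE /= => im; have [lt_im|] := ltnP i m.
    rewrite (_ : b i = 0) ?mul0r ?mulr0 //; apply/eqP/negPn/negP => /mmin.
    by rewrite leqNgt lt_im.
  rewrite leq_eqVlt eq_sym (negPf im) /= => lt_mi.
  by rewrite IH ?mulr0 //; have := ltn_ord i; lia.
move=> t t1; have := series_zero (has_series_eq a_eq0 (fun _ _ => erefl) af1) t1.
by move/eqP; rewrite mulNr subr_eq0 => /eqP.
Qed.

End Wronskian.

(** * The coefficient ring *)

Section CoefficientRing.
Context (R : realType) (K : closedFieldType) (v : K -> R).
Context (p : nat) (p_prime : prime p) (KCp : is_Cp v p).
#[local] Hint Extern 0 (is_true (0 <= v _)) => exact: (av_ge0 KCp) : core.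
Context (T : seq K) (T_unit : forall s, s \in T -> v s = 1).

Definition off (t : K) : Prop := forall s, s \in T -> 1 <= v (t - s).

Definition shell (mu : R) (t : K) : Prop := [/\ mu <= v t, v t <= 1 & off t].

Definition shell_gt (lam : R) (t : K) : Prop := [/\ lam < v t, v t <= 1 & off t].

Lemma off_open t : v t < 1 -> off t.
Proof.
by move=> t1 s sT; rewrite (avBC KCp) (avB_iso KCp) (T_unit sT).
Qed.

Lemma off_near t s : off t -> v (s - t) < 1 -> off s.
Proof.
move=> Ht st x xT; rewrite leNgt; apply/negP => sx.
have := Ht x xT; apply/negP; rewrite -ltNge.
by apply: (av_lt_trans KCp (y := s)) => //; rewrite (avBC KCp).
Qed.

Lemma shell_sub lam mu t : lam < mu -> shell mu t -> shell_gt lam t.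
Proof. by move=> lm [mt t1 tT]; split=> //; apply: lt_le_trans mt. Qed.

Lemma shell_gt_sub lam lam' t : lam <= lam' -> shell_gt lam' t -> shell_gt lam t.
Proof. by move=> ll [mt t1 tT]; split=> //; apply: le_lt_trans mt. Qed.

Lemma shell_gtP lam t : lam < 1 -> shell_gt lam t ->
  exists mu, [/\ lam < mu, mu < 1 & shell mu t].
Proof.
move=> l1 [lt t1 tT].
have [h1|h1] := ltP (v t) 1; first by exists (v t); split.
exists ((lam + 1) / 2); split; [lra | lra |].
by split=> //; lra.
Qed.

Lemma shell_near mu t h : shell mu t -> v h < v t -> shell mu (t + h).
Proof.
move=> [mt t1 tT] ht; split; rewrite ?(avD_iso KCp) //.
by apply: off_near tT _; rewrite addrAC subrr add0r (lt_le_trans ht).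
Qed.

Lemma not_shell mu q : ~ shell mu q ->
  [\/ v q < mu, 1 < v q | exists2 s, s \in T & v (q - s) < 1].
Proof.
move=> nq; have [h1|h1] := ltP (v q) mu; first by constructor 1.
have [h2|h2] := ltP 1 (v q); first by constructor 2.
constructor 3; apply: contrapT => H; apply: nq; split=> // s sT.
by rewrite leNgt; apply/negP => sq; apply: H; exists s.
Qed.

Lemma root_dist mu t q : mu <= 1 -> shell mu t -> ~ shell mu q -> mu <= v (t - q).
Proof.
move=> mu1 [mt t1 tT] /not_shell[qmu|q1|[s sT qs]].
- by rewrite (avB_iso KCp) // (lt_le_trans qmu).
- rewrite (avBC KCp) (avB_iso KCp) ?(le_lt_trans t1) //.
  by rewrite (le_trans mu1) // ltW.
- have ts := tT s sT; rewrite (avBC KCp) in qs.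
  rewrite -(subrKA s) (avD_iso KCp) ?(lt_le_trans qs) //; exact: le_trans ts.
Qed.

Definition unif_rational (mu : R) (f : K -> K) : Prop :=
  forall e : R, 0 < e -> exists P Q : {poly K},
    (forall t, shell mu t -> Q.[t] != 0) /\
    (forall t, shell mu t -> v (f t - P.[t] / Q.[t]) <= e).

(* Functions on [lam < |t| <= 1] minus the residue discs of [T].  They
   overconverge into the residue disc of 0 only: this is enough for the
   identity principle, and it makes the overconvergence of the rigid
   polylogarithm along its poles superfluous. *)
Definition coef_fun (f : K -> K) : Prop :=
  exists lam : R, [/\ 0 < lam, lam < 1 &
    forall mu, lam < mu -> mu < 1 -> unif_rational mu f].

(** The roots of Q are outside the shell, hence at distance at least [mu] from each of its points;
    this bounds |Q| from below. *)
Lemma ratio_bounded mu (P Q : {poly K}) : 0 < mu -> mu <= 1 ->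
  (forall t, shell mu t -> Q.[t] != 0) ->
  exists2 B, 0 < B & forall t, shell mu t -> v (P.[t] / Q.[t]) <= B.
Proof.
move=> mu0 mu1 HQ; have [A A0 HA] := poly_bounded KCp P.
have [qs defQ] := poly_factor Q.
have [Q0|Q0] := eqVneq (lead_coef Q) 0.
  exists A => // t Ht; have := HQ t Ht.
  by rewrite defQ Q0 scale0r horner0 eqxx.
have Qv0 : 0 < v (lead_coef Q) by rewrite (av_gt0 KCp).
have B0 : 0 < v (lead_coef Q) * mu ^+ size qs by rewrite mulr_gt0 ?exprn_gt0.
exists (A / (v (lead_coef Q) * mu ^+ size qs)); first by rewrite divr_gt0.
move=> t Ht; have [_ t1 _] := Ht; rewrite (avF KCp).
apply: ler_pM; rewrite ?invr_ge0 ?HA //.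
rewrite lef_pV2 ?posrE ?(av_gt0 KCp) ?HQ //.
have -> : v Q.[t] = v (lead_coef Q) * \prod_(q <- qs) v (t - q).
  by rewrite {1}defQ (horner_factor KCp).
rewrite ler_wpM2l //.
rewrite (_ : mu ^+ size qs = \prod_(q <- qs) mu); last first.
  by rewrite big_const_seq count_predT iter_mulr_1.
rewrite !big_seq; apply: ler_prod => q qin; rewrite (ltW mu0) /=.
apply: root_dist => // Hq; have := HQ q Hq.
rewrite defQ hornerZ mulf_eq0 negb_or => /andP[_].
by rewrite -[X in X != 0]/(_.[q]) -rootE root_prod_XsubC qin.
Qed.

Lemma unif_rational_bounded mu f : 0 < mu -> mu <= 1 -> unif_rational mu f ->
  exists2 B, 0 < B & forall t, shell mu t -> v (f t) <= B.
Proof.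
move=> mu0 mu1 Hf; have [P [Q [HQ HP]]] := Hf 1 ltr01.
have [B B0 HB] := ratio_bounded P mu0 mu1 HQ.
exists (Num.max 1 B); first by rewrite lt_max ltr01.
move=> t Ht; rewrite -[f t](subrK (P.[t] / Q.[t])); apply: (avD_le KCp).
  by rewrite le_max HP.
by rewrite le_max HB ?orbT.
Qed.

Lemma unif_rational_const mu a : unif_rational mu (fun=> a).
Proof.
move=> e e0; exists a%:P, 1; split=> t _; rewrite !hornerE ?oner_neq0 //.
by rewrite divr1 subrr (av0 KCp) ltW.
Qed.

Lemma unif_rational_id mu : unif_rational mu id.
Proof.
move=> e e0; exists 'X, 1; split=> t _; rewrite !hornerE ?oner_neq0 //.
by rewrite divr1 subrr (av0 KCp) ltW.
Qed.

Lemma unif_rational_add mu f g : unif_rational mu f -> unif_rational mu g ->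
  unif_rational mu (fun t => f t + g t).
Proof.
move=> Hf Hg e e0; have [P [Q [HQ HP]]] := Hf e e0.
have [P' [Q' [HQ' HP']]] := Hg e e0.
exists (P * Q' + P' * Q), (Q * Q'); split=> t Ht.
  by rewrite hornerM mulf_neq0 ?HQ ?HQ'.
rewrite hornerD !hornerM.
have -> : f t + g t - (P.[t] * Q'.[t] + P'.[t] * Q.[t]) / (Q.[t] * Q'.[t]) =
  (f t - P.[t] / Q.[t]) + (g t - P'.[t] / Q'.[t]).
  by field; rewrite HQ ?HQ'.
by apply: (avD_le KCp); [apply: HP | apply: HP'].
Qed.

Lemma unif_rational_mul mu f g : 0 < mu -> mu <= 1 ->
  unif_rational mu f -> unif_rational mu g ->
  unif_rational mu (fun t => f t * g t).
Proof.
move=> mu0 mu1 Hf Hg e e0.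
have [B B0 HB] := unif_rational_bounded mu0 mu1 Hg.
have [P [Q [HQ HP]]] := Hf (e / B) (divr_gt0 e0 B0).
have [A A0 HA] := ratio_bounded P mu0 mu1 HQ.
have [P' [Q' [HQ' HP']]] := Hg (e / A) (divr_gt0 e0 A0).
exists (P * P'), (Q * Q'); split=> t Ht.
  by rewrite hornerM mulf_neq0 ?HQ ?HQ'.
rewrite !hornerM.
have -> : f t * g t - P.[t] * P'.[t] / (Q.[t] * Q'.[t]) =
  (f t - P.[t] / Q.[t]) * g t + P.[t] / Q.[t] * (g t - P'.[t] / Q'.[t]).
  by field; rewrite HQ ?HQ'.
apply: (avD_le KCp); rewrite (avM KCp).
  rewrite -[e](divfK (lt0r_neq0 B0)).
  by apply: ler_pM; rewrite ?HP ?HB.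
rewrite -[e](divfK (lt0r_neq0 A0)) mulrC.
by apply: ler_pM; rewrite ?HP' ?HA.
Qed.

Lemma coef_fun2 (op : K -> K -> K) f g :
  (forall mu, 0 < mu -> mu <= 1 -> unif_rational mu f -> unif_rational mu g ->
     unif_rational mu (fun t => op (f t) (g t))) ->
  coef_fun f -> coef_fun g -> coef_fun (fun t => op (f t) (g t)).
Proof.
move=> H [l [l0 l1 Hf]] [l' [l'0 l'1 Hg]].
exists (Num.max l l'); rewrite lt_max l0 gt_max l1; split=> // mu.
rewrite gt_max => /andP[lmu l'mu] mu1; apply: H; [|exact: ltW|exact: Hf|exact: Hg].
exact: lt_trans lmu.
Qed.

Lemma coef_fun_add f g :
  coef_fun f -> coef_fun g -> coef_fun (fun t => f t + g t).
Proof. by apply: coef_fun2 => mu _ _; apply: unif_rational_add. Qed.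

Lemma coef_fun_mul f g :
  coef_fun f -> coef_fun g -> coef_fun (fun t => f t * g t).
Proof. by apply: coef_fun2 => mu mu0 mu1; apply: unif_rational_mul. Qed.

Lemma half_01 : 0 < 2^-1 :> R /\ 2^-1 < 1 :> R.
Proof. by split; lra. Qed.

Lemma coef_fun_const a : coef_fun (fun=> a).
Proof.
have [h0 h1] := half_01; exists 2^-1; split=> // mu _ _.
exact: unif_rational_const.
Qed.

Lemma coef_fun_id : coef_fun id.
Proof.
have [h0 h1] := half_01; exists 2^-1; split=> // mu _ _.
exact: unif_rational_id.
Qed.

Lemma coef_fun_scale a f : coef_fun f -> coef_fun (fun t => a * f t).
Proof. by move=> ?; apply: coef_fun_mul => //; apply: coef_fun_const. Qed.

Lemma coef_fun_germ f g lam : lam < 1 ->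
  (forall t, shell_gt lam t -> f t = g t) -> coef_fun f -> coef_fun g.
Proof.
move=> lam1 fg [l [l0 l1 Hf]].
exists (Num.max l lam); rewrite lt_max l0 gt_max l1; split=> // mu.
rewrite gt_max => /andP[lmu lammu] mu1 e e0.
have [P [Q [HQ HP]]] := Hf mu lmu mu1 e e0.
exists P, Q; split=> // t Ht; rewrite -fg ?HP //.
exact: shell_sub Ht.
Qed.

(** The open disc of radius |c| around t stays in the shell, where the rational approximations have
    no poles. The choice c = t reaches the points with |t| < 1; the choice c = 1 gives the residue
    disc of a unit. *)
Lemma unif_rational_apx mu f t c : unif_rational mu f -> shell mu t ->
  v c <= v t -> apx v (fun h => f (t + c * h)).
Proof.
move=> Hf Ht ct; apply: (apx_ulim KCp) => e e0.
have [P [Q [HQ HP]]] := Hf e e0.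
have H h : v h < 1 -> shell mu (t + c * h).
  move=> h1; have [c0|c0] := eqVneq c 0; first by rewrite c0 mul0r addr0.
  apply: shell_near => //; apply: lt_le_trans ct; rewrite (avM KCp) gtr_pMr //.
  by rewrite (av_gt0 KCp).
pose S := t%:P + c *: 'X.
have hS h : S.[h] = t + c * h by rewrite !hornerE.
exists (fun h => (P \Po S).[h] / (Q \Po S).[h]) => [|h h1].
  apply: (apx_ratio KCp) => h h1; rewrite horner_comp hS.
  by apply: HQ; apply: H.
by rewrite !horner_comp hS; apply/HP/H.
Qed.

Lemma coef_fun_apx f t : coef_fun f -> v t = 1 -> off t ->
  apx v (fun h => f (t + h)).
Proof.
move=> [l [l0 l1 Hf]] t1 tT; pose mu := (l + 1) / 2.
have Ht : shell mu t by split; rewrite ?t1 // /mu; lra.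
have H : apx v (fun h => f (t + 1 * h)).
  apply: unif_rational_apx Ht _; first by apply: Hf; rewrite /mu; lra.
  by rewrite (av1 KCp) t1.
by apply: (apx_eq _ H) => h _; rewrite mul1r.
Qed.

Lemma is_deriv_rescale f t c d : c != 0 ->
  is_deriv v (fun h => f (t + c * h)) 0 d -> is_deriv v f t (d / c).
Proof.
move=> c0 Hd.
have H : is_deriv v (fun s => c^-1 * s + (- (c^-1 * t))) t (c^-1).
  have := is_deriv_add KCp (is_deriv_scale KCp c^-1 (is_deriv_id KCp t))
    (is_deriv_const KCp (- (c^-1 * t)) t).
  by rewrite mulr1 addr0.
have E0 : c^-1 * t + (- (c^-1 * t)) = 0 by rewrite subrr.
have := is_deriv_comp KCp H; move=> /(_ (fun h => f (t + c * h)) d).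
rewrite E0 => /(_ Hd); apply: (is_deriv_near KCp ltr01) => s _.
by congr f; field.
Qed.

Lemma is_deriv_shift f t c d : is_deriv v f t d ->
  is_deriv v (fun h => f (t + c * h)) 0 (c * d).
Proof.
move=> Hd.
have H : is_deriv v (fun h => t + c * h) 0 c.
  have := is_deriv_add KCp (is_deriv_const KCp t 0)
    (is_deriv_scale KCp c (is_deriv_id KCp 0)).
  by rewrite mulr1 add0r.
have := is_deriv_comp KCp H; move=> /(_ f d).
by rewrite mulr0 addr0 mulrC => /(_ Hd).
Qed.

Lemma unif_rational_deriv_ex mu f t : 0 < mu -> unif_rational mu f -> shell mu t ->
  exists d, is_deriv v f t d.
Proof.
move=> mu0 Hf Ht; have [mt _ _] := Ht.
have t0 : t != 0 by rewrite -(av_gt0 KCp) (lt_le_trans mu0).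
have [a Ha] := apx_has_series p_prime KCp (unif_rational_apx Hf Ht (lexx _)).
exists (a 1%N / t); apply: is_deriv_rescale => //.
exact: (series_deriv0 p_prime KCp).
Qed.

Lemma unif_rational_deriv mu f f' : 0 < mu -> mu <= 1 -> unif_rational mu f ->
  (forall t, shell mu t -> is_deriv v f t (f' t)) -> unif_rational mu f'.
Proof.
move=> mu0 mu1 Hf fd e e0.
(* Cauchy's estimate for the derivative, on the disc of radius |t| >= [mu] around t, loses at most
   the factor 1 / [mu]; the precision e [mu] compensates for it. *)
have [P [Q [HQ HP]]] := Hf (e * mu) (mulr_gt0 e0 mu0).
exists (P^`() * Q - P * Q^`()), (Q ^+ 2); split=> t Ht.
  by rewrite horner_exp expf_neq0 ?HQ.
have [mt _ _] := Ht.
have t0 : t != 0 by rewrite -(av_gt0 KCp) (lt_le_trans mu0).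
set d := _ / _; have dR : is_deriv v (fun s => P.[s] / Q.[s]) t d.
  exact: (is_deriv_ratio KCp P (HQ t Ht)).
pose k s := f s + (-1) * (P.[s] / Q.[s]).
have kd : is_deriv v k t (f' t + (-1) * d).
  exact: (is_deriv_add KCp (fd t Ht) (is_deriv_scale KCp _ dR)).
have near h : v h < 1 -> shell mu (t + t * h).
  by move=> h1; apply: shell_near => //; rewrite (avM KCp) gtr_pMr ?(av_gt0 KCp).
have uk : unif_rational mu k.
  apply: unif_rational_add => //; apply: unif_rational_mul => //.
    exact: unif_rational_const.
  move=> e' e'0; exists P, Q; split=> // s _.
  by rewrite subrr (av0 KCp) ltW.
have := apx_deriv_bound p_prime KCp (unif_rational_apx uk Ht (lexx _))
  (is_deriv_shift t kd) (B := e * mu).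
move=> H; have {}H : v (t * (f' t + -1 * d)) <= e * mu.
  by apply: H => h /near Hh; rewrite /k mulN1r HP.
rewrite mulN1r (avM KCp) in H.
have vt0 : 0 < v t by rewrite (av_gt0 KCp).
rewrite -(ler_pM2l vt0); apply: le_trans H _.
by rewrite mulrC ler_wpM2r // ltW.
Qed.

Lemma coef_fun_deriv f : coef_fun f -> exists f' lam,
  [/\ coef_fun f', lam < 1 & forall t, shell_gt lam t -> is_deriv v f t (f' t)].
Proof.
move=> [l [l0 l1 Hf]].
have ex t : exists d, shell_gt l t -> is_deriv v f t d.
  have [Ht|nt] := pselect (shell_gt l t); last by exists 0.
  have [mu [lmu mu1 Hm]] := shell_gtP l1 Ht.
  have [d Hd] := unif_rational_deriv_ex (lt_trans l0 lmu) (Hf _ lmu mu1) Hm.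
  by exists d.
have [f' Hf'] := boolp.choice ex.
exists f', l; split=> //; exists l; split=> // mu lmu mu1.
apply: unif_rational_deriv (Hf mu lmu mu1) _ => [||t Ht].
- exact: lt_trans lmu.
- exact: ltW.
- by apply/Hf'/(shell_sub lmu).
Qed.

(** * Identity principles for the coefficient ring *)

Lemma root_dist_unit mu t q : mu <= 1 -> v t = 1 -> off t -> ~ shell mu q ->
  v (t - q) = Num.max 1 (v q).
Proof.
move=> mu1 t1 tT /not_shell[qmu|q1|[s sT qs]].
- rewrite (avB_iso KCp) t1 ?(lt_le_trans qmu) //.
  by apply/esym/max_idPl/ltW/(lt_le_trans qmu).
- rewrite (avBC KCp) (avB_iso KCp) ?t1 //.
  by apply/esym/max_idPr/ltW.
- have qv : v q = 1.
    by rewrite -(subrK s q) addrC (avD_iso KCp) (T_unit sT).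
  have ts := tT s sT; rewrite (avBC KCp) in qs.
  rewrite -(subrKA s) (avD_iso KCp) ?(lt_le_trans qs) // qv maxxx.
  by apply/le_anti; rewrite ts andbT (avB_le KCp) ?(T_unit sT) ?t1.
Qed.

Lemma horner_le_gauss Q qs t : Q = lead_coef Q *: \prod_(q <- qs) ('X - q%:P) ->
  v t <= 1 -> v Q.[t] <= v (lead_coef Q) * gauss_prod v qs.
Proof.
move=> defQ t1; rewrite {1}defQ (horner_factor KCp) ler_wpM2l //.
by apply: ler_prod => q _; rewrite (av_ge0 KCp) (av_sub_le_max KCp).
Qed.

(** Since Q has no root in the shell, every unit off [T] is generic for Q, and |Q| takes its largest
    possible value there. *)
Lemma horner_eq_gauss mu Q qs t :
  Q = lead_coef Q *: \prod_(q <- qs) ('X - q%:P) ->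
  mu <= 1 -> (forall s, shell mu s -> Q.[s] != 0) -> v t = 1 -> off t ->
  v Q.[t] = v (lead_coef Q) * gauss_prod v qs.
Proof.
move=> defQ mu1 HQ t1 tT; rewrite {1}defQ (horner_factor KCp); congr (_ * _).
rewrite /gauss_prod !big_seq; apply: eq_bigr => q qin.
apply: (root_dist_unit mu1) => // Hq; have := HQ q Hq.
rewrite defQ hornerZ mulf_eq0 negb_or => /andP[_].
by rewrite -[X in X != 0]/(_.[q]) -rootE root_prod_XsubC qin.
Qed.

Lemma shell_of_open mu t : mu <= v t -> v t < 1 -> shell mu t.
Proof. by move=> mt t1; split=> //; [exact: ltW | exact: off_open]. Qed.

Lemma shell_of_unit mu t : mu <= 1 -> v t = 1 -> off t -> shell mu t.
Proof. by move=> mu1 t1 tT; split; rewrite ?t1. Qed.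

Lemma gauss_le_of_annulus (P : {poly K}) (lam e : R) : 0 <= e -> lam < 1 ->
  (forall t, lam < v t -> v t < 1 -> v P.[t] <= e) -> forall k, v P`_k <= e.
Proof.
move=> e0 lam1 HP k.
apply: (near1_le p_prime KCp (l := Num.max 0 lam) (k := k)) => //.
  by rewrite gt_max ltr01.
move=> c; rewrite gt_max => /andP[/andP[c0 lc] c1].
apply: (cauchy_poly KCp) => [|t tc]; first by rewrite -(av_gt0 KCp).
by apply: HP; rewrite tc.
Qed.

(** If f is within e of P / Q, then |P| <= e |Q| on the annulus, so the Gauss norm of P is at most e
    times that of Q. At a unit off [T] the latter is |Q (t)|, whence |P / Q| <= e. *)
Lemma coef_fun_annulus_eq0 f lam : coef_fun f -> lam < 1 ->
  (forall t, lam < v t -> v t < 1 -> f t = 0) ->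
  forall t, v t = 1 -> off t -> f t = 0.
Proof.
move=> [l [l0 l1 Hf]] lam1 f0 t t1 tT.
apply/eqP; rewrite -(av_eq0 KCp) eq_le (av_ge0 KCp) andbT.
apply: le_of_forall_gt => e e0; rewrite add0r.
pose mu := (l + 1) / 2; have [lmu mu1] : l < mu /\ mu < 1 by rewrite /mu; lra.
have [P [Q [HQ HP]]] := Hf mu lmu mu1 e e0.
have Ht : shell mu t by apply: shell_of_unit => //; apply: ltW.
have [qs defQ] := poly_factor Q.
set C := v (lead_coef Q) * gauss_prod v qs.
have Qt : v Q.[t] = C by apply: horner_eq_gauss defQ (ltW mu1) HQ t1 tT.
have C0 : 0 < C by rewrite -Qt (av_gt0 KCp) HQ.
have Pk : forall k, v P`_k <= e * C.
  apply: (gauss_le_of_annulus (lam := Num.max mu lam)).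
  - by rewrite mulr_ge0 // ltW.
  - by rewrite gt_max mu1.
  - move=> s; rewrite gt_max => /andP[ms ls] s1.
    have Hs : shell mu s by apply: shell_of_open => //; apply: ltW.
    have := HP s Hs; rewrite f0 // sub0r (avN KCp) (avF KCp).
    rewrite ler_pdivrMr ?(av_gt0 KCp) ?HQ // => /le_trans; apply.
    by apply: ler_wpM2l; [exact: ltW|exact: horner_le_gauss defQ (ltW s1)].
have Rt : v (P.[t] / Q.[t]) <= e.
  rewrite (avF KCp) Qt ler_pdivrMr //.
  apply: (horner_le KCp (r := 1)) => [||k]; rewrite ?t1 ?expr1n ?mulr1 //.
  by rewrite mulr_ge0 // ltW.
rewrite -[f t](subrK (P.[t] / Q.[t])); apply: (avD_le KCp) => //.
exact: HP.
Qed.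

(* Hadamard's three circles: [f] is small near [|t| = 1] and bounded on
   [|t| = r ^ 2], hence small on [|t| = r]. *)
Lemma coef_fun_disc_eq0 f x : coef_fun f -> v x = 1 -> off x ->
  (forall t, v (t - x) < 1 -> f t = 0) ->
  exists2 lam, lam < 1 & forall t, lam < v t -> v t < 1 -> f t = 0.
Proof.
move=> [l [l0 l1 Hf]] x1 xT f0.
pose mu := (l + 1) / 2; have [lmu mu1] : l < mu /\ mu < 1 by rewrite /mu; lra.
have mu0 : 0 < mu by apply: lt_trans lmu.
(* For |t| > [lam] one has |t|^2 > [mu], so the innermost of the three circles lies in the shell. *)
have [lam /andP[lam0 lam1] mulam] := exp_near1 2 mu1.
exists lam => // t lt t1.
have vt0 : 0 < v t by apply: lt_trans lt.
have mut2 : mu < v t ^+ 2.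
  by apply: lt_trans mulam _; rewrite ltr_pXn2r ?nnegrE // ltW.
have mut : mu <= v t.
  by apply: le_trans (ltW mut2) _; rewrite expr2 ger_pMr // ltW.
have t21 : v t ^+ 2 < 1 by rewrite exprn_ilt1.
have umu := Hf mu lmu mu1.
have [M M0 HM] := unif_rational_bounded mu0 (ltW mu1) umu.
apply/eqP; rewrite -(av_eq0 KCp) eq_le (av_ge0 KCp) andbT.
apply: le_of_forall_gt => e' e'0; rewrite add0r.
pose E := Num.min e' M.
have E0 : 0 < E by rewrite lt_min e'0.
have EM : E <= M by rewrite ge_min lexx orbT.
apply: (@le_trans _ _ E); last by rewrite ge_min lexx.
(* [E] is the geometric mean of [e] and [M], the bounds used on the unit circle and on the circle of
   radius |t|^2. *)
pose e := E ^+ 2 / M.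
have e0 : 0 < e by rewrite divr_gt0 ?exprn_gt0.
have eE : e <= E by rewrite ler_pdivrMr // expr2 ler_wpM2l // ltW.
have [P [Q [HQ HP]]] := umu e e0.
have [qs defQ] := poly_factor Q.
set C := v (lead_coef Q) * gauss_prod v qs.
have Qx : v Q.[x] = C by apply: horner_eq_gauss defQ (ltW mu1) HQ x1 xT.
have Hx : shell mu x by apply: shell_of_unit => //; apply: ltW.
have C0 : 0 < C by rewrite -Qx (av_gt0 KCp) HQ.
have eC0 : 0 <= e * C by rewrite mulr_ge0 // ltW.
(* The vanishing of f on the disc of x bounds the Gauss norm of P (X + x), and translating back by
   the integral x does not increase it. *)
have Ppos k : v P`_k <= e * C.
  pose Px := P \Po ('X + x%:P).
  have hPx h : Px.[h] = P.[h + x] by rewrite horner_comp !hornerE.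
  have HPx : forall k, v Px`_k <= e * C.
    apply: (gauss_le_of_annulus (lam := 0)) => // h _ h1; rewrite hPx.
    have xh : v (h + x) = 1 by rewrite addrC (avD_iso KCp) x1.
    have Hs : shell mu (h + x).
      apply: shell_of_unit (ltW mu1) xh _.
      by apply: off_near xT _; rewrite addrK.
    have := HP _ Hs; rewrite f0 ?addrK // sub0r (avN KCp) (avF KCp).
    rewrite ler_pdivrMr ?(av_gt0 KCp) ?HQ // => /le_trans; apply.
    apply: ler_wpM2l; first exact: ltW.
    by apply: horner_le_gauss defQ _; rewrite xh.
  apply: (gauss_le_of_annulus (lam := 0)) => // s _ s1.
  rewrite -(subrK x s) -hPx.
  apply: (horner_le KCp (r := 1)) => // [|j]; last by rewrite expr1n mulr1.
  by apply: (avB_le KCp); rewrite ?x1 // ltW.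
(* On the circle |s| = r, a root with |q| < [mu] contributes r to |Q|, any other root max (1, |q|):
   no root satisfies [mu] <= |q| < 1. This is why three circles hold for Q with equality, in the
   form G (r^2) G (1) = G (r)^2. *)
pose g (r : R) q := if v q < mu then r else Num.max 1 (v q).
pose G r := \prod_(q <- qs) g r q.
have Qt : v Q.[t] = v (lead_coef Q) * G (v t).
  rewrite {1}defQ (horner_factor KCp); congr (_ * _).
  rewrite /G !big_seq; apply: eq_bigr => q qin; rewrite /g.
  have nq : ~ shell mu q.
    move=> Hq; have := HQ q Hq.
    rewrite defQ hornerZ mulf_eq0 negb_or => /andP[_].
    by rewrite -[X in X != 0]/(_.[q]) -rootE root_prod_XsubC qin.
  case: ifP => qmu; first by rewrite (avB_iso KCp) // (lt_le_trans qmu).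
  have [|q1|[s sT qs1]] := not_shell nq; first by rewrite qmu.
    rewrite (avBC KCp) (avB_iso KCp) ?(lt_trans t1) //.
    by apply/esym/max_idPr/ltW.
  have qv : v q = 1.
    by rewrite -(subrK s q) addrC (avD_iso KCp) (T_unit sT).
  by rewrite qv maxxx (avBC KCp) (avB_iso KCp) qv.
have Qu s : v s = v t ^+ 2 -> v Q.[s] <= v (lead_coef Q) * G (v t ^+ 2).
  move=> st; rewrite {1}defQ (horner_factor KCp) ler_wpM2l //.
  apply: ler_prod => q _; rewrite (av_ge0 KCp) /= /g.
  case: ifP => qmu; first by rewrite (avB_iso KCp) st // (lt_trans qmu).
  by apply: (av_sub_le_max KCp); rewrite st ltW.
have GG : G (v t ^+ 2) * gauss_prod v qs = G (v t) ^+ 2.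
  rewrite /G /gauss_prod -big_split -prodrXl /=; apply: eq_bigr => q _.
  rewrite /g; case: ifP => qmu; last by rewrite expr2.
  rewrite (_ : Num.max 1 (v q) = 1) ?mulr1 //.
  by apply/max_idPl/ltW/(lt_trans qmu).
have Pt k : v P`_k * v t ^+ k <= E * v Q.[t].
  have H1 : v P`_k * v (t ^+ 2) ^+ k <= M * (v (lead_coef Q) * G (v t ^+ 2)).
    apply: (cauchy_poly KCp) => [|s st].
      by rewrite expf_neq0 // -(av_gt0 KCp).
    rewrite (avX KCp) in st.
    have Hs : shell mu s by apply: shell_of_open; rewrite st // ltW.
    have Rs : v (P.[s] / Q.[s]) <= M.
      rewrite -[_ / _](subKr (f s)); apply: (avB_le KCp); first exact: HM.
      by apply: le_trans (HP s Hs) _; apply: le_trans EM.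
    move: Rs; rewrite (avF KCp) ler_pdivrMr ?(av_gt0 KCp) ?HQ // => /le_trans.
    by apply; apply: ler_wpM2l; [exact: ltW | exact: Qu].
  have EQ0 : 0 <= E * v Q.[t] by rewrite mulr_ge0 // ltW.
  rewrite -(@ler_pXn2r _ 2) ?nnegrE ?EQ0 ?mulr_ge0 ?exprn_ge0 //.
  have -> : (v P`_k * v t ^+ k) ^+ 2 = v P`_k * (v P`_k * v (t ^+ 2) ^+ k).
    by rewrite (avX KCp) exprMn -!exprM mulnC expr2 mulrA.
  have -> : (E * v Q.[t]) ^+ 2 = e * C * (M * (v (lead_coef Q) * G (v t ^+ 2))).
    rewrite Qt !exprMn -GG /e /C; field.
    by rewrite gt_eqF.
  by apply: ler_pM; rewrite ?mulr_ge0 ?exprn_ge0.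
have Ht : shell mu t by apply: shell_of_open.
have Rt : v (P.[t] / Q.[t]) <= E.
  rewrite (avF KCp) ler_pdivrMr ?(av_gt0 KCp) ?HQ //.
  by apply: (horner_le KCp _ (lexx _) Pt); rewrite mulr_ge0 // ltW.
rewrite -[f t](subrK (P.[t] / Q.[t])); apply: (avD_le KCp) => //.
by apply: le_trans (HP t Ht) eE.
Qed.

End CoefficientRing.

(** * The residue field is algebraic over F_p *)

Section ResidueField.
Context (R : realType) (K : closedFieldType) (v : K -> R).
Context (p : nat) (p_prime : prime p) (KCp : is_Cp v p).
#[local] Hint Extern 0 (is_true (0 <= v _)) => exact: (av_ge0 KCp) : core.

Lemma frobenius_add a b : v a <= 1 -> v b <= 1 ->
  v ((a + b) ^+ p - (a ^+ p + b ^+ p)) < 1.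
Proof.
move=> a1 b1; have p0 := prime_gt0 p_prime.
rewrite exprDn -(big_mkord xpredT (fun i => a ^+ (p - i) * b ^+ i *+ 'C(p, i))).
rewrite big_ltn // big_nat_recr //= subn0 subnn !expr0 bin0 binn !mulr1n mulr1 mul1r.
set S := \sum_(_ <= i < _) _.
have -> : a ^+ p + (S + b ^+ p) - (a ^+ p + b ^+ p) = S by ring.
rewrite /S big_nat; apply: (av_sum_lt KCp) => // i ip.
rewrite -mulr_natl !(avM KCp) !(avX KCp).
have /dvdnP[w ->] := prime_dvd_bin p_prime ip.
rewrite natrM (avM KCp).
have p1 := av_p_lt1 p_prime KCp.
apply: (@le_lt_trans _ _ (v p%:R)) => //.
rewrite -mulrA -[X in _ <= X]mul1r; apply: ler_pM; rewrite ?mulr_ge0 ?exprn_ge0 //.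
  exact: (av_nat_le1 KCp).
rewrite ger_pMr ?(av_gt0 KCp) ?(natK_neq0 p_prime KCp) //.
by rewrite mulr_ile1 ?exprn_ge0 ?exprn_ile1.
Qed.

Lemma av_lt1_X x k : (0 < k)%N -> (v (x ^+ k) < 1) = (v x < 1).
Proof. by move=> k0; rewrite (avX KCp) expr_lt1. Qed.

(** Since (a - b)^p is congruent to a^p - b^p, Frobenius is injective on the residue field. *)
Lemma frobenius1_congr a b : v a <= 1 -> v b <= 1 ->
  (v (a ^+ p - b ^+ p) < 1) = (v (a - b) < 1).
Proof.
move=> a1 b1; have ab1 : v (a - b) <= 1 by apply: (avB_le KCp).
have := frobenius_add ab1 b1; rewrite subrK => H.
rewrite -(av_lt1_X (a - b) (prime_gt0 p_prime)).
apply/idP/idP => H'.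
  rewrite (_ : (a - b) ^+ p = (a ^+ p - b ^+ p) - (a ^+ p - ((a - b) ^+ p + b ^+ p))).
    exact: (avB_lt KCp).
  by ring.
rewrite (_ : a ^+ p - b ^+ p = (a ^+ p - ((a - b) ^+ p + b ^+ p)) + (a - b) ^+ p).
  exact: (avD_lt KCp).
by ring.
Qed.

Lemma frobenius_congr m a b : v a <= 1 -> v b <= 1 ->
  (v (a ^+ (p ^ m) - b ^+ (p ^ m)) < 1) = (v (a - b) < 1).
Proof.
elim: m a b => [|m IH] a b a1 b1; first by rewrite expn0 !expr1.
rewrite expnS !exprM IH ?frobenius1_congr // (avX KCp) exprn_ile1 //.
Qed.

Lemma av_natmod a b : (a = b %[mod p])%N -> v (a%:R - b%:R) < 1.
Proof.
move=> E; rewrite (divn_eq a p) (divn_eq b p) E !natrD opprD addrACA subrr addr0.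
rewrite !natrM -mulrBl (avM KCp).
apply: le_lt_trans (av_p_lt1 p_prime KCp).
by apply: ler_piMl => //; apply: (avB_le KCp); apply: (av_nat_le1 KCp).
Qed.

Lemma av_int_abs (z : int) : v z%:~R = v `|z|%N%:R.
Proof. by case: z => n //=; rewrite NegzE mulrNz (avN KCp). Qed.

Lemma av_intmod (z : int) : exists c : nat, v (z%:~R - c%:R) < 1.
Proof.
have p0 := prime_gt0 p_prime.
exists (`|(z %% p)%Z|%N).
rewrite -[X in _ - X]/(`|(z %% p)%Z|%N%:Z%:~R) gez0_abs ?modz_ge0 ?eqz_nat -?lt0n //.
rewrite {1}(divz_eq z p) intrD addrK intrM (avM KCp).
apply: le_lt_trans (av_p_lt1 p_prime KCp).
by apply: ler_piMl => //; rewrite av_int_abs; apply: (av_nat_le1 KCp).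
Qed.

Lemma av_ratmod (b : rat) : v (ratr b) <= 1 -> exists c : nat, v (ratr b - c%:R) < 1.
Proof.
move=> b1; have p0 := prime_gt0 p_prime.
have [d Hd] : exists d : nat, denq b = d by exists `|denq b|%N; rewrite absz_denq.
have d0 : (0 < d)%N by rewrite -ltz_nat -Hd denq_gt0.
have defb : ratr b = (numq b)%:~R / d%:R :> K by rewrite /ratr Hd.
have dK : (d%:R : K) != 0 by rewrite (natK_neq0 p_prime KCp).
(* If p divided the denominator, the numerator would be a unit and the absolute value of the
   fraction would exceed 1. *)
have cpd : coprime p d.
  rewrite prime_coprime //; apply/negP => pd.
  have pn : coprime p `|numq b|.
    have := coprime_num_den b; rewrite Hd absz_nat coprime_sym.
    exact: coprime_dvdl.
  move: b1; rewrite defb (avF KCp) av_int_abs (av_nat_coprime p_prime KCp) //.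
  apply/negP; rewrite -ltNge mul1r invf_gt1 ?(av_gt0 KCp) //.
  have /dvdnP[w ->] := pd; rewrite natrM (avM KCp).
  apply: le_lt_trans (av_p_lt1 p_prime KCp).
  by apply: ler_piMl => //; apply: (av_nat_le1 KCp).
have vd : v d%:R = 1 by apply: (av_nat_coprime p_prime KCp).
(* By Euler's theorem, u inverts the denominator modulo p. *)
pose u := (d ^ (totient p).-1)%N.
have ud : v ((d * u)%N%:R - 1%:R) < 1.
  apply: av_natmod; rewrite -expnS prednK ?totient_gt0 //.
  by apply: cyclic.Euler_exp_totient; rewrite coprime_sym.
have [c Hc] := av_intmod (numq b * u); exists c.
apply: (av_lt_trans KCp (y := (numq b * u)%:~R)) => //.
have -> : ratr b - (numq b * u)%:~R = - (numq b)%:~R * ((d * u)%N%:R - 1) / d%:R :> K.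
  rewrite defb intrM natrM -[u%:~R]/(u%:R); by field.
rewrite (avF KCp) vd divr1 (avM KCp) (avN KCp); apply: le_lt_trans ud.
by apply: ler_piMl => //; rewrite av_int_abs; apply: (av_nat_le1 KCp).
Qed.

Lemma intK_neq0 (z : int) : z != 0 -> (z%:~R : K) != 0.
Proof.
move=> z0; rewrite -(av_gt0 KCp) av_int_abs (av_gt0 KCp).
by rewrite (natK_neq0 p_prime KCp) // absz_gt0.
Qed.

(** The compatibility of [ratr] with fractions rests on nonzero integers being nonzero in K, which
    is known here through the absolute value. *)
Lemma ratr_frac (a b : int) : b != 0 ->
  ratr (a%:~R / b%:~R) = a%:~R / b%:~R :> K.
Proof.
move=> b0; have bQ : (b%:~R : rat) != 0 by rewrite intr_eq0.
have bK := intK_neq0 b0.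
set r := a%:~R / b%:~R.
have E : numq r * b = a * denq r.
  apply/eqP; rewrite -(eqr_int rat) !intrM; apply/eqP.
  rewrite -[a%:~R](divfK bQ) -/r -{2}(divq_num_den r).
  by rewrite mulrAC divfK // intr_eq0 denq_neq0.
have dK := intK_neq0 (denq_neq0 r).
by rewrite /ratr; apply/eqP; rewrite eqr_div // -!intrM E.
Qed.

Lemma ratr_oppr_div (x y : rat) : (ratr y : K) != 0 ->
  ratr (- x / y) = - ratr x / ratr y :> K.
Proof.
move=> y0.
have ny : numq y != 0.
  by apply: contraNneq y0 => y0; rewrite /ratr y0 mul0r.
have -> : - x / y = (- (numq x * denq y))%:~R / (denq x * numq y)%:~R.
  rewrite -{1}(divq_num_den x) -{1}(divq_num_den y) mulrNz !intrM.
  by field; rewrite !intr_eq0 !denq_neq0 ny.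
rewrite ratr_frac ?mulf_neq0 ?denq_neq0 // /ratr mulrNz !intrM.
by field; rewrite !intK_neq0 ?denq_neq0 ?ny.
Qed.

(* Truncating a minimal equation at its last coefficient of maximal absolute
   value makes it monic modulo the maximal ideal. *)
Lemma residue_integral x : v x <= 1 -> exists (y : K) (d : nat) (c : nat -> nat),
  [/\ v (x - y) < 1, (0 < d)%N & v (y ^+ d - \sum_(i < d) (c i)%:R * y ^+ i) < 1].
Proof.
move=> x1; have [y [P [P0 Pq Py xy]]] := Cp_dense KCp x ltr01.
exists y.
have y1 : v y <= 1.
  by rewrite -(subKr x y); apply: (avB_le KCp) => //; apply: ltW.
pose n := size P; have n0 : (0 < n)%N by rewrite size_poly_gt0.
have [i0 Hi0] : exists i0 : 'I_n, forall i : 'I_n, v P`_i <= v P`_i0.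
  by case: (@arg_maxP _ _ _ (Ordinal n0) xpredT (fun i => v P`_i) isT) => i0 _ H;
    exists i0 => i; apply: H.
pose M := v P`_i0.
have leM i : v P`_i <= M.
  have [Pi|iP] := leqP n i; last exact: (Hi0 (Ordinal iP)).
  by rewrite nth_default // (av0 KCp) (av_ge0 KCp).
have M0 : 0 < M.
  by apply: lt_le_trans (leM n.-1); rewrite (av_gt0 KCp) -[P`_n.-1]/(lead_coef P) lead_coef_eq0.
(* Rational approximations with error below [M], the largest absolute value of a coefficient: the
   equation at y persists up to an error below [M]. *)
have [q Hq] : {q : nat -> rat & forall i, v (P`_i - ratr (q i)) < M}.
  apply: (@boolp.choice _ _ (fun i r => v (P`_i - ratr r) < M)) => i.
  exact: Pq M0.
have qM i : v (ratr (q i)) <= M.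
  rewrite -(subKr P`_i (ratr (q i))); apply: (avB_le KCp (leM i)).
  exact/ltW/Hq.
have sumq : v (\sum_(i < n) ratr (q i) * y ^+ i) < M.
  have -> : \sum_(i < n) ratr (q i) * y ^+ i =
      \sum_(i < n) (- (P`_i - ratr (q i)) * y ^+ i).
    have E0 : P.[y] = 0 by apply/eqP.
    rewrite -[LHS](subrK P.[y]) {2}E0 addr0 horner_coef -sumrB.
    by apply: eq_bigr => i _; ring.
  apply: (av_sum_lt KCp) => // i _; rewrite (avM KCp) (avN KCp) (avX KCp).
  by apply: le_lt_trans (Hq i); rewrite ler_piMr // exprn_ile1.
have qi0 : M <= v (ratr (q i0)).
  rewrite -(subKr P`_i0 (ratr (q i0))) (avB_iso KCp) //; exact: Hq.
have exd : exists i, (i < n)%N && (M <= v (ratr (q i))).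
  by exists i0; rewrite ltn_ord.
have ubd i : (i < n)%N && (M <= v (ratr (q i))) -> (i <= n)%N.
  by move=> /andP[/ltnW].
case: (ex_maxnP exd ubd) => d /andP[dn Md] dmax.
have vqd : v (ratr (q d)) = M by apply/le_anti; rewrite Md qM.
have qd0 : (ratr (q d) : K) != 0 by rewrite -(av_gt0 KCp) vqd.
(* After division by q_d the coefficients are p-integral rationals, hence congruent to natural
   numbers. *)
have Hb i : exists c : nat, v (ratr (- q i / q d) - c%:R) < 1.
  apply: av_ratmod; rewrite ratr_oppr_div // (avF KCp) (avN KCp) vqd.
  by rewrite ler_pdivrMr // mul1r.
have [c Hc] := boolp.choice Hb.
have main : v (y ^+ d - \sum_(i < d) (c i)%:R * y ^+ i) < 1.
  rewrite (_ : y ^+ d - _ = (ratr (q d))^-1 * \sum_(i < n) ratr (q i) * y ^+ i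
    - \sum_(d.+1 <= i < n) (ratr (q i) / ratr (q d)) * y ^+ i
    + \sum_(i < d) (ratr (- q i / q d) - (c i)%:R) * y ^+ i).
    apply: (avD_lt KCp).
      apply: (avB_lt KCp).
        by rewrite (avM KCp) (avV KCp) vqd mulrC ltr_pdivrMr // mul1r.
      rewrite big_nat; apply: (av_sum_lt KCp) => // i /andP[di i_n].
      rewrite (avM KCp) (avX KCp) (avF KCp) vqd.
      apply: (@le_lt_trans _ _ (v (ratr (q i)) / M)).
        by rewrite ler_piMr ?exprn_ile1 // divr_ge0 // ltW.
      rewrite ltr_pdivrMr // mul1r ltNge; apply/negP => H.
      by have := dmax i; rewrite i_n H leqNgt di => /(_ isT).
    apply: (av_sum_lt KCp) => // i _; rewrite (avM KCp) (avX KCp).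
    by apply: le_lt_trans (Hc i); rewrite ler_piMr // exprn_ile1.
  rewrite -(big_mkord xpredT (fun i => ratr (q i) * y ^+ i)).
  rewrite (@big_cat_nat _ _ _ d.+1) //= big_nat_recr //= big_mkord.
  rewrite !mulrDr mulrA mulVf // mul1r.
  have -> : (ratr (q d))^-1 * (\sum_(d.+1 <= i < n) ratr (q i) * y ^+ i) =
     \sum_(d.+1 <= i < n) (ratr (q i) / ratr (q d)) * y ^+ i.
    rewrite mulr_sumr; apply: eq_bigr => i _; by ring.
  rewrite addrK addrAC mulr_sumr -big_split /= addrC -sumrN; congr (_ + _).
  by apply: eq_bigr => i _; rewrite ratr_oppr_div //; ring.
exists d, c; split=> //.
rewrite lt0n; apply/eqP => d0; move: main; rewrite d0 big_ord0 subr0 expr0.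
by rewrite (av1 KCp) ltxx.
Qed.

(** Modulo the maximal ideal the powers of y are combinations of 1, y, ..., y^(d - 1) with
    coefficients in F_p, so two of them agree. If y is a unit, this gives y^k congruent to 1 with k
    prime to p, and p^N is congruent to 1 modulo k for N = [totient k]. *)
Lemma residue_periodic x : v x <= 1 ->
  exists2 N, (0 < N)%N & v (x ^+ (p ^ N) - x) < 1.
Proof.
move=> x1; have [y [d [b [xy d0 yd]]]] := residue_integral x1.
have y1 : v y <= 1.
  by rewrite -(subKr x y); apply: (avB_le KCp) => //; apply: ltW.
have reps n : exists c : nat -> nat, v (y ^+ n - \sum_(i < d) (c i)%:R * y ^+ i) < 1.
  elim: n => [|n [c Hc]].
    exists (fun i => (i == 0)%N); rewrite -(prednK d0) big_ord_recl big1 => [|i _].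
      by rewrite /= !expr0 mulr1 addr0 subrr (av0 KCp).
    by rewrite /= mul0r.
  (* Multiplication by y shifts the coefficients, and the overflow in y^d is rewritten by the
     equation of y. *)
  exists (fun i => (if i is j.+1 then c j else 0) + c d.-1 * b i)%N.
  rewrite (_ : _ - _ = y * (y ^+ n - \sum_(i < d) (c i)%:R * y ^+ i) +
    (c d.-1)%:R * (y ^+ d - \sum_(i < d) (b i)%:R * y ^+ i)).
    apply: (avD_lt KCp); rewrite (avM KCp).
      by apply: le_lt_trans Hc; rewrite ler_piMl.
    by apply: le_lt_trans yd; rewrite ler_piMl // (av_nat_le1 KCp).
  have -> : \sum_(i < d) ((if i : nat is j.+1 then c j else 0) + c d.-1 * b i)%:R * y ^+ i =
    \sum_(i < d) (if i : nat is j.+1 then c j else 0)%:R * y ^+ i +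
    (c d.-1)%:R * \sum_(i < d) (b i)%:R * y ^+ i.
    rewrite mulr_sumr -big_split; apply: eq_bigr => i _ /=.
    by rewrite natrD natrM mulrDl mulrA.
  case: d d0 {yd Hc} => // d _ /=.
  have -> : \sum_(i < d.+1) (if i : nat is j.+1 then c j else 0)%:R * y ^+ i =
      \sum_(i < d) (c i)%:R * y ^+ i.+1.
    by rewrite big_ord_recl /= mul0r add0r.
  have E : y * (\sum_(i < d.+1) (c i)%:R * y ^+ i) =
      \sum_(i < d) (c i)%:R * y ^+ i.+1 + (c d)%:R * y ^+ d.+1.
    rewrite big_ord_recr /= mulrDr mulr_sumr; congr (_ + _).
      by apply: eq_bigr => i _; rewrite exprS; ring.
    by rewrite exprS; ring.
  by rewrite mulrBr E -exprS; ring.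
have [c Hc] := boolp.choice reps.
pose F n : {ffun 'I_d -> 'I_p} :=
  [ffun i : 'I_d => Ordinal (ltn_pmod (c n i) (prime_gt0 p_prime))].
have HF m n : F m = F n -> v (y ^+ m - y ^+ n) < 1.
  move=> E; apply: (av_lt_trans KCp (Hc m)); rewrite (avBC KCp).
  apply: (av_lt_trans KCp (Hc n)); rewrite -sumrB.
  apply: (av_sum_lt KCp) => // i _; rewrite -mulrBl (avM KCp) (avX KCp).
  have H : v ((c n i)%:R - (c m i)%:R) < 1.
    by apply: av_natmod; have /ffunP /(_ i) := E; rewrite !ffunE => -[->].
  by apply: le_lt_trans H; rewrite ler_piMr // exprn_ile1.
have [m [n [mn E]]] : exists m n, (m < n)%N /\ F m = F n.
  pose N := #|{ffun 'I_d -> 'I_p}|.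
  have : ~~ injectiveb (fun i : 'I_N.+1 => F i).
    apply/negP => /injectiveP /leq_card; rewrite card_ord.
    by rewrite -/N ltnn.
  move=> /injectivePn[i [j ij E]].
  have [lt_ij|lt_ji|/val_inj eq_ij] := ltngtP i j.
  - by exists i, j.
  - by exists j, i.
  - by rewrite eq_ij eqxx in ij.
have [y_lt1|y_ge1] := ltP (v y) 1.
  have x_lt1 : v x < 1 by rewrite -(subrK y x) (avD_lt KCp).
  exists 1%N => //; rewrite expn1; apply: (avB_lt KCp) => //.
  by rewrite av_lt1_X // prime_gt0.
have vy : v y = 1 by apply/le_anti; rewrite y1.
have yk : v (y ^+ (n - m) - 1 ^+ (n - m)) < 1.
  have := HF m n E; rewrite -{1}(subnKC (ltnW mn)) exprD -{1}[y ^+ m]mulr1 -mulrBr.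
  by rewrite (avM KCp) (avX KCp) vy expr1n mul1r (avBC KCp) expr1n.
have k0 : (0 < n - m)%N by rewrite subn_gt0.
(* The p-part of the exponent can be removed because Frobenius is injective on residues. *)
have [k cpk Hk] := pfactor_coprime p_prime k0.
have {}yk : v (y ^+ k - 1) < 1.
  move: yk; rewrite Hk !exprM frobenius_congr ?expr1n ?(av1 KCp) //.
  by rewrite (avX KCp) vy expr1n.
have k_gt0 : (0 < k)%N by rewrite lt0n; apply: contraTneq k0 => k0; rewrite Hk k0 mul0n.
exists (totient k); first by rewrite totient_gt0.
have /eqP := cyclic.Euler_exp_totient cpk.
rewrite eqn_mod_dvd ?expn_gt0 ?prime_gt0 // => /dvdnP[w Hw].
have {}Hw : (p ^ totient k = (k * w).+1)%N.
  by rewrite mulnC -Hw subn1 prednK // expn_gt0 prime_gt0.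
have yN : v (y ^+ (p ^ totient k) - y) < 1.
  have -> : y ^+ (p ^ totient k) - y = y * ((y ^+ k) ^+ w - 1).
    by rewrite Hw exprS exprM mulrBr mulr1.
  rewrite (avM KCp) vy mul1r.
  elim: w {Hw} => [|w IH]; first by rewrite expr0 subrr (av0 KCp).
  apply: (av_lt_trans KCp (y := (y ^+ k) ^+ w)) => //.
  have -> : (y ^+ k) ^+ w.+1 - (y ^+ k) ^+ w = (y ^+ k - 1) * (y ^+ k) ^+ w.
    by rewrite exprS mulrBl mul1r.
  by rewrite (avM KCp) !(avX KCp) vy !expr1n mulr1.
apply: (av_lt_trans KCp (y := y ^+ (p ^ totient k))).
  by rewrite frobenius_congr.
by apply: (av_lt_trans KCp yN); rewrite (avBC KCp).
Qed.

End ResidueField.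

(** * The identity principle *)

Section GoodModules.
Context (R : realType) (K : closedFieldType) (v : K -> R).
Context (p : nat) (p_prime : prime p) (KCp : is_Cp v p).
#[local] Hint Extern 0 (is_true (0 <= v _)) => exact: (av_ge0 KCp) : core.
Context (T : seq K) (T_unit : forall s, s \in T -> v s = 1).
Context (m : nat) (T_frob : forall s, s \in T -> v (s ^+ (p ^ m) - s) < 1).

Local Notation q := (p ^ m)%N.
Local Notation off := (off v T).
Local Notation shell := (shell v T).
Local Notation shell_gt := (shell_gt v T).
Local Notation coef_fun := (coef_fun v T).

Lemma q_gt0 : (0 < q)%N. Proof. by rewrite expn_gt0 prime_gt0. Qed.

Lemma off_frob t : v t <= 1 -> off t -> off (t ^+ q).
Proof.
move=> t1 tT s sT; rewrite leNgt; apply/negP => H.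
have := tT s sT; apply/negP; rewrite -ltNge.
rewrite -(frobenius_congr p_prime KCp m) ?(T_unit sT) //.
by apply: (av_lt_trans KCp (y := s)) => //; rewrite (avBC KCp) T_frob.
Qed.

Lemma shell_frob mu t : 0 <= mu -> shell mu t -> shell (mu ^+ q) (t ^+ q).
Proof.
move=> mu0 [mt t1 tT]; split; last exact: off_frob.
  by rewrite (avX KCp) lerXn2r ?nnegrE.
by rewrite (avX KCp) exprn_ile1.
Qed.

Lemma shell_gt_frob lam : lam < 1 -> exists2 lam', 0 < lam' < 1 &
  forall t, shell_gt lam' t -> shell_gt lam (t ^+ q).
Proof.
move=> lam1; have [l' /andP[l'0 l'1] H] := exp_near1 q lam1.
exists l'; rewrite ?l'0 // => t [lt t1 tT]; split; last exact: off_frob.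
  by apply: lt_trans H _; rewrite (avX KCp) ltr_pXn2r ?nnegrE ?q_gt0 // ltW.
by rewrite (avX KCp) exprn_ile1.
Qed.

Lemma unif_rational_frob mu f : 0 <= mu -> unif_rational v T (mu ^+ q) f ->
  unif_rational v T mu (fun t => f (t ^+ q)).
Proof.
move=> mu0 Hf e e0; have [P [Q [HQ HP]]] := Hf e e0.
exists (P \Po 'X^q), (Q \Po 'X^q).
by split=> t Ht; rewrite !horner_comp hornerXn; [apply: HQ|apply: HP]; apply: shell_frob.
Qed.

Lemma coef_fun_frob f : coef_fun f -> coef_fun (fun t => f (t ^+ q)).
Proof.
move=> [l [l0 l1 Hf]]; have [l' /andP[l'0 l'1] H] := exp_near1 q l1.
exists l'; split=> // mu l'mu mu1; have mu0 : 0 < mu by apply: lt_trans l'mu.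
apply: unif_rational_frob; first exact: ltW.
apply: Hf; last by rewrite exprn_ilt1 // ?gtn_eqF ?q_gt0 // ltW.
by apply: lt_trans H _; rewrite ltr_pXn2r ?nnegrE ?q_gt0 // ltW.
Qed.

(* Modules of functions for which the identity principle holds: a member
   vanishing on an annulus [lam < |t| < 1] vanishes on the units off [T]. *)
Record good_module (W : (K -> K) -> Prop) : Prop := GoodModule {
  good_coef : forall a, coef_fun a -> W a;
  good_add : forall f g, W f -> W g -> W (fun t => f t + g t);
  good_mul : forall a f, coef_fun a -> W f -> W (fun t => a t * f t);
  good_germ : forall f g lam, lam < 1 ->
    (forall t, shell_gt lam t -> f t = g t) -> W f -> W g;
  good_frob : forall f, W f -> W (fun t => f (t ^+ q));
  good_deriv : forall f, W f -> exists f' lam,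
    [/\ W f', lam < 1 & forall t, shell_gt lam t -> is_deriv v f t (f' t)];
  good_apx : forall f x, W f -> v x = 1 -> off x -> apx v (fun h => f (x + h));
  good_identity : forall f lam, W f -> lam < 1 ->
    (forall t, lam < v t -> v t < 1 -> f t = 0) ->
    forall t, v t = 1 -> off t -> f t = 0
}.

Lemma coef_fun_good : good_module coef_fun.
Proof.
split=> //.
- exact: (coef_fun_add KCp).
- exact: (coef_fun_mul KCp).
- by move=> f g lam lam1; apply: coef_fun_germ.
- exact: coef_fun_frob.
- exact: (coef_fun_deriv p_prime KCp).
- by move=> f x Hf x1 xT; apply: (coef_fun_apx KCp Hf).
- by move=> f lam Hf lam1 f0; apply: (coef_fun_annulus_eq0 p_prime KCp T_unit Hf lam1 f0).
Qed.

Lemma good_scale W a f : good_module W -> W f -> W (fun t => a * f t).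
Proof. by move=> gW; apply: (good_mul gW); apply: (coef_fun_const KCp). Qed.

Lemma good_sub W f g : good_module W -> W f -> W g -> W (fun t => f t - g t).
Proof.
move=> gW Wf Wg; have := good_add gW Wf (good_scale (-1) gW Wg).
apply: (good_germ gW (@ltr01 R)) => t _ /=.
by rewrite mulN1r.
Qed.

Lemma is_deriv_translate f x h d :
  is_deriv v f (x + h) d -> is_deriv v (fun h => f (x + h)) h d.
Proof. by apply: lim0_eq => k _; rewrite addrA. Qed.

(** Degree one in F is enough: [coleman] is generated by sums, multiplication by overconvergent
    functions and integration, without products of two integrals. *)
Definition adjoin (W : (K -> K) -> Prop) (F : K -> K) (h : K -> K) : Prop :=
  exists w a lam, [/\ W w, coef_fun a, lam < 1 &
    forall t, shell_gt lam t -> h t = w t + a t * F t].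

Section Adjoin.
Context (W : (K -> K) -> Prop) (gW : good_module W).
Context (F g : K -> K) (lamF : R) (lamF1 : lamF < 1).
Context (F_apx : forall x, v x = 1 -> off x -> apx v (fun h => F (x + h))).
Context (Wg : W g)
  (F_deriv : forall t, shell_gt lamF t -> is_deriv v F t (g t)).
Context (r : K) (r_pow : forall k, (0 < k)%N -> r ^+ k != 1).
Context (F_frob : W (fun t => F (t ^+ q) - r * F t)).

Lemma adjoin_sub f : W f -> adjoin W F f.
Proof.
move=> Wf; exists f, (fun=> 0), 0; split=> //; first exact: (coef_fun_const KCp).
by move=> t _; rewrite mul0r addr0.
Qed.

Lemma adjoin_mem : adjoin W F F.
Proof.
exists (fun=> 0), (fun=> 1), 0; split=> //.
- by apply: (good_coef gW); apply: (coef_fun_const KCp).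
- exact: (coef_fun_const KCp).
- by move=> t _; rewrite mul1r add0r.
Qed.

Lemma periodic_orbit x : v x <= 1 ->
  exists2 N, (0 < N)%N & v (x ^+ (q ^ N) - x) < 1.
Proof.
move=> x1; have [N N0 HN] := residue_periodic p_prime KCp x1; exists N => //.
rewrite -expnM mulnC expnM; elim: m => [|j IH].
  by rewrite expn0 expr1 subrr (av0 KCp).
rewrite expnSr exprM; apply: (av_lt_trans KCp (y := x ^+ (p ^ N))) => //.
by rewrite frobenius_congr // (avX KCp) exprn_ile1.
Qed.

Lemma adjoin_identity f lam : adjoin W F f -> lam < 1 ->
  (forall t, lam < v t -> v t < 1 -> f t = 0) ->
  forall t, v t = 1 -> off t -> f t = 0.
Proof.
move=> [w [a [lam1 [Ww ca lam11 fE]]]] lam_lt1 f0.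
pose S t := w t + a t * F t.
have unit_shell mu t : mu < 1 -> v t = 1 -> off t -> shell_gt mu t.
  by move=> mu1 t1 tT; split; rewrite ?t1.
suff HS t : v t = 1 -> off t -> S t = 0.
  by move=> t t1 tT; rewrite fE; [apply: HS | apply: unit_shell].
pose lam2 := Num.max lam lam1.
have lam21 : lam2 < 1 by rewrite gt_max lam_lt1.
have S0 s : lam2 < v s -> v s < 1 -> S s = 0.
  rewrite gt_max => /andP[ls l1s] s1; rewrite /S -fE ?f0 //.
  by split=> //; [exact: ltW | exact: (off_open KCp T_unit)].
have disc_off x s : off x -> v x = 1 -> v (s - x) < 1 -> v s = 1 /\ off s.
  move=> xT x1 sx; split; last exact: (off_near KCp xT).
  by rewrite -(subrK x s) addrC (avD_iso KCp) x1.
(* If a vanishes on one residue disc, it vanishes on an annulus and then at all units off [T]; S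
   reduces to w and the identity principle of [W] applies. *)
have [[x [x1 xT ax0]]|a_nz] := pselect (exists x, [/\ v x = 1, off x &
    forall t, v (t - x) < 1 -> a t = 0]).
  have [lam3 lam31 a0] := coef_fun_disc_eq0 p_prime KCp T_unit ca x1 xT ax0.
  move=> t1 tT.
  have at0 : a t = 0 := coef_fun_annulus_eq0 p_prime KCp T_unit ca lam31 a0 t1 tT.
  rewrite /S at0 mul0r addr0.
  apply: (good_identity gW Ww (lam := Num.max lam2 lam3)) => //.
    by rewrite gt_max lam21.
  move=> s; rewrite gt_max => /andP[l2s l3s] s1.
  by have := S0 s l2s s1; rewrite /S a0 // mul0r addr0.
have {}a_nz x : v x = 1 -> off x -> exists2 t, v (t - x) < 1 & a t != 0.
  move=> x1 xT; apply: contrapT => H; apply: a_nz; exists x; split=> // s sx.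
  by apply/eqP/negPn/negP => as0; apply: H; exists s.
have [a' [lama [ca' lama1 a_deriv]]] := coef_fun_deriv p_prime KCp ca.
have [w' [lamw [Ww' lamw1 w_deriv]]] := good_deriv gW Ww.
pose S' t := w' t + (a' t * F t + a t * g t).
pose lam3 := Num.max (Num.max lama lamw) lamF.
have lam31 : lam3 < 1 by rewrite !gt_max lama1 lamw1.
have S_deriv s : shell_gt lam3 s -> is_deriv v S s (S' s).
  move=> [ls s1 sT]; move: ls; rewrite !gt_max => /andP[/andP[las lws] lFs].
  apply: (is_deriv_add KCp); first by apply: w_deriv.
  by apply: (is_deriv_mul KCp); [apply: a_deriv | apply: F_deriv].
have S'0 s : Num.max lam2 lam3 < v s -> v s < 1 -> S' s = 0.
  rewrite gt_max => /andP[l2s l3s] s1.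
  have Hs : shell_gt lam3 s.
    by split=> //; [exact: ltW | exact: (off_open KCp T_unit)].
  apply: (is_deriv_unique p_prime KCp (S_deriv s Hs)).
  (* The radius [lam2] may be negative, so s = 0 has to be considered; S then vanishes on the whole
     open unit disc. *)
  have [vs0|s0] := eqVneq s 0.
    have l20 : lam2 < 0 by move: l2s; rewrite vs0 (av0 KCp).
    have near0 u : v (u - s) < 1 -> 0 = S u.
      by rewrite vs0 subr0 => u1; rewrite S0 // (lt_le_trans l20).
    exact: (is_deriv_near KCp ltr01 near0 (is_deriv_const KCp 0 s)).
  have vs : 0 < v s by rewrite (av_gt0 KCp).
  have near u : v (u - s) < v s -> 0 = S u.
    move=> us; have vu : v u = v s by rewrite -(subrK s u) addrC (avD_iso KCp).
    by rewrite S0 ?vu.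
  exact: (is_deriv_near KCp vs near (is_deriv_const KCp 0 s)).
(* [a' S - a S'] does not involve [F], so that it lies in [W]. *)
pose T1 t := a' t * w t - a t * w' t - a t * a t * g t.
have WT1 : W T1.
  apply: good_sub => //; last by apply: (good_mul gW) => //; apply: (coef_fun_mul KCp).
  by apply: good_sub => //; apply: (good_mul gW).
have T1E s : T1 s = a' s * S s - a s * S' s by rewrite /T1 /S /S'; ring.
have T10 : forall t, v t = 1 -> off t -> T1 t = 0.
  apply: (good_identity gW WT1 (lam := Num.max lam2 lam3)) => [|s ls s1].
    by rewrite gt_max lam21.
  rewrite T1E S'0 // S0 ?mulr0 ?subrr //.
  by move: ls; rewrite gt_max => /andP[].
have a_apx x : v x = 1 -> off x -> apx v (fun h => a (x + h)).
  by move=> x1 xT; apply: (coef_fun_apx KCp ca).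
have S_prop x : v x = 1 -> off x ->
    exists c, forall s, v (s - x) < 1 -> S s = c * a s.
  move=> x1 xT; have [s0 s0x as0] := a_nz x x1 xT.
  have S_apx : apx v (fun h => S (x + h)).
    apply: (apx_add KCp); first exact: (good_apx gW).
    by apply: (apx_mul KCp); [exact: a_apx | exact: F_apx].
  have inner h : v h < 1 -> v (x + h) = 1 /\ off (x + h).
    by move=> h1; apply: (disc_off x) => //; rewrite addrAC subrr add0r.
  have [|||||c Hc] := @wronskian_prop _ _ _ _ p_prime KCp _ _
    (fun h => S' (x + h)) (fun h => a' (x + h)) (s0 - x) S_apx (a_apx x x1 xT).
  - move=> h /inner[xh1 xhT]; apply/is_deriv_translate/S_deriv.
    exact: unit_shell.
  - move=> h /inner[xh1 xhT]; apply/is_deriv_translate/a_deriv.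
    exact: unit_shell.
  - move=> h /inner[xh1 xhT]; have := T10 _ xh1 xhT; rewrite T1E => /eqP.
    by rewrite subr_eq0 => /eqP <-; rewrite mulrC.
  - by [].
  - by rewrite subrKC.
  - by exists c => s sx; have := Hc _ sx; rewrite subrKC.
(* [a * (S o phi) - r * (a o phi) * S] lies in [W] for the same reason. *)
pose T2 t := a t * w (t ^+ q) - r * (a (t ^+ q) * w t) +
  a t * (a (t ^+ q) * (F (t ^+ q) - r * F t)).
have caq : coef_fun (fun t => a (t ^+ q)) by apply: coef_fun_frob.
have WT2 : W T2.
  apply: (good_add gW); last by apply: (good_mul gW) => //; apply: (good_mul gW).
  apply: good_sub => //; first by apply: (good_mul gW) => //; apply: (good_frob gW).
  by apply: good_scale => //; apply: (good_mul gW).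
have T2E s : T2 s = a s * S (s ^+ q) - r * a (s ^+ q) * S s.
  by rewrite /T2 /S; ring.
have T20 : forall t, v t = 1 -> off t -> T2 t = 0.
  (* The radius [lam4] keeps s^q in the annulus where S vanishes. *)
  have [lam4 /andP[lam40 lam41] Hlam4] := exp_near1 q lam21.
  apply: (good_identity gW WT2 (lam := Num.max lam2 lam4)) => [|s].
    by rewrite gt_max lam21.
  rewrite gt_max => /andP[l2s l4s] s1; rewrite T2E !S0 ?mulr0 ?subrr //.
    rewrite (avX KCp); apply: lt_trans Hlam4 _.
    by rewrite ltr_pXn2r ?nnegrE ?q_gt0 // ltW.
  by rewrite (avX KCp) exprn_ilt1 // ?gtn_eqF ?q_gt0.
have frob_disc x : v x = 1 -> off x -> v (x ^+ q) = 1 /\ off (x ^+ q).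
  by move=> x1 xT; rewrite (avX KCp) x1 expr1n; split=> //; apply: off_frob; rewrite ?x1.
have step x c c' : v x = 1 -> off x ->
    (forall s, v (s - x) < 1 -> S s = c * a s) ->
    (forall s, v (s - x ^+ q) < 1 -> S s = c' * a s) -> c' = r * c.
  move=> x1 xT Hc Hc'; have [xq1 xqT] := frob_disc x x1 xT.
  (* The two constants are compared at a point of the disc of x where neither a nor a o phi
     vanishes; it exists since zeros are isolated. That a o phi is not zero on this disc is seen at
     a q-th root of a point where a is nonzero: the root lies in the disc of x by injectivity of
     Frobenius on residues. *)
  have [s1 s1x as1] := a_nz x x1 xT.
  have [u ux au] := a_nz _ xq1 xqT.
  have [s2 Hs2] := root_exists u q_gt0.
  have vs2 : v s2 = 1.
    have [vu _] := disc_off _ _ xqT xq1 ux.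
    apply/eqP; rewrite -(@pexpr_eq1 _ _ q) ?q_gt0 ?av_ge0 //.
    by rewrite -(avX KCp) Hs2 vu.
  have s2x : v (s2 - x) < 1.
    by rewrite -(frobenius_congr p_prime KCp m) ?x1 ?vs2 // Hs2.
  have [|d1 d10 Hd1] := isolated_zeros p_prime KCp (a_apx x x1 xT) s1x.
    by rewrite subrKC.
  have [|d2 d20 Hd2] := isolated_zeros p_prime KCp (coef_fun_apx KCp caq x1 xT) s2x.
    by rewrite subrKC Hs2.
  have [h h0 h_lt] : exists2 h, 0 < v h & v h < Num.min (Num.min d1 d2) 1.
    by apply: (av_small p_prime KCp); rewrite !lt_min d10 d20 ltr01.
  move: h_lt; rewrite !lt_min => /andP[/andP[hd1 hd2] h1].
  rewrite (av_gt0 KCp) in h0.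
  have ah := Hd1 h h0 hd1; have aqh := Hd2 h h0 hd2.
  have hx : v (x + h - x) < 1 by rewrite addrAC subrr add0r.
  have [xh1 xhT] := disc_off _ _ xT x1 hx.
  have := T20 _ xh1 xhT; rewrite T2E (Hc _ hx) Hc'; last first.
    by rewrite frobenius_congr // ?x1 ?xh1.
  move=> E; apply/eqP; rewrite -subr_eq0.
  have /eqP : (c' - r * c) * (a (x + h) * a ((x + h) ^+ q)) = 0.
    by rewrite -[RHS]E; ring.
  by rewrite !mulf_eq0 (negPf ah) (negPf aqh) !orbF.
have steps N x c : v x = 1 -> off x ->
    (forall s, v (s - x) < 1 -> S s = c * a s) ->
    forall s, v (s - x ^+ (q ^ N)) < 1 -> S s = r ^+ N * c * a s.
  elim: N x c => [|N IH] x c x1 xT Hc s; first by rewrite expn0 !expr1 mul1r; apply: Hc.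
  have [xq1 xqT] := frob_disc x x1 xT.
  have [c' Hc'] := S_prop _ xq1 xqT.
  rewrite expnS exprM => /(IH _ c' xq1 xqT Hc') ->.
  by rewrite (step x c c') // exprSr mulrA.
move=> t1 tT; have [c Hc] := S_prop t t1 tT.
have [|N N0 HN] := @periodic_orbit t; first by rewrite t1.
have [s st as0] := a_nz t t1 tT.
(* After N steps the disc of t is reached again, so both constants describe S on it. *)
have E : c * a s = r ^+ N * c * a s.
  rewrite -(Hc s st); apply: (steps N t c t1 tT Hc).
  by apply: (av_lt_trans KCp st); rewrite (avBC KCp).
have /eqP : (1 - r ^+ N) * c * a s = 0.
  by rewrite !mulrBl mul1r E subrr.
rewrite !mulf_eq0 (negPf as0) orbF subr_eq0 eq_sym (negPf (r_pow N0)) /=.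
by move=> /eqP c0; rewrite Hc ?subrr ?(av0 KCp) // c0 mul0r.
Qed.

(** Stability under phi follows from (a F) o phi = r (a o phi) F + (a o phi) (F o phi - r F), where
    the last factor lies in [W]; stability under d/dt follows from F' = g. *)
Lemma adjoin_good : good_module (adjoin W F).
Proof.
have lt_max2 (x y z : R) : x < 1 -> y < 1 -> z < 1 -> Num.max (Num.max x y) z < 1.
  by move=> x1 y1 z1; rewrite !gt_max x1 y1.
split.
- by move=> a ca; apply/adjoin_sub/(good_coef gW).
- move=> f f' [w [a [l [Ww ca l1 fE]]]] [w' [a' [l' [Ww' ca' l'1 f'E]]]].
  exists (fun t => w t + w' t), (fun t => a t + a' t), (Num.max l l').
  split; first exact: (good_add gW).
  + exact: (coef_fun_add KCp).
  + by rewrite gt_max l1.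
  + move=> t Ht; rewrite fE ?f'E; first by ring.
      by apply: shell_gt_sub Ht; rewrite le_max lexx orbT.
    by apply: shell_gt_sub Ht; rewrite le_max lexx.
- move=> b f cb [w [a [l [Ww ca l1 fE]]]].
  exists (fun t => b t * w t), (fun t => b t * a t), l; split=> //.
  + exact: (good_mul gW).
  + exact: (coef_fun_mul KCp).
  + by move=> t Ht; rewrite fE // mulrDr mulrA.
- move=> f f' l' l'1 ff' [w [a [l [Ww ca l1 fE]]]].
  exists w, a, (Num.max l l'); split=> //; first by rewrite gt_max l1.
  move=> t Ht; rewrite -ff' ?fE //.
    by apply: shell_gt_sub Ht; rewrite le_max lexx.
  by apply: shell_gt_sub Ht; rewrite le_max lexx orbT.
- move=> f [w [a [l [Ww ca l1 fE]]]].
  have [l' /andP[_ l'1] Hl'] := shell_gt_frob l1.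
  have caq := coef_fun_frob ca.
  exists (fun t => w (t ^+ q) + a (t ^+ q) * (F (t ^+ q) - r * F t)),
    (fun t => r * a (t ^+ q)), l'; split=> //.
  + by apply: (good_add gW); [exact: (good_frob gW) | exact: (good_mul gW)].
  + exact: (coef_fun_scale KCp).
  + by move=> t /Hl' Ht; rewrite fE //; ring.
- move=> f [w [a [l [Ww ca l1 fE]]]].
  have [a' [la [ca' la1 a_deriv]]] := coef_fun_deriv p_prime KCp ca.
  have [w' [lw [Ww' lw1 w_deriv]]] := good_deriv gW Ww.
  exists (fun t => w' t + (a' t * F t + a t * g t)).
  (* The 0 in the maximum makes |t| positive, so that |s - t| < |t| is a neighbourhood of t on which
     f = w + a F. *)
  exists (Num.max (Num.max (Num.max (Num.max l 0) la) lw) lamF).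
  split.
  + exists (fun t => w' t + a t * g t), a', 0; split=> //.
      by apply: (good_add gW) => //; apply: (good_mul gW).
    by move=> t _; ring.
  + by rewrite !gt_max l1 la1 lw1 lamF1 ltr01.
  + move=> t [lt t1 tT]; move: lt; rewrite !gt_max.
    move=> /andP[/andP[/andP[/andP[lt t0] lat] lwt] lFt].
    have near s : v (s - t) < v t -> w s + a s * F s = f s.
      move=> st; have vs : v s = v t by rewrite -(subrK t s) addrC (avD_iso KCp).
      rewrite fE //; split; rewrite ?vs //.
      by apply: (off_near KCp tT); apply: lt_le_trans st t1.
    apply: (is_deriv_near KCp t0 near).
    apply: (is_deriv_add KCp); first by apply: w_deriv.
    by apply: (is_deriv_mul KCp); [apply: a_deriv | apply: F_deriv].
- move=> f x [w [a [l [Ww ca l1 fE]]]] x1 xT.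
  apply: (@apx_eq _ _ _ (fun h => w (x + h) + a (x + h) * F (x + h))).
    move=> h h1; have xh : v (x + h) = 1 by rewrite (avD_iso KCp) x1.
    rewrite fE //; split; rewrite ?xh //.
    by apply: (off_near KCp xT); rewrite addrAC subrr add0r.
  apply: (apx_add KCp); first exact: (good_apx gW).
  apply: (apx_mul KCp); last exact: F_apx.
  exact: (coef_fun_apx KCp ca).
- by move=> f lam; apply: adjoin_identity.
Qed.

End Adjoin.

Definition frob_sub (r : K) (F : K -> K) : K -> K := fun t => F (t ^+ q) - r * F t.

(** The map h -> (x + h)^q - x^q does not increase absolute values on the open unit disc, so it can
    be substituted into the expansion of F at x^q. *)
Lemma apx_frob F : (forall x, v x = 1 -> off x -> apx v (fun h => F (x + h))) ->
  forall x, v x = 1 -> off x -> apx v (fun h => F ((x + h) ^+ q)).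
Proof.
move=> HF x x1 xT.
have xq : apx v (fun h => F (x ^+ q + h)).
  by apply: HF; [rewrite (avX KCp) x1 expr1n | apply: off_frob; rewrite ?x1].
pose P := (x%:P + 'X) ^+ q - (x ^+ q)%:P.
have hP h : P.[h] = (x + h) ^+ q - x ^+ q.
  by rewrite !hornerE.
have HP h : v h < 1 -> v P.[h] <= v h.
  move=> h1; rewrite hP subrXX (avM KCp) addrAC subrr add0r ler_piMr //.
  apply: (av_sum_le KCp) => // i _; rewrite (avM KCp) !(avX KCp) x1 expr1n mulr1.
  by rewrite exprn_ile1 // (avD_le KCp) ?x1 // ltW.
by apply: (apx_eq _ (apx_comp HP xq)) => h _; rewrite hP subrKC.
Qed.

(** Induction on the linear factors: (phi - r) F has the derivative q t^(q - 1) g (t^q) - r g, which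
    is again in [W], and one factor less. A good module containing it exists by induction, and F is
    adjoined to that module. *)
Lemma good_extension rs W F g lam : good_module W -> lam < 1 -> W g ->
  (forall t, shell_gt lam t -> is_deriv v F t (g t)) ->
  (forall x, v x = 1 -> off x -> apx v (fun h => F (x + h))) ->
  (forall r, r \in rs -> forall k, (0 < k)%N -> r ^+ k != 1) ->
  W (foldl (fun F r => frob_sub r F) F rs) ->
  exists W', [/\ good_module W', forall f, W f -> W' f & W' F].
Proof.
elim: rs W F g lam => [|r rs IH] W F g lam gW lam1 Wg Fd Fa Hr WF.
  by exists W.
have [lam' /andP[lam'0 lam'1] Hlam'] := shell_gt_frob lam1.
pose g2 t := (q%:R * t ^+ q.-1) * g (t ^+ q) - r * g t.
have Wg2 : W g2.
  apply: good_sub => //; last exact: good_scale.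
  apply: (good_mul gW); last exact: (good_frob gW).
  apply: (coef_fun_scale KCp).
  elim: (q.-1) => [|k IHk].
    by under eq_fun do rewrite expr0; apply: (coef_fun_const KCp).
  under eq_fun do rewrite exprS.
  by apply: (coef_fun_mul KCp) => //; apply: (coef_fun_id KCp).
have d2 t : shell_gt (Num.max lam lam') t -> is_deriv v (frob_sub r F) t (g2 t).
  move=> Ht; have Ht1 : shell_gt lam t by apply: shell_gt_sub Ht; rewrite le_max lexx.
  have Ht2 : shell_gt lam' t by apply: shell_gt_sub Ht; rewrite le_max lexx orbT.
  have dq : is_deriv v (fun s => s ^+ q) t (q%:R * t ^+ q.-1).
    have := is_deriv_poly KCp 'X^q t; rewrite derivXn hornerMn hornerXn mulr_natl.
    by apply: (is_deriv_near KCp ltr01) => s _; rewrite hornerXn.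
  have := is_deriv_add KCp (is_deriv_comp KCp dq (Fd _ (Hlam' t Ht2)))
    (is_deriv_scale KCp (- r) (Fd t Ht1)).
  rewrite /g2 mulrC mulNr; apply: (is_deriv_near KCp ltr01) => s _.
  by rewrite mulNr.
have a2 x : v x = 1 -> off x -> apx v (fun h => frob_sub r F (x + h)).
  move=> x1 xT; apply: (apx_add KCp); first exact: apx_frob.
  by apply: (apx_opp KCp); apply: (apx_mul KCp); [exact: (apx_const KCp) | exact: Fa].
have [|r' r'in|W1 [gW1 sub1 W1F]] :=
  IH W (frob_sub r F) g2 (Num.max lam lam') gW _ Wg2 d2 a2 _ WF.
- by rewrite gt_max lam1.
- by apply: Hr; rewrite inE r'in orbT.
exists (adjoin W1 F); split.
- apply: (adjoin_good gW1 lam1 Fa (sub1 _ Wg) Fd (r := r)) => //.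
  by apply: Hr; rewrite inE eqxx.
- by move=> f /sub1; apply: adjoin_sub.
- exact: adjoin_mem.
Qed.

End GoodModules.

(** * Coleman functions lie in good modules *)

Section ColemanGood.
Context (R : realType) (K : closedFieldType) (v : K -> R).
Context (p : nat) (p_prime : prime p) (KCp : is_Cp v p).
#[local] Hint Extern 0 (is_true (0 <= v _)) => exact: (av_ge0 KCp) : core.

Lemma frob_iter a b x : v x <= 1 -> v (x ^+ (p ^ a) - x) < 1 ->
  v (x ^+ (p ^ (a * b)) - x) < 1.
Proof.
move=> x1 Hx; elim: b => [|b IH].
  by rewrite muln0 expn0 expr1 subrr (av0 KCp).
rewrite mulnS expnD exprM.
apply: (av_lt_trans KCp (y := x ^+ (p ^ (a * b)))) => //.
by rewrite frobenius_congr // (avX KCp) exprn_ile1.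
Qed.

(** Minimality yields divisibility, since the remainder of a period modulo m is again a period. This
    reduces the various Frobenius exponents of Coleman integrations to a single m. *)
Lemma exists_min_period (T : seq K) : (forall s, s \in T -> v s <= 1) ->
  exists m, [/\ (0 < m)%N, forall s, s \in T -> v (s ^+ (p ^ m) - s) < 1 &
    forall k, (forall s, s \in T -> v (s ^+ (p ^ k) - s) < 1) -> (m %| k)%N].
Proof.
move=> T1.
have ex : exists m, (0 < m)%N && all (fun s => v (s ^+ (p ^ m) - s) < 1) T.
  elim: T T1 => [|s T IH] T1; first by exists 1%N.
  have [a /andP[a0 /allP Ha]] := IH (fun s' H => T1 s' (mem_behead (s := s :: T) H)).
  have s1 : v s <= 1 by apply: T1; rewrite mem_head.
  have [b b0 Hb] := residue_periodic p_prime KCp s1.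
  exists (a * b)%N; rewrite muln_gt0 a0 b0 /= mulnC frob_iter //=.
  apply/allP => s' s'T; rewrite mulnC; apply: frob_iter; last exact: Ha.
  by apply: T1; rewrite inE s'T orbT.
case: (ex_minnP ex) => m /andP[m0 /allP Hm] m_min; exists m; split=> // k Hk.
rewrite /dvdn; apply/negPn/negP; rewrite -lt0n => r0.
have : (m <= k %% m)%N.
  apply: m_min; rewrite r0 /=; apply/allP => s sT.
  have s1 := T1 s sT; have := Hk s sT.
  rewrite {1}(divn_eq k m) expnD exprM => H.
  apply: (av_lt_trans KCp (y := (s ^+ (p ^ (k %/ m * m))) ^+ (p ^ (k %% m)))) => //.
  rewrite (frobenius_congr p_prime KCp) // ?(avX KCp) ?exprn_ile1 //.
  by rewrite (avBC KCp) mulnC frob_iter // Hm.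
by rewrite leqNgt ltn_pmod.
Qed.

(** The linear functional X^i -> u i. For u i = F (t^(q^i)) its value at P is that of P(phi) F at t,
    so identities between polynomials become identities between operators. *)
Definition umbral (u : nat -> K) (P : {poly K}) : K := \sum_(i < size P) P`_i * u i.

Lemma umbral_widen u (P : {poly K}) N : (size P <= N)%N ->
  umbral u P = \sum_(i < N) P`_i * u i.
Proof.
move=> PN; rewrite /umbral (big_ord_widen N (fun i => P`_i * u i) PN) big_mkcond.
apply: eq_bigr => i _; case: ltnP => // H.
by rewrite nth_default // mul0r.
Qed.

Lemma umbral_add u P Q : umbral u (P + Q) = umbral u P + umbral u Q.
Proof.
rewrite (umbral_widen u (leq_trans (size_polyD _ _) (leqnn _))).
rewrite (umbral_widen u (leq_maxl (size P) (size Q))).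
rewrite (umbral_widen u (leq_maxr (size P) (size Q))) -big_split.
by apply: eq_bigr => i _; rewrite coefD mulrDl.
Qed.

Lemma umbral_scale u c P : umbral u (c *: P) = c * umbral u P.
Proof.
rewrite (umbral_widen u (size_scale_leq c P)) mulr_sumr.
by apply: eq_bigr => i _; rewrite coefZ mulrA.
Qed.

Lemma umbral_Xn u k : umbral u 'X^k = u k.
Proof.
rewrite /umbral size_polyXn (bigD1 ord_max) //= coefXn eqxx mul1r.
rewrite big1 ?addr0 // => i; rewrite -val_eqE /= => ik.
by rewrite coefXn (negPf ik) mul0r.
Qed.

Lemma umbral_sum u (I : Type) (s : seq I) (F : I -> {poly K}) :
  umbral u (\sum_(i <- s) F i) = \sum_(i <- s) umbral u (F i).
Proof.
apply: (big_morph (umbral u) (umbral_add u)).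
by rewrite /umbral size_poly0 big_ord0.
Qed.

Lemma umbral_comp_Xn u (P : {poly K}) k :
  umbral u (P \Po 'X^k) = umbral (fun i => u (k * i)%N) P.
Proof.
rewrite comp_polyE umbral_sum; apply: eq_bigr => i _.
by rewrite umbral_scale -exprM umbral_Xn.
Qed.

Lemma umbral_mulXsubC u r (P : {poly K}) :
  umbral u (('X - r%:P) * P) = umbral (fun i => u i.+1 - r * u i) P.
Proof.
have -> : umbral (fun i => u i.+1 - r * u i) P =
    umbral (fun i => u i.+1) P - r * umbral u P.
  by rewrite /umbral mulr_sumr -sumrB; apply: eq_bigr => i _; ring.
rewrite mulrBl mul_polyC -scaleNr umbral_add umbral_scale mulNr; congr (_ - _).
rewrite (@umbral_widen u _ (size P).+1); last first.
  by apply: leq_trans (size_polyMleq _ _) _; rewrite size_polyX.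
rewrite big_ord_recl coefXM eqxx mul0r add0r.
by apply: eq_bigr => i _; rewrite coefXM.
Qed.

(** The factorization of P(phi) into operators phi - r: a factor X - r replaces u i by u (i + 1) - r
    u i, that is, F by (phi - r) F. *)
Lemma umbral_prod m (rs : seq K) (F : K -> K) t :
  umbral (fun i => F (t ^+ ((p ^ m) ^ i))) (\prod_(r <- rs) ('X - r%:P)) =
  foldl (fun F r => frob_sub p m r F) F rs t.
Proof.
elim: rs F => [|r rs IH] F; first by rewrite big_nil -(expr0 'X) umbral_Xn expn0 expr1.
rewrite big_cons umbral_mulXsubC /= -IH; congr umbral; apply/funext => i.
by rewrite /frob_sub -exprM -expnSr.
Qed.

Context (log : K -> K) (S : seq (P1 K)) (T : seq K).
Context (T_unit : forall s, s \in T -> v s = 1).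
(** [ST] and [TS] relate the singular set [S] of one function to the common set [T]: among integral
    points off [T] only the disc of 0 is singular, and every residue disc of [T] is one of [S], so
    that a Frobenius fixing [S] also fixes [T]. *)
Context (ST : forall t s, v t <= 1 -> off v T t -> s \in S ->
  red_eq v s (Some t) -> s = Some 0).
Context (TS : forall s, s \in T -> exists2 b, Some b \in S & v (b - s) < 1).
Context (m : nat).
Context (T_frob : forall s, s \in T -> v (s ^+ (p ^ m) - s) < 1).
Context (m_min : forall k, (forall s, s \in T -> v (s ^+ (p ^ k) - s) < 1) ->
  (m %| k)%N).

Lemma lpar0 t : lpar v (Some 0) (Some t) = t.
Proof. by rewrite /lpar /= (av0 KCp) ler01 subr0. Qed.

Lemma shell_Uset lam t : shell_gt v T lam t -> Uset v S lam (Some t).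
Proof.
by move=> [lt t1 tT] s sS st; rewrite (ST t1 tT sS st) lpar0.
Qed.

Lemma shell_Uaff mu t : shell v T mu t -> Uaff v S mu (Some t).
Proof.
by move=> [lt t1 tT] s sS st; rewrite (ST t1 tT sS st) lpar0.
Qed.

Lemma dagger_coef_fun f : dagger v S f -> coef_fun v T (fun t => f (Some t)).
Proof.
move=> [lam [lam0 lam1 Hf]]; exists lam; split=> // mu lmu mu1 e e0.
have [P [Q [_ HQ HP]]] := Hf mu lmu mu1 e e0; exists P, Q; split=> t Ht.
  exact: (HQ (Some t) (shell_Uaff Ht)).
by apply/ltW; apply: (HP (Some t) (shell_Uaff Ht)).
Qed.

Lemma A_loc_apx F x : A_loc v log S F -> v x = 1 -> off v T x ->
  apx v (fun h => F (Some (x + h))).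
Proof.
move=> [HF _] x1 xT.
have xS : off_tube v S (Some x).
  move=> s sS; apply/negP => sx.
  have x1' : v x <= 1 by rewrite x1.
  have s0 := ST x1' xT sS sx.
  move: sx; rewrite s0 /red_eq /= (av0 KCp) ler01 x1 lexx /=.
  by rewrite sub0r (avN KCp) x1 ltxx.
have [a Ha] := HF _ xS; apply: (apx_series KCp (a := a)) => h h1.
have xh : v (x + h) = 1 by rewrite (avD_iso KCp) x1.
have := Ha (Some (x + h)).
rewrite /red_eq /lpar /= x1 xh lexx /= opprD addNKr (avN KCp) => /(_ h1).
by rewrite addrAC subrr add0r.
Qed.

Lemma red_frob_S k : (forall s, s \in S -> red_eq v (P1pow (p ^ k) s) s) ->
  forall s, s \in T -> v (s ^+ (p ^ k) - s) < 1.
Proof.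
move=> HS s sT; have [b bS bs] := TS sT.
have s1 : v s <= 1 by rewrite T_unit.
have b1 : v b <= 1 by rewrite -(subrK s b) (avD_le KCp) // ltW.
have bk : v (b ^+ (p ^ k)) <= 1 by rewrite (avX KCp) exprn_ile1.
have := HS _ bS; rewrite /red_eq /= bk b1 /= => H.
apply: (av_lt_trans KCp (y := b ^+ (p ^ k))).
  by rewrite frobenius_congr // (avBC KCp).
exact: (av_lt_trans KCp H).
Qed.

(** The arbitrary initial module makes the induction work: the modules for g and for P(phi) F are
    built on top of each other. It also allows several Coleman functions to be collected in one
    module. *)
Lemma coleman_good f : coleman v p log S f -> forall W, good_module v p T m W ->
  exists W', [/\ good_module v p T m W', forall h, W h -> W' h &
    W' (fun t => f (Some t))].
Proof.
elim=> {f}.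
- move=> f g [lam [lam0 lam1 fg]] _ IH W gW.
  have [W' [gW' WW' Wf]] := IH W gW; exists W'; split=> //.
  by apply: (good_germ gW' lam1 _ Wf) => t /shell_Uset/fg.
- move=> f df W gW; exists W; split=> //.
  exact/(good_coef gW)/dagger_coef_fun.
- move=> f g _ IHf _ IHg W gW.
  have [W1 [gW1 WW1 W1f]] := IHf W gW.
  have [W2 [gW2 WW2 W2g]] := IHg W1 gW1.
  exists W2; split=> // [h /WW1/WW2 //|].
  by apply: (good_add gW2) => //; apply: WW2.
- move=> a f da _ IHf W gW.
  have [W1 [gW1 WW1 W1f]] := IHf W gW; exists W1; split=> //.
  by apply: (good_mul gW1) => //; apply: dagger_coef_fun.
- move=> k P g F k0 Sk HP AF _ IHg [lam [lam0 lam1 Fd]] _ IHF W gW.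
  have [W1 [gW1 WW1 W1g]] := IHg W gW.
  have [W2 [gW2 WW2 W2F]] := IHF W1 gW1.
  have /dvdnP[j Hj] := m_min (red_frob_S Sk).
  have j0 : (0 < j)%N by case: j Hj k0 => // ->.
  (* Since p^k = (p^m)^j, the operator of the integration is [P2] evaluated at phi. If r is a root
     of [P2], then r^j is a root of P, so r is not a root of unity. *)
  pose P2 := P \Po 'X^j.
  have [rs defP2] := poly_factor P2.
  have P2F t : frob_poly (p ^ k) P F (Some t) =
      lead_coef P2 * foldl (fun F r => frob_sub p m r F) (fun t => F (Some t)) rs t.
    rewrite -(umbral_prod m rs (fun t => F (Some t)) t) -umbral_scale -defP2.
    rewrite umbral_comp_Xn; apply: eq_bigr => i _; congr (_ * F (Some _)).
    by rewrite Hj mulnC -!expnM mulnA.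
  (* Both polynomials have the same value at the root of unity 1, where P does not vanish. *)
  have P2_neq0 : P2 != 0.
    apply/negP => /eqP P20; have := HP 1%N 1 isT (expr1n _ _).
    rewrite rootE => /negP; apply; apply/eqP.
    have : P2.[1] = 0 by rewrite P20 horner0.
    by rewrite horner_comp hornerXn expr1n.
  have rs_root r : r \in rs -> forall i, (0 < i)%N -> r ^+ i != 1.
    move=> rin i i0; apply/negP => /eqP ri.
    have := HP i (r ^+ j) i0; rewrite exprAC ri expr1n => /(_ erefl) /negP; apply.
    rewrite rootE -[X in P.[X]](hornerXn r j) -horner_comp -/P2 defP2 hornerZ mulf_eq0.
    by apply/orP; right; rewrite -rootE root_prod_XsubC.
  have W2h : W2 (foldl (fun F r => frob_sub p m r F) (fun t => F (Some t)) rs).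
    have := good_scale KCp (lead_coef P2)^-1 gW2 W2F.
    apply: (good_germ gW2 (@ltr01 R)) => t _ /=.
    by rewrite P2F mulKf // lead_coef_eq0.
  have Fd' t : shell_gt v T lam t -> is_deriv v (fun t => F (Some t)) t (g (Some t)).
    by move=> /shell_Uset/Fd.
  have [W3 [gW3 WW3 W3F]] := good_extension p_prime KCp T_unit T_frob gW2 lam1
    (WW2 _ W1g) Fd' (fun x => A_loc_apx AF (x := x)) rs_root W2h.
  by exists W3; split=> // h /WW1/WW2/WW3.
Qed.

End ColemanGood.

(** * Taylor coefficients at 0 *)

Section PolylogSeries.
Context (R : realType) (K : closedFieldType) (v : K -> R).
Context (p : nat) (p_prime : prime p) (KCp : is_Cp v p).
#[local] Hint Extern 0 (is_true (0 <= v _)) => exact: (av_ge0 KCp) : core.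

Lemma apx_deriv_ex f t : apx v f -> v t < 1 -> exists d, is_deriv v f t d.
Proof.
move=> af t1.
have at_t : apx v (fun h => f (t%:P + 'X).[h]).
  apply: apx_comp_gen af => c c1.
  exists (if v t <= v c then c else t); first by case: ifP.
  move=> h hc; rewrite !hornerE; case: ifP => tc; first exact: (avD_le KCp).
  by apply: (avD_le KCp) => //; apply: le_trans hc _; rewrite ltW // ltNge tc.
have [a Ha] := apx_has_series p_prime KCp at_t; exists (a 1%N).
have := series_deriv0 p_prime KCp Ha.
by apply: lim0_eq => h _; rewrite add0r !(hornerD, hornerC, hornerX) addr0.
Qed.

Lemma red_eq_pole x t : v x <= 1 -> v t < 1 -> red_eq v (P1inv x) (Some t) = false.
Proof.
move=> x1 t1; rewrite /P1inv /red_eq; case: (eqVneq x 0) => [_|x0] /=.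
  by rewrite ltW.
rewrite (ltW t1) andbT; case: ifP => [xV1|->//].
have xV : v x^-1 = 1.
  by apply/le_anti; rewrite xV1 (avV KCp) invf_ge1 ?(av_gt0 KCp).
by rewrite (avB_iso KCp) xV // ltxx.
Qed.

Lemma prod_drop_le1 (xi : seq K) j : (forall x, x \in xi -> v x <= 1) ->
  v (\prod_(x <- drop j xi) x) <= 1.
Proof.
move=> Hxi; rewrite (av_prod KCp) big_seq; apply: prodr_ile1 => x /mem_drop xin.
by rewrite (av_ge0 KCp) Hxi.
Qed.

(** The poles have absolute value at least 1 or are infinite, so 0 is the only singular residue in
    the open unit disc. *)
Lemma annulus_Uset xi lam t : (forall x, x \in xi -> v x <= 1) ->
  lam < v t -> v t < 1 -> Uset v (tmpl_sing xi) lam (Some t).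
Proof.
move=> Hxi lt t1 s; rewrite !inE => /or3P[/eqP->|/eqP->|/mapP[j _ ->]].
- by rewrite /lpar /= (av0 KCp) ler01 subr0.
- by rewrite /red_eq /= ltW.
- by rewrite red_eq_pole // prod_drop_le1.
Qed.

(** The equation dF = g dz is only known near the boundary of the residue disc of 0. Comparing t F'
    with t g on one circle there determines all the coefficients. *)
Lemma coleman_int_series log xi g F b : (forall x, x \in xi -> v x <= 1) ->
  coleman_int_from0 v p log (tmpl_sing xi) g F ->
  has_series v b (fun t => t * g t) ->
  has_series v (fun k => b k / k%:R) (fun t => F (Some t)).
Proof.
move=> Hxi [_ [lam [lam0 lam1 Fd]] [a Ha] F0] bg.
have af : has_series v a (fun t => F (Some t)).
  move=> t t1; have := Ha (Some t); rewrite /red_eq /lpar /= (av0 KCp) ler01 ltW //=.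
  by rewrite sub0r (avN KCp) => /(_ t1); rewrite subr0.
have [f' Hf'] : {f' : K -> K & forall t, v t < 1 ->
    is_deriv v (fun t => F (Some t)) t (f' t)}.
  apply: (@boolp.choice _ _ (fun t d => v t < 1 ->
    is_deriv v (fun t => F (Some t)) t d)) => t.
  have [t1|t1] := ltP (v t) 1; last by exists 0.
  by have [d Hd] := apx_deriv_ex (apx_series KCp af) t1; exists d.
have tf := has_series_theta p_prime KCp af Hf'.
have dif := has_series_lin KCp (-1) tf bg.
have [c /andP[lc c1]] := av_near1 p_prime KCp lam1.
have c0 : c != 0 by rewrite -(av_gt0 KCp) (lt_trans lam0).
have ab k : k%:R * a k = b k.
  have := series_circle_eq0 KCp dif c0 c1; move=> H.
  apply/eqP; rewrite -subr_eq0 -mulN1r; apply/eqP/H => t tc.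
  have t1 : v t < 1 by rewrite tc.
  have -> : f' t = g t.
    apply: (is_deriv_unique p_prime KCp (Hf' t t1)).
    by apply: Fd; apply: annulus_Uset => //; rewrite tc.
  by rewrite mulN1r subrr.
(* At k = 0 the quotient is 0 by the convention on division by 0, in agreement with F (0) = 0. *)
apply: (has_series_eq _ _ af) => // k; rewrite -ab.
have [->|k0] := posnP k; last by rewrite mulrC mulKf ?(natK_neq0 p_prime KCp).
by rewrite -(series_at0 KCp af) F0 !mul0r.
Qed.

Lemma geometric_series y : v y <= 1 ->
  has_series v (fun k => if k == 0%N then 0 else y ^+ k)
    (fun t => t * (y / (1 - y * t))).
Proof.
move=> y1 t t1; apply/(av_cvgP KCp) => e e0.
have yt1 : v (y * t) < 1.
  by rewrite (avM KCp); apply: le_lt_trans t1; apply: ler_piMl.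
have vyt : v (1 - y * t) = 1 by rewrite (avB_iso KCp) (av1 KCp).
have yt0 : 1 - y * t != 0 by rewrite -(av_gt0 KCp) vyt.
have [N0 HN0] := exp_small (l := v t) (e := e) ltac:(by rewrite (av_ge0 KCp) t1) e0.
exists N0.+1; case=> // N; rewrite ltnS => NN.
have -> : \sum_(k < N.+1) (if k == 0%N :> nat then 0 else y ^+ k) * t ^+ k -
    t * (y / (1 - y * t)) = - (y * t) ^+ N.+1 / (1 - y * t).
  elim: N {NN} => [|N IH]; first by rewrite big_ord1 mul0r expr1; field.
  rewrite big_ord_recr /= addrAC IH -exprMn (exprS _ N.+1).
  by field.
rewrite (avF KCp) vyt divr1 (avN KCp) (avX KCp) (avM KCp) exprMn.
apply: le_lt_trans HN0; rewrite -[X in _ <= X]mul1r.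
apply: ler_pM; rewrite ?exprn_ge0 ?exprn_ile1 //.
by apply: ler_wiXn2l => //; [exact: ltW | exact: leqW].
Qed.

(* Taylor coefficients at 0 of the polylogarithm with (n_r, xi_r), ..., (n_1, xi_1)
   listed from the outermost summation index. *)
Fixpoint mcoef (w : seq (nat * K)) (k : nat) : K :=
  if w is (n, x) :: w' then x ^+ k / k%:R ^+ n * \sum_(i < k) mcoef w' i
  else (k == 0%N)%:R.

Lemma sum_mcoef_nil k : \sum_(i < k) mcoef [::] i = (0 < k)%N%:R.
Proof.
case: k => [|k]; first by rewrite big_ord0.
by rewrite big_ord_recl big1 ?addr0.
Qed.

(** Integration against dt / t divides the k-th coefficient by k. Integration against y dt / (1 - y
    t) first multiplies by a geometric series, which opens a new outermost summation index. *)
Lemma tmpl_series log n xi F : is_tmpl v p log n xi F ->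
  (forall x, x \in xi -> v x <= 1) ->
  size n = size xi /\
  has_series v (mcoef (rev (zip n xi))) (fun t => F (Some t)).
Proof.
elim=> {n xi F}.
- move=> x F HF Hxi; split=> //.
  have x1 : v x <= 1 by apply: Hxi; rewrite mem_head.
  apply: has_series_eq (coleman_int_series Hxi HF (geometric_series x1)) => // k.
  rewrite /= sum_mcoef_nil expr1; case: k => [|k] /=; first by rewrite mul0r mulr0.
  by rewrite mulr1.
- move=> n m xi G F m0 _ IH HF Hxi; have {IH} [sz Gs] := IH Hxi.
  split; first by rewrite -sz !size_rcons.
  case/lastP: xi => [|xi x] in Hxi sz Gs HF *; first by rewrite size_rcons in sz.
  have {}sz : size n = size xi by move: sz; rewrite !size_rcons => -[].
  rewrite zip_rcons // rev_rcons in Gs; rewrite zip_rcons // rev_rcons.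
  (* The quotient G / t has the conventional value 0 at t = 0, so t (G / t) = G requires G (0) =
     0. *)
  have G0 : G (Some 0) = 0.
    by rewrite (series_at0 KCp Gs) /= big_ord0 mulr0.
  have H : has_series v (mcoef ((m, x) :: rev (zip n xi)))
      (fun t => t * (G (Some t) / t)).
    apply: has_series_eq Gs => // t _.
    have [->|t0] := eqVneq t 0; first by rewrite G0 mul0r.
    by rewrite mulrC divfK.
  apply: has_series_eq (coleman_int_series Hxi HF H) => // k /=.
  by rewrite exprS invfM; ring.
- move=> n xi x y G F _ IH HF Hxi.
  have y1 : v y <= 1 by apply: Hxi; rewrite mem_rcons mem_head.
  have x1 : v x <= 1 by apply: Hxi; rewrite mem_rcons inE mem_rcons mem_head orbT.
  have Hxi' : forall z, z \in rcons xi (x * y) -> v z <= 1.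
    move=> z; rewrite mem_rcons inE => /orP[/eqP->|zin].
      by rewrite (avM KCp) mulr_ile1.
    by apply: Hxi; rewrite mem_rcons inE mem_rcons inE zin !orbT.
  have {IH} [sz Gs] := IH Hxi'.
  split; first by rewrite !size_rcons in sz *; rewrite sz.
  case/lastP: n => [|n m] in sz Gs *; first by rewrite size_rcons in sz.
  have {}sz : size n = size xi by move: sz; rewrite !size_rcons => -[].
  rewrite zip_rcons // rev_rcons in Gs.
  rewrite zip_rcons ?size_rcons ?sz // rev_rcons zip_rcons // rev_rcons.
  have [d Hd] := apx_has_series p_prime KCp (apx_mul KCp (apx_series KCp Gs)
    (apx_series KCp (geometric_series y1))).
  have dE := mul_coef p_prime KCp Gs (geometric_series y1) Hd.
  have H : has_series v d (fun t => t * (G (Some t) * (y / (1 - y * t)))).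
    by apply: has_series_eq Hd => // t _; ring.
  apply: has_series_eq (coleman_int_series Hxi HF H) => // k /=.
  rewrite dE big_ord_recr /= subnn mulr0 addr0 expr1 mulrAC; congr (_ / _).
  rewrite mulr_sumr; apply: eq_bigr => i _ /=.
  rewrite subn_eq0 leqNgt ltn_ord /= exprMn.
  (* The merged argument of G and the geometric series combine as (x y)^i y^(k - i) = x^i y^k. *)
  have -> : y ^+ k = y ^+ (k - i) * y ^+ i by rewrite -exprD subnK // ltnW.
  by ring.
Qed.

End PolylogSeries.

(** * Iterated sums and orthogonality *)

Section IteratedSums.
Context (K : fieldType).

Lemma sum_tuple_rcons (A : finType) r (F : r.+1.-tuple A -> K) :
  \sum_(t : r.+1.-tuple A) F t =
  \sum_(t : r.-tuple A) \sum_(a : A) F [tuple of rcons t a].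
Proof.
rewrite pair_bigA /= (reindex (fun u : r.-tuple A * A => [tuple of rcons u.1 u.2])) //.
apply: onW_bij; apply: inj_card_bij.
  by move=> [t a] [t' a'] /(congr1 val) /rcons_inj [/val_inj -> ->].
by rewrite card_prod !card_tuple expnSr.
Qed.

Lemma prod_tnth_rcons (A : Type) r (h : nat -> A -> K) (t : r.-tuple A) a :
  \prod_(j < r.+1) h j (tnth [tuple of rcons t a] j) =
  (\prod_(j < r) h j (tnth t j)) * h r a.
Proof.
rewrite big_ord_recr /=; congr (_ * _).
  apply: eq_bigr => j _; congr (h _ _).
  by rewrite !(tnth_nth a) /= nth_rcons size_tuple ltn_ord.
by rewrite (tnth_nth a) /= nth_rcons size_tuple ltnn eqxx.
Qed.

Lemma sum_tuple_prod (A : finType) r (h : nat -> A -> K) :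
  \sum_(t : r.-tuple A) \prod_(j < r) h j (tnth t j) =
  \prod_(j < r) \sum_(a : A) h j a.
Proof.
elim: r => [|r IH].
  rewrite (eq_bigr (fun=> 1)) => [|t _]; last by rewrite big_ord0.
  by rewrite big_ord0 sumr_const card_tuple expn0.
rewrite sum_tuple_rcons big_ord_recr /= -IH mulr_suml; apply: eq_bigr => t _.
by rewrite mulr_sumr; apply: eq_bigr => a _; rewrite prod_tnth_rcons.
Qed.

Lemma prod_if_forall (A : Type) r (P : pred A) (h : nat -> A -> K) (t : r.-tuple A) :
  \prod_(j < r) (if P (tnth t j) then h j (tnth t j) else 0) =
  if [forall j, P (tnth t j)] then \prod_(j < r) h j (tnth t j) else 0.
Proof.
case: ifP => [/forallP H|/forallPn[j /negPf Pj]].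
  by apply: eq_bigr => j _; rewrite H.
by rewrite (bigD1 j) //= Pj mul0r.
Qed.

Lemma sum_tuple_prod_cond (A : finType) r (P : pred A) (h : nat -> A -> K) :
  \sum_(t : r.-tuple A | [forall j, P (tnth t j)]) \prod_(j < r) h j (tnth t j) =
  \prod_(j < r) \sum_(a : A | P a) h j a.
Proof.
rewrite big_mkcond /=.
under eq_bigr => t _ do rewrite -prod_if_forall.
rewrite (sum_tuple_prod r (fun j a => if P a then h j a else 0)).
by apply: eq_bigr => j _; rewrite [RHS]big_mkcond.
Qed.

(* [iter_sum r f k] sums [\prod_j f j k_j] over [0 < k_0 < ... < k_(r - 1) = k];
   the empty index sequence ends at [0]. *)
Fixpoint iter_sum (r : nat) (f : nat -> nat -> K) (k : nat) : K :=
  if r is r'.+1 then f r' k * \sum_(i < k) iter_sum r' f i else (k == 0%N)%:R.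

Definition increasing_to N r (k : nat) (t : r.-tuple 'I_N) : bool :=
  let s := [seq val i | i <- t] in path ltn 0 s && (last 0%N s == k).

Lemma iter_sum_tuples r N f k : (k < N)%N ->
  iter_sum r f k = \sum_(t : r.-tuple 'I_N | increasing_to k t)
    \prod_(j < r) f j (tnth t j).
Proof.
elim: r k => [|r IH] k kN.
  rewrite /= (eq_bigl (fun=> k == 0%N)) => [|t]; last first.
    by rewrite /increasing_to tuple0 /= eq_sym.
  case: eqP => _; last by rewrite big_pred0_eq.
  rewrite (eq_bigr (fun=> 1)) => [|t _]; last by rewrite big_ord0.
  by rewrite sumr_const card_tuple expn0.
rewrite big_mkcond sum_tuple_rcons /=.
have inc_rcons (t : r.-tuple 'I_N) (a : 'I_N) :
    increasing_to k [tuple of rcons t a] =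
    (a == Ordinal kN) && (path ltn 0 [seq val i | i <- t] &&
      (last 0 [seq val i | i <- t] < k))%N.
  rewrite /increasing_to /= map_rcons rcons_path last_rcons -val_eqE /=.
  by case: eqP => [->|_]; rewrite ?andbT ?andbF.
have step (t : r.-tuple 'I_N) :
    \sum_(a : 'I_N) (if increasing_to k [tuple of rcons t a] then
       \prod_(j < r.+1) f j (tnth [tuple of rcons t a] j) else 0) =
    f r k * \sum_(i < k) (if increasing_to i t then \prod_(j < r) f j (tnth t j) else 0).
  rewrite (bigD1 (Ordinal kN)) //= [X in _ + X]big1 ?addr0 => [|a /negPf ak].
    rewrite inc_rcons eqxx /= (prod_tnth_rcons (fun j (i : 'I_N) => f j i)) /=.
    rewrite /increasing_to; case: path => /=; last by rewrite big1 ?mulr0.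
    have [lt_k|ge_k] := ltnP.
      rewrite (bigD1 (Ordinal lt_k)) //= eqxx [X in _ + X]big1 => [|i].
        by rewrite addr0 mulrC.
      by rewrite -val_eqE /= eq_sym => /negPf ->.
    rewrite [X in _ = _ * X]big1 ?mulr0 // => i _; case: eqP => // E.
    by have := ltn_ord i; rewrite -E ltnNge ge_k.
  by rewrite inc_rcons ak.
under [RHS]eq_bigr => t _ do rewrite step.
rewrite -mulr_sumr exchange_big /=; congr (_ * _); apply: eq_bigr => i _.
by rewrite IH ?big_mkcond // (ltn_trans (ltn_ord i)).
Qed.

Lemma iter_sum_tuples_all r N f (g : nat -> K) : (0 < r)%N ->
  \sum_(k < N) iter_sum r f k * g k =
  \sum_(t : r.-tuple 'I_N | path ltn 0 [seq val i | i <- t])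
    (\prod_(j < r) f j (tnth t j)) * g (last 0%N [seq val i | i <- t]).
Proof.
move=> r0; rewrite [RHS]big_mkcond /=.
have step (k : 'I_N) : iter_sum r f k * g k = \sum_(t : r.-tuple 'I_N)
    (if increasing_to k t then (\prod_(j < r) f j (tnth t j)) * g k else 0).
  rewrite (iter_sum_tuples r f (ltn_ord k)) mulr_suml [LHS]big_mkcond /=.
  by [].
under eq_bigr => k _ do rewrite step.
rewrite exchange_big /=; apply: eq_bigr => t _.
rewrite /increasing_to; case: path => /=; last by rewrite big1.
have lastN : (last 0 [seq val i | i <- t] < N)%N.
  case: r r0 t {step} => // r _ t; case/tupleP: t => a t /=.
  by rewrite (last_map val); apply: ltn_ord.
rewrite (bigD1 (Ordinal lastN)) //= eqxx [X in _ + X]big1 ?addr0 // => i.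
by rewrite -val_eqE /= eq_sym => /negPf ->.
Qed.

Lemma sum_tuple_prod_ord (A : finType) r (P : pred A) (h : 'I_r -> A -> K) :
  \sum_(t : r.-tuple A | [forall j, P (tnth t j)]) \prod_(j < r) h j (tnth t j) =
  \prod_(j < r) \sum_(a : A | P a) h j a.
Proof.
pose h' (j : nat) a := if insub j is Some i then h i a else 0.
have h'E (j : 'I_r) a : h' j a = h j a by rewrite /h' valK.
transitivity (\prod_(j < r) \sum_(a : A | P a) h' j a).
  by rewrite -sum_tuple_prod_cond; apply: eq_bigr => t _; apply: eq_bigr => j _.
by apply: eq_bigr => j _; apply: eq_bigr => a _.
Qed.
End IteratedSums.

(** * Character sums over p-th roots of unity *)

Section Orthogonality.
Context (R : realType) (K : closedFieldType) (v : K -> R).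
Context (p : nat) (p_prime : prime p) (KCp : is_Cp v p).

(** A root of 1 + X + ... + X^(p - 1) is a p-th root of unity, and it differs from 1 because p is
    nonzero in K. *)
Lemma prim_root_exists : exists z : K, p.-primitive_root z.
Proof.
have p0 := prime_gt0 p_prime; have pK := natK_neq0 p_prime KCp p0.
pose P : {poly K} := \poly_(i < p) 1.
have szP : size P = p by rewrite size_poly_eq // oner_neq0.
have [z rz] : exists z, root P z.
  by apply/closed_rootP; rewrite szP gtn_eqF ?prime_gt1.
have Pz : \sum_(i < p) z ^+ i = 0.
  move: rz; rewrite rootE horner_poly => /eqP; under eq_bigr do rewrite mul1r.
  by [].
have zp : z ^+ p = 1.
  by apply/eqP; rewrite -subr_eq0 subrX1 Pz mulr0.
have [k kz kp] := prim_order_exists p0 zp.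
exists z; have [_ /(_ _ kp) /orP[/eqP k1|/eqP kp']] := primeP p_prime; last first.
  by rewrite -kp'.
have z1 : z = 1 by have := prim_expr_order kz; rewrite k1 expr1.
move: Pz pK; rewrite z1; under eq_bigr do rewrite expr1n.
by rewrite sumr_const card_ord => ->; rewrite eqxx.
Qed.

Context (z : K) (z_prim : p.-primitive_root z).

Lemma prim_neq0 b : z ^+ b != 0.
Proof. by rewrite expf_neq0 // (prim_root_eq0 z_prim) -lt0n prime_gt0. Qed.

Lemma sum_char_pow (k : nat) (a : 'I_p) :
  \sum_(b : 'I_p) (z ^+ b) ^- a * (z ^+ b) ^+ k =
  if (k %% p)%N == a then p%:R else 0.
Proof.
pose w := z ^- a * z ^+ k.
have wE (b : 'I_p) : (z ^+ b) ^- a * (z ^+ b) ^+ k = w ^+ b.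
  by rewrite /w exprMn exprVn -!exprM mulnC (mulnC b).
have wp : w ^+ p = 1.
  by rewrite /w exprMn exprVn -!exprM mulnC exprM (prim_expr_order z_prim) expr1n invr1
    mul1r mulnC exprM (prim_expr_order z_prim) expr1n.
have w1 : (w == 1) = ((k %% p)%N == a).
  have zV : (z ^+ a)^-1 != 0 by rewrite invr_eq0 prim_neq0.
  rewrite /w mulrC -(mulfV (prim_neq0 a)) (inj_eq (mulIf zV)).
  by rewrite (eq_prim_root_expr z_prim) (modn_small (ltn_ord a)).
under eq_bigr => b _ do rewrite wE.
rewrite -w1; case: eqP => [->|/eqP w1'].
  by under eq_bigr do rewrite expr1n; rewrite sumr_const card_ord.
have /eqP := subrX1 w p; rewrite wp subrr eq_sym mulf_eq0 subr_eq0.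
by rewrite (negPf w1') => /eqP.
Qed.

(** The inner sum is p times the indicator of k congruent to a modulo p; nonzero a leave exactly the
    k prime to p. *)
Lemma sum_char_coprime (k : nat) :
  \sum_(a : 'I_p | (0 < a)%N) \sum_(b : 'I_p) (z ^+ b) ^- a * (z ^+ b) ^+ k =
  if coprime k p then p%:R else 0.
Proof.
under eq_bigr => a _ do rewrite sum_char_pow.
have p0 := prime_gt0 p_prime.
rewrite coprime_sym prime_coprime // /dvdn.
rewrite big_mkcond (bigD1 (Ordinal (ltn_pmod k p0))) //= eqxx.
rewrite big1 ?addr0 => [|a].
  by rewrite lt0n.
rewrite -val_eqE /= eq_sym => /negPf ->; by case: ifP.
Qed.

Lemma iter_sum_eq r (f g : nat -> nat -> K) :
  (forall j k, (j < r)%N -> f j k = g j k) -> forall k, iter_sum r f k = iter_sum r g k.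
Proof.
elim: r => // r IH fg k /=; rewrite fg //; congr (_ * _).
by apply: eq_bigr => i _; apply: IH => j l jr; apply: fg; apply: ltnW.
Qed.

Lemma mcoef_iter_sum (n : seq nat) (x : seq K) k : size n = size x ->
  mcoef (rev (zip n x)) k =
  iter_sum (size x) (fun j k => nth 0 x j ^+ k / k%:R ^+ nth 0%N n j) k.
Proof.
elim/last_ind: x n k => [|x a IH] n k.
  by case: n.
case/lastP: n => [|n b]; rewrite !size_rcons // => -[sz].
rewrite zip_rcons // rev_rcons /= nth_rcons ltnn eqxx nth_rcons sz ltnn eqxx.
congr (_ * _); apply: eq_bigr => i _; rewrite IH //.
by apply: iter_sum_eq => j l jx; rewrite !nth_rcons sz jx.
Qed.

Definition twist r (xi : r.-tuple K) (b : r.-tuple 'I_p) : r.-tuple K :=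
  [tuple z ^+ tnth b j * tnth xi j | j < r].

(** The identity is exact for each truncation N, so no infinite series is rearranged. After the sums
    are exchanged, an index tuple carries a product of r character sums, which is p^r or 0. *)
Lemma rigid_tmpl_partial_twist r (n : r.-tuple nat) (xi : r.-tuple K) t N :
  (0 < r)%N ->
  p%:R ^+ r * rigid_tmpl_partial p n xi t N =
  \sum_(alpha : r.-tuple 'I_p | [forall j, (0 < tnth alpha j)%N])
    \sum_(b : r.-tuple 'I_p) (\prod_(j < r) (z ^+ tnth b j) ^- tnth alpha j) *
      \sum_(k < N) mcoef (rev (zip n (twist xi b))) k * t ^+ k.
Proof.
move=> r0.
pose F (k : r.-tuple 'I_N) : K :=
  (\prod_(j < r) (tnth xi j ^+ tnth k j / (tnth k j)%:R ^+ tnth n j)) *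
  t ^+ last 0%N [seq val i | i <- k].
have partial b : \sum_(k < N) mcoef (rev (zip n (twist xi b))) k * t ^+ k =
    \sum_(k : r.-tuple 'I_N | path ltn 0 [seq val i | i <- k])
      (\prod_(j < r) (z ^+ tnth b j) ^+ tnth k j) * F k.
  under eq_bigr => k _ do rewrite mcoef_iter_sum ?size_tuple //.
  rewrite iter_sum_tuples_all //; apply: eq_bigr => k _.
  rewrite mulrA -big_split /=; congr (_ * _); apply: eq_bigr => j _.
  by rewrite -(tnth_nth 0 (twist xi b)) -(tnth_nth 0%N n) tnth_mktuple exprMn mulrA.
under eq_bigr => alpha _ do under eq_bigr => b _ do rewrite partial mulr_sumr.
under eq_bigr => alpha _ do rewrite exchange_big.
rewrite exchange_big /= /rigid_tmpl_partial mulr_sumr.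
rewrite big_mkcond [RHS]big_mkcond; apply: eq_bigr => k _.
have -> : path ltn 0 [seq val i | i <- k] =
    sorted ltn [seq val i | i <- k] && all (fun i : 'I_N => (0 < i)%N) k.
  by rewrite path_sortedE ?all_map 1?andbC //; apply: ltn_trans.
have -> : all (fun i : 'I_N => (0 < i)%N && coprime i p) k =
    all (fun i : 'I_N => (0 < i)%N) k && [forall j, coprime (tnth k j) p].
  rewrite all_predI; congr (_ && _).
  by apply/all_tnthP/forallP => H j; apply: H.
rewrite andbA; case: (_ && all _ _) => //=.
have -> : \sum_(alpha : r.-tuple 'I_p | [forall j, (0 < tnth alpha j)%N])
    \sum_(b : r.-tuple 'I_p) (\prod_(j < r) (z ^+ tnth b j) ^- tnth alpha j) *
      ((\prod_(j < r) (z ^+ tnth b j) ^+ tnth k j) * F k) =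
  (\sum_(alpha : r.-tuple 'I_p | [forall j, (0 < tnth alpha j)%N])
     \prod_(j < r) \sum_(b : 'I_p) (z ^+ b) ^- tnth alpha j * (z ^+ b) ^+ tnth k j) * F k.
  rewrite mulr_suml; apply: eq_bigr => alpha _.
  rewrite -(sum_tuple_prod_ord predT
    (fun j (b : 'I_p) => (z ^+ b) ^- tnth alpha j * (z ^+ b) ^+ tnth k j)).
  rewrite mulr_suml; apply: eq_big => [b|b _]; first by apply/esym/forallP.
  by rewrite mulrA -big_split.
rewrite (sum_tuple_prod_ord (fun a : 'I_p => (0 < a)%N)
  (fun j (a : 'I_p) => \sum_(b : 'I_p) (z ^+ b) ^- a * (z ^+ b) ^+ tnth k j)).
have -> : \prod_(j < r) \sum_(a : 'I_p | (0 < a)%N) \sum_(b : 'I_p)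
    (z ^+ b) ^- a * (z ^+ b) ^+ tnth k j =
    if [forall j, coprime (tnth k j) p] then p%:R ^+ r else 0.
  transitivity (\prod_(j < r) if coprime (tnth k j) p then p%:R else 0 : K).
    by apply: eq_bigr => j _; rewrite sum_char_coprime.
  rewrite (prod_if_forall (fun i : 'I_N => coprime i p) (fun _ _ => p%:R)).
  by rewrite prodr_const card_ord.
by case: ifP => _; rewrite ?mul0r.
Qed.

End Orthogonality.

(** * The theorem *)

Section Main.
Context (R : realType) (K : closedFieldType) (v : K -> R).
Context (p : nat) (p_prime : prime p) (KCp : is_Cp v p).
#[local] Hint Extern 0 (is_true (0 <= v _)) => exact: (av_ge0 KCp) : core.

Lemma av_lim_lin (I : Type) (s : seq I) (P : pred I) (c : I -> K)
    (u : I -> nat -> K) (l : I -> K) :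
  (forall i, (fun N => v (u i N - l i)) @ \oo --> (0 : R)) ->
  (fun N => v (\sum_(i <- s | P i) c i * u i N - \sum_(i <- s | P i) c i * l i))
    @ \oo --> (0 : R).
Proof.
move=> ul; apply/(av_cvgP KCp) => e e0; elim: s => [|i s [N1 H1]].
  by exists 0%N => N _; rewrite !big_nil subrr (av0 KCp).
have c0 : 0 < 1 + v (c i) by rewrite ltr_pwDl.
have /(av_cvgP KCp) /(_ _ (divr_gt0 e0 c0)) [N2 H2] := ul i.
exists (maxn N1 N2) => N; rewrite geq_max => /andP[/H1 {}H1 /H2 {}H2].
rewrite !big_cons; case: ifP => // _; rewrite opprD addrACA -mulrBr.
apply: (avD_lt KCp) => //; rewrite (avM KCp).
apply: le_lt_trans (ler_wpM2r _ (_ : v (c i) <= 1 + v (c i))) _; rewrite ?lerDr //.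
by rewrite mulrC -ltr_pdivlMr.
Qed.

Lemma prod_congr (s s' : seq K) : size s = size s' ->
  (forall i, (i < size s)%N ->
    [/\ v s`_i = 1, v s'`_i = 1 & v (s`_i - s'`_i) < 1]) ->
  [/\ v (\prod_(x <- s) x) = 1, v (\prod_(x <- s') x) = 1 &
    v (\prod_(x <- s) x - \prod_(x <- s') x) < 1].
Proof.
elim: s s' => [|x s IH] [|x' s'] //= => [_ _|[sz] H].
  by rewrite !big_nil (av1 KCp) subrr (av0 KCp).
have [/= x1 x'1 xx'] := H 0%N isT.
have [s1 s'1 ss'] := IH s' sz (fun i => H i.+1).
rewrite !big_cons !(avM KCp) x1 x'1 s1 s'1 mulr1; split=> //.
set A := \prod_(x <- s) x in s1 ss' *; set A' := \prod_(x <- s') x in s'1 ss' *.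
have -> : x * A - x' * A' = (x - x') * A + x' * (A - A') by ring.
by apply: (avD_lt KCp); rewrite (avM KCp) ?s1 ?mulr1 // x'1 mul1r.
Qed.

Definition pole_val (xi : seq K) (j : nat) : K := (\prod_(x <- drop j xi) x)^-1.

Lemma polesE (xi : seq K) : (forall x, x \in xi -> v x = 1) ->
  poles xi = [seq Some (pole_val xi j) | j <- iota 0 (size xi)].
Proof.
move=> xi1; apply: eq_map => j; rewrite /P1inv ifN //.
rewrite -(av_gt0 KCp) (av_prod KCp) big_seq; apply: prodr_gt0 => x /mem_drop xin.
by rewrite xi1.
Qed.

Lemma pole_val_congr (s s' : seq K) j : size s = size s' ->
  (forall i, (i < size s)%N ->
    [/\ v s`_i = 1, v s'`_i = 1 & v (s`_i - s'`_i) < 1]) ->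
  [/\ v (pole_val s j) = 1, v (pole_val s' j) = 1 &
    v (pole_val s j - pole_val s' j) < 1].
Proof.
move=> sz H; have [|i|] := @prod_congr (drop j s) (drop j s').
- by rewrite !size_drop sz.
- by rewrite size_drop !nth_drop => ij; apply: H; rewrite -ltn_subRL.
rewrite /pole_val; set A := \prod_(x <- _) x; set A' := \prod_(x <- _) x.
move=> A1 A'1 AA'; rewrite !(avV KCp) A1 A'1 invr1; split=> //.
have A0 : A != 0 by rewrite -(av_gt0 KCp) A1.
have A'0 : A' != 0 by rewrite -(av_gt0 KCp) A'1.
have -> : A^-1 - A'^-1 = (A' - A) / (A * A') by field; rewrite A0 A'0.
by rewrite (avF KCp) (avM KCp) A1 A'1 mulr1 divr1 (avBC KCp).
Qed.

Lemma is_tmpl_coleman log n xi F : is_tmpl v p log n xi F ->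
  coleman v p log (tmpl_sing xi) F.
Proof. by case=> [? ? []|? ? ? ? ? _ _ []|? ? ? ? ? ? _ []]. Qed.

(** From w^p = 1^p, by injectivity of Frobenius on residues. Hence a twist moves the poles only
    within their residue discs. *)
Lemma root_unity_congr1 (w : K) : w ^+ p = 1 -> v w = 1 /\ v (w - 1) < 1.
Proof.
move=> wp; have w1 : v w = 1.
  apply/eqP; rewrite -(@pexpr_eq1 _ _ p) ?prime_gt0 ?(av_ge0 KCp) //.
  by rewrite -(avX KCp) wp (av1 KCp).
split=> //; rewrite -(frobenius1_congr p_prime KCp) ?w1 ?(av1 KCp) //.
by rewrite wp expr1n subrr (av0 KCp).
Qed.

(** The powers of a primitive root enumerate the index set without repetition, which turns a sum
    over a set into a sum over exponents. *)
Lemma sum_roots_unity (z : K) (z_prim : p.-primitive_root z) r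
    (G : r.-tuple K -> K) :
  \sum_(rho \in [set rho : r.-tuple K | forall j, tnth rho j ^+ p = 1]) G rho =
  \sum_(b : r.-tuple 'I_p) G [tuple z ^+ tnth b j | j < r].
Proof.
pose h (b : r.-tuple 'I_p) : r.-tuple K := [tuple z ^+ tnth b j | j < r].
have h_inj : injective h.
  move=> b b' /(congr1 (fun t => tnth t)) E; apply: eq_from_tnth => j.
  have := congr1 (fun f => f j) E; rewrite /h !tnth_mktuple => /eqP.
  rewrite (eq_prim_root_expr z_prim) !modn_small // => /eqP.
  exact: val_inj.
have -> : [set rho : r.-tuple K | forall j, tnth rho j ^+ p = 1] =
    [set` [seq h b | b <- index_enum (r.-tuple 'I_p)]].
  apply/seteqP; split=> rho /=.
    move=> Hrho; apply/mapP.
    have Hb j : exists b : 'I_p, tnth rho j = z ^+ b.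
      by have [b Hb] := prim_rootP z_prim (Hrho j); exists b.
    have [b Hb'] := boolp.choice Hb.
    exists [tuple b j | j < r]; first exact: mem_index_enum.
    by apply: eq_from_tnth => j; rewrite !tnth_mktuple.
  move=> /mapP[b _ ->] j; rewrite tnth_mktuple -exprM mulnC exprM.
  by rewrite (prim_expr_order z_prim) expr1n.
by rewrite -fsbig_seq ?big_map // map_inj_uniq // index_enum_uniq.
Qed.

(** Supplies the condition [ST] of [coleman_good] for any [x] congruent to [xi]: their poles share
    residue discs, which [off] excludes, and an integral t does not reduce to infinity. *)
Lemma tmpl_sing_red (xi x : seq K) T t s : size xi = size x ->
  (forall i, (i < size xi)%N ->
    [/\ v xi`_i = 1, v x`_i = 1 & v (xi`_i - x`_i) < 1]) ->
  T = [seq pole_val xi j | j <- iota 0 (size xi)] ->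
  v t <= 1 -> off v T t -> s \in tmpl_sing x -> red_eq v s (Some t) -> s = Some 0.
Proof.
move=> sz H -> t1 tT; rewrite !inE => /or3P[/eqP->//|/eqP->|].
  by rewrite /red_eq /= t1.
have x1 y : y \in x -> v y = 1.
  by move=> /(nthP 0)[i ix <-]; have [] := H i; rewrite ?sz.
rewrite polesE // => /mapP[j jin ->].
have [b1 b'1 bb'] := pole_val_congr j sz H.
rewrite /red_eq /= b'1 lexx t1 /= => bt.
have := tT (pole_val xi j); rewrite -sz in jin.
rewrite map_f // => /(_ isT); rewrite leNgt => /negP[].
by apply: (av_lt_trans KCp (y := pole_val x j)); rewrite (avBC KCp).
Qed.

Lemma good_sum T m (I : Type) (s : seq I) (P : pred I) (f : I -> K -> K) W :
  good_module v p T m W -> (forall i, W (f i)) ->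
  W (fun t => \sum_(i <- s | P i) f i t).
Proof.
move=> gW Wf; elim: s => [|i s IH].
  under eq_fun do rewrite big_nil.
  by apply: (good_coef gW); apply: (coef_fun_const KCp).
case Pi: (P i); under eq_fun do rewrite big_cons Pi; last exact: IH.
exact: (good_add gW).
Qed.

(** On the open unit disc both sides are limits of the same partial sums. At the remaining points
    the difference is a member of a good module that vanishes on the open disc. *)
Lemma polylog_identity (log : K -> K)
  (r : nat) (r_gt0 : (0 < r)%N)
  (n : r.-tuple nat)
  (xi : r.-tuple K) (hxi : forall j, v (tnth xi j) = 1)
  (ell : option K -> K) (hell : is_rigid_tmpl v p n xi ell)
  (Li : r.-tuple K -> option K -> K)
  (hLi : forall x : r.-tuple K, (forall j, v (tnth x j) <= 1) ->
     is_tmpl v p log n x (Li x))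
  (z : K) (z_prim : p.-primitive_root z) (a : K) (a1 : v a <= 1)
  (a_off : off v [seq pole_val xi j | j <- iota 0 r] a) :
  ell (Some a) = (p%:R ^+ r)^-1 *
  \sum_(alpha : r.-tuple 'I_p | [forall j, (0 < tnth alpha j)%N])
    \sum_(b : r.-tuple 'I_p)
      (\prod_(j < r) (z ^+ tnth b j) ^- tnth alpha j) * Li (twist z xi b) (Some a).
Proof.
have [ell_rigid ell_series] := hell.
set T := [seq pole_val xi j | j <- iota 0 r] in a_off.
have pK : (p%:R ^+ r : K) != 0.
  by rewrite expf_neq0 // (natK_neq0 p_prime KCp) // prime_gt0.
pose c (u : r.-tuple 'I_p * r.-tuple 'I_p) :=
  \prod_(j < r) (z ^+ tnth u.2 j) ^- tnth u.1 j.
pose P (u : r.-tuple 'I_p * r.-tuple 'I_p) := [forall j, (0 < tnth u.1 j)%N].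
pose rhs t := (p%:R ^+ r)^-1 *
  \sum_(u : r.-tuple 'I_p * r.-tuple 'I_p | P u) c u * Li (twist z xi u.2) (Some t).
suff main : ell (Some a) = rhs a.
  rewrite main /rhs; congr (_ * _); rewrite pair_big_dep /=.
  by apply: eq_bigl => u; rewrite andbT.
have zb b : v (z ^+ b) = 1 /\ v (z ^+ b - 1) < 1.
  by apply: root_unity_congr1; rewrite exprAC (prim_expr_order z_prim) expr1n.
have twist_unit (b : r.-tuple 'I_p) j : v (tnth (twist z xi b) j) = 1.
  by rewrite tnth_mktuple (avM KCp) hxi mulr1; have [] := zb (tnth b j).
have LiP (b : r.-tuple 'I_p) : is_tmpl v p log n (twist z xi b) (Li (twist z xi b)).
  by apply: hLi => j; rewrite twist_unit.
have open_disc t : v t < 1 -> ell (Some t) = rhs t.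
  move=> t1; rewrite /rhs mulr_sumr.
  under eq_bigr => u _ do rewrite mulrA.
  have ell_lim := ell_series t t1.
  have Li_lim (u : r.-tuple 'I_p * r.-tuple 'I_p) :
    (fun N => v (\sum_(k < N) mcoef (rev (zip n (twist z xi u.2))) k * t ^+ k -
      Li (twist z xi u.2) (Some t))) @ \oo --> (0 : R).
    have [|_ ser] := tmpl_series p_prime KCp (LiP u.2).
      by move=> x /tnthP[j ->]; rewrite twist_unit.
    exact: ser.
  apply: (av_lim_unique KCp ell_lim).
  have -> : rigid_tmpl_partial p n xi t = fun N =>
      \sum_(u | P u) ((p%:R ^+ r)^-1 * c u) *
        \sum_(k < N) mcoef (rev (zip n (twist z xi u.2))) k * t ^+ k.
    apply/funext => N; apply: (mulfI pK).
    rewrite (rigid_tmpl_partial_twist p_prime z_prim) // pair_big_dep mulr_sumr /=.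
    by apply: eq_big => [u|u _]; rewrite ?andbT // !mulrA mulfV // mul1r.
  exact: av_lim_lin (Li_lim).
have [a_lt1|a_ge1] := ltP (v a) 1; first exact: open_disc.
have {a1} va : v a = 1 by apply/le_anti; rewrite a1.
have xi_nth i : (i < size xi)%N -> v xi`_i = 1.
  by rewrite size_tuple => ir; rewrite -(tnth_nth 0 xi (Ordinal ir)).
have xi_congr i : (i < size xi)%N -> [/\ v xi`_i = 1, v xi`_i = 1 & v (xi`_i - xi`_i) < 1].
  by move=> ix; rewrite subrr (av0 KCp) xi_nth.
have TE : T = [seq pole_val xi j | j <- iota 0 (size xi)] by rewrite size_tuple.
have T_unit s : s \in T -> v s = 1.
  by rewrite TE => /mapP[j _ ->]; have [] := pole_val_congr j (erefl (size xi)) xi_congr.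
have twist_congr (b : r.-tuple 'I_p) i : (i < size xi)%N ->
    [/\ v xi`_i = 1, v (twist z xi b)`_i = 1 & v (xi`_i - (twist z xi b)`_i) < 1].
  rewrite size_tuple => ir.
  rewrite -(tnth_nth 0 xi (Ordinal ir)) -(tnth_nth 0 (twist z xi b) (Ordinal ir)).
  rewrite hxi twist_unit; split=> //.
  rewrite tnth_mktuple -{1}[tnth xi _]mul1r -mulrBl (avM KCp) hxi mulr1 (avBC KCp).
  by have [] := zb (tnth b (Ordinal ir)).
have sz (b : r.-tuple 'I_p) : size xi = size (twist z xi b) by rewrite !size_tuple.
have T_le1 s : s \in T -> v s <= 1 by move=> /T_unit ->.
have [m [m0 T_frob m_min]] := exists_min_period p_prime KCp T_le1.
have ell_coef : coef_fun v T (fun t => ell (Some t)).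
  (* The radius is arbitrary, since [ell] is rigid on the whole residue disc of 0. *)
  have [h0 h1] := @half_01 R; exists 2^-1; split=> // mu _ mu1 e e0.
  have [P' [Q' [_ HQ HP]]] := ell_rigid e e0; exists P', Q'.
  have shell_off t : shell v T mu t -> off_tube v (poles xi) (Some t).
    move=> [_ t1 tT] s; rewrite polesE => [|x /(nthP 0)[i ix <-]]; last exact: xi_nth.
    move=> /mapP[j jin ->]; set b := pole_val xi j.
    have bT : b \in T by rewrite TE map_f.
    rewrite /red_eq /= (T_unit b bT) lexx t1 /= -leNgt (avBC KCp).
    exact: tT.
  split=> t /shell_off Ht; first exact: (HQ _ Ht).
  exact/ltW/(HP _ Ht).
(* Using [coleman_good] once per twist accumulates all the polylogarithms in a single good
   module. *)
have family (bs : seq (r.-tuple 'I_p)) : exists W, [/\ good_module v p T m W,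
    forall f, coef_fun v T f -> W f &
    forall b, b \in bs -> W (fun t => Li (twist z xi b) (Some t))].
  elim: bs => [|b bs [W [gW coefW HW]]].
    exists (coef_fun v T); split=> //.
    exact: coef_fun_good.
  have TS s : s \in T -> exists2 b', Some b' \in tmpl_sing (twist z xi b) & v (b' - s) < 1.
    rewrite TE => /mapP[j jin ->]; exists (pole_val (twist z xi b) j).
      rewrite !inE polesE => [|x /tnthP[i ->]]; last by rewrite twist_unit.
      by rewrite -sz map_f ?orbT.
    rewrite (avBC KCp).
    by have [] := pole_val_congr j (sz b) (twist_congr b).
  have [W' [gW' WW' W'b]] := coleman_good p_prime KCp T_unit
    (fun t s => tmpl_sing_red (sz b) (twist_congr b) TE) TS T_frob m_min
    (is_tmpl_coleman (LiP b)) gW.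
  exists W'; split=> // [f /coefW/WW' //|b'].
  by rewrite inE => /orP[/eqP->|/HW/WW'].
have [W [gW coefW HW]] := family (index_enum (r.-tuple 'I_p)).
have WH : W (fun t => ell (Some t) - rhs t).
  apply: (good_sub KCp gW); first exact: coefW.
  apply: (good_scale KCp _ gW); apply: (good_sum _ _ gW) => u.
  by apply: (good_scale KCp _ gW); apply: HW; apply: mem_index_enum.
apply/eqP; rewrite -subr_eq0; apply/eqP.
apply: (good_identity gW WH (@ltr01 R)) => // t _ t1.
by rewrite open_disc // subrr.
Qed.

End Main.

Theorem theorem4p35 (R : realType) (K : closedFieldType) (v : K -> R)
  (p : nat) (p_prime : prime p) (KCp : is_Cp v p)
  (varpi : K) (log : K -> K) (hlog : is_log_branch v p varpi log)
  (r : nat) (r_gt0 : (0 < r)%N)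
  (n : r.-tuple nat) (n_gt0 : forall j, (0 < tnth n j)%N)
  (xi : r.-tuple K) (hxi : forall j, v (tnth xi j) = 1)
  (ell : option K -> K) (hell : is_rigid_tmpl v p n xi ell)
  (Li : r.-tuple K -> option K -> K)
  (hLi : forall x : r.-tuple K, (forall j, v (tnth x j) <= 1) ->
     is_tmpl v p log n x (Li x))
  (z : option K)
  (hz : forall s, s \in tmpl_sing xi ->
     ~~ red_eq v s (Some 0) -> ~~ red_eq v s z) :
  ell z =
  (p%:R ^+ r)^-1 *
  \sum_(alpha : r.-tuple 'I_p | [forall j, (0 < tnth alpha j)%N])
    \sum_(rho \in [set rho : r.-tuple K | forall j, tnth rho j ^+ p = 1])
      (\prod_(j < r) tnth rho j ^- tnth alpha j) *
      Li [tuple tnth rho j * tnth xi j | j < r] z.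
Proof.
(* Infinity belongs to S_r and does not reduce to 0, so its residue disc is removed. *)
have z_int : integral v z.
  apply/negPn/negP => /negPf z_inf.
  have := hz None; rewrite !inE /red_eq /= (av0 KCp) ler01 => /(_ isT isT).
  by rewrite z_inf.
case: z hz z_int => // a hz /= a1.
have xi1 x : x \in (xi : seq K) -> v x = 1 by move=> /tnthP[j ->].
(* The poles are units, so their residue discs differ from that of 0 and are removed as well. *)
have a_off : off v [seq pole_val xi j | j <- iota 0 r] a.
  move=> s /mapP[j jr ->]; set b := pole_val xi j.
  have b1 : v b = 1.
    have [] // := @pole_val_congr _ _ _ _ KCp xi xi j erefl _ => i ix.
    by rewrite subrr (av0 KCp) xi1 // mem_nth.
  have /hz : Some b \in tmpl_sing xi.
    by rewrite !inE (polesE KCp xi1) size_tuple map_f ?orbT.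
  rewrite /red_eq /= b1 (av0 KCp) ler01 lexx a1 /= subr0 b1 ltxx => /(_ isT).
  by rewrite -leNgt (avBC KCp).
have [w w_prim] := prim_root_exists p_prime KCp.
rewrite (polylog_identity p_prime KCp r_gt0 hxi hell hLi w_prim a1 a_off).
congr (_ * _); apply: eq_bigr => alpha _.
rewrite (sum_roots_unity w_prim); apply: eq_bigr => b _; congr (_ * Li _ _).
  by apply: eq_bigr => j _; rewrite tnth_mktuple.
by apply: eq_from_tnth => j; rewrite !tnth_mktuple.
Qed.
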